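(* Let $G$ be an abelian group, let $\mathcal D$ be a finite-dimensional real $G$-graded division algebra whose center $Z(\mathcal D)$ is isomorphic to $\mathbb C$ or to $\mathbb R\times\mathbb R$ and is nontrivially graded, and let $\varphi_0$ be a degree-preserving involution on $\mathcal D$ that restricts to the conjugation on $\mathcal D_e$ and satisfies $\varphi_0|_{Z(\mathcal D)}\ne\mathrm{id}$. Let $f$ be the distinguished element (so the support of $Z(\mathcal D)$ is $\{e,f\}$) and pick $\nu\in\mathrm{Hom}(K,\{\pm1\})$ such that $\nu(f)=-1$. Let $(g_0,\kappa,\sigma),(g_0',\kappa',\sigma')\in\mathsf X(G,\mathcal D,\varphi_0,1)$. Then the graded algebras with involution $M(\mathcal D,\varphi_0,g_0,\kappa,\sigma,1)$ and $M(\mathcal D,\varphi_0,g_0',\kappa',\sigma',1)$ are isomorphic if and only if $(g_0',\kappa',\sigma')$ lies in the same $G\times\{\pm1\}$-orbit as $(g_0,\kappa,\sigma)$ or $(g_0,\kappa,\nu\sigma)$, where $(\nu\sigma)(x)=\nu(g_0\xi(x)^2)\sigma(x)$.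
   Context: $G$ is written multiplicatively, with identity $e$. A graded division algebra is a unital (nonzero) associative $G$-graded algebra in which every nonzero homogeneous element is invertible; its support $T$ is a subgroup of $G$. Here $\mathcal D_e\cong\mathbb R,\mathbb C$ or $\mathbb H$; the center is a graded subalgebra, and in the present situation its support is $\{e,f\}$ with $f\in K$ of order $2$; $f$ is called the distinguished element. Isomorphisms of graded algebras with involution preserve degrees and intertwine the involutions. Conjugation on $\mathcal D_e=\mathbb R$ means the identity. Notation. $K=T$ if $\mathcal D_e=\mathbb R$ or $\mathcal D_e\cong\mathbb H$, and $K=\{t\in T\mid \mathcal D_t \text{ commutes elementwise with }\mathcal D_e\}$ if $\mathcal D_e\cong\mathbb C$. For each $t\in T$ fix $0\ne X_t\in\mathcal D_t$ such that: $X_t$ commutes with $\mathcal D_e$ if $\mathcal D_e\cong\mathbb H$; $\varphi_0(X_t)=X_t$ if $\mathcal D_e\cong\mathbb C$ and $t\in K$ (such choices exist). Then $\varphi_0(X_t)=\eta(t)X_t$ with $\eta(t)\in\{\pm1\}$. Fix a section $\xi:G/T\to G$ of the quotient map. For $g_0\in G$ let $(G/T)_{g_0}=\{gT\mid g_0g^2\in T\}$ and $\tau(x)=g_0\xi(x)^2\in T$ for $x\in(G/T)_{g_0}$. Admissible multiplicity function (for $g_0$): a map $\kappa:G/T\to\mathbb Z_{\ge0}$ (not identically zero) with finite support such that $\kappa(g_0^{-1}x^{-1})=\kappa(x)$ for all $x$; if $\mathcal D_e=\mathbb R$, $\kappa(x)$ is even whenever $x\in(G/T)_{g_0}$ and $\eta(\tau(x))=-1$;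 if $\mathcal D_e\cong\mathbb C$, $\kappa(x)$ is even whenever $x\in(G/T)_{g_0}$, $\tau(x)\in T\setminus K$ and $\eta(\tau(x))=-1$. Write $|\kappa|=\sum_x\kappa(x)$. Signature function for $(g_0,\kappa)$: a map $\sigma:G/T\to\mathbb Z$ with $|\sigma(x)|\le\kappa(x)$ for all $x$, and: if $\mathcal D_e=\mathbb R$ or $\cong\mathbb H$, then $\sigma(x)\equiv\kappa(x)\pmod 2$ when $x\in(G/T)_{g_0}$ and $\eta(\tau(x))=1$, and $\sigma(x)=0$ otherwise; if $\mathcal D_e\cong\mathbb C$, then $\sigma(x)\equiv\kappa(x)\pmod2$ when $x\in(G/T)_{g_0}$ and $\tau(x)\in K$, and $\sigma(x)=0$ otherwise. (Hence $\nu\sigma$ is well defined: $\nu\sigma(x)=0$ when $\sigma(x)=0$.) $\mathsf X(G,\mathcal D,\varphi_0,1)$ is the set of triples $(g_0,\kappa,\sigma)$ with $g_0\in G$, $\kappa$ an admissible multiplicity function for $g_0$, $\sigma$ a signature function for $(g_0,\kappa)$. $M(\mathcal D,\varphi_0,g_0,\kappa,\sigma,1)$: let $x_1,\dots,x_s$ be the distinct elements of the support of $\kappa$, ordered so that $x_1,\dots,x_m\in(G/T)_{g_0}$ and the others come in pairs with $x_{m+2j-1}x_{m+2j}=g_0^{-1}T$, $j=1,\dots,r$, $m+2r=s$. Let $g_i=\xi(x_i)$, $k_i=\kappa(x_i)$, $k=|\kappa|$. The algebra is $M_k(\mathcal D)=M_k(\mathbb R)\otimes\mathcal D$, partitioned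 into $s^2$ blocks according to $k=k_1+\dots+k_s$, with $\deg(E\otimes d)=g_itg_j^{-1}$ for a matrix unit $E$ in the $(i,j)$ block and $d\in\mathcal D_t$. The involution is $\varphi(X)=\Phi^{-1}\varphi_0(X^T)\Phi$ ($\varphi_0$ applied entrywise), where $\Phi=X_{t_1}S_1\oplus\dots\oplus X_{t_{m+r}}S_{m+r}$ with: for $1\le j\le r$, $t_{m+j}=g_0g_{m+2j-1}g_{m+2j}$ and $S_{m+j}=\begin{pmatrix}0&I_{k_{m+2j}}\\ \eta(t_{m+j})I_{k_{m+2j}}&0\end{pmatrix}$; for $1\le i\le m$, $t_i=\tau(x_i)$ and - if $\mathcal D_e=\mathbb R$ or $\cong\mathbb H$ with $\eta(t_i)=1$, or $\mathcal D_e\cong\mathbb C$ with $t_i\in K$: $S_i=\mathrm{diag}(I_{p_i},-I_{q_i})$ with $p_i=\frac12(\kappa(x_i)+\sigma(x_i))$, $q_i=\frac12(\kappa(x_i)-\sigma(x_i))$; - if $\mathcal D_e=\mathbb R$ with $\eta(t_i)=-1$, or $\mathcal D_e\cong\mathbb C$ with $t_i\in T\setminus K$, $\eta(t_i)=-1$: $S_i=\begin{pmatrix}0&I_{k_i/2}\\-I_{k_i/2}&0\end{pmatrix}$; - if $\mathcal D_e\cong\mathbb C$ with $t_i\in T\setminus K$, $\eta(t_i)=1$: $S_i=I_{k_i}$; - if $\mathcal D_e\cong\mathbb H$ with $\eta(t_i)=-1$: $S_i=\mathbf i I_{k_i}$, $\mathbf i$ a fixed imaginary unit in $\mathcal D_e$.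 Actions on $\mathsf X(G,\mathcal D,\varphi_0,1)$: $\epsilon\in\{\pm1\}$ acts by $\epsilon\cdot(g_0,\kappa,\sigma)=(g_0,\kappa,\epsilon\sigma)$; $g\in G$ acts by $g\cdot(g_0,\kappa,\sigma)=(g^{-2}g_0,g\cdot\kappa,\underline\sigma)$, where $(g\cdot\kappa)(x)=\kappa(g^{-1}x)$ and $\underline\sigma(x)=\eta(u)\,\mathrm{sign}\big(X_{tu^2}^{-1}X_uX_tX_u\big)\sigma(g^{-1}x)$, with $t=g_0\xi(g^{-1}x)^2$ and $u=\xi(g^{-1}x)^{-1}g^{-1}\xi(x)\in T$ (if $\sigma(g^{-1}x)=0$ then $\underline\sigma(x)=0$; otherwise $t\in K$ and the element whose sign is taken is a nonzero real number). *)

(* Defs.v *)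
(* The grading group G is an abelian group written additively, i.e. a zmodType:
   g0 g^2 becomes g0 + g *+ 2, and g^-1 x becomes x - g. *)
From HB Require Import structures.
From mathcomp Require Import all_boot all_order all_algebra all_field ring.
From mathcomp Require Import boolp classical_sets reals.
From mathcomp Require Import complex.

Set Implicit Arguments.
Unset Strict Implicit.
Unset Printing Implicit Defensive.

Import Order.TTheory GRing.Theory Num.Theory.
Local Open Scope ring_scope.
Local Open Scope quotient_scope.

Record quaternion (R : Type) := Quat { q_re : R; q_i : R; q_j : R; q_k : R }.

Section Quaternions.
Variable R : fieldType.
Local Notation H := (quaternion R).

Definition quat_tuple (x : H) := (q_re x, q_i x, q_j x, q_k x).
Definition tuple_quat (x : R * R * R * R) : H :=
  let: (a, b, c, d) := x in Quat a b c d.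
Lemma quat_tupleK : cancel quat_tuple tuple_quat. Proof. by case. Qed.
HB.instance Definition _ := Equality.copy H (can_type quat_tupleK).
HB.instance Definition _ := Choice.copy H (can_type quat_tupleK).

Definition quat_add (x y : H) :=
  Quat (q_re x + q_re y) (q_i x + q_i y) (q_j x + q_j y) (q_k x + q_k y).
Definition quat_opp (x : H) := Quat (- q_re x) (- q_i x) (- q_j x) (- q_k x).
Definition quat_scale (r : R) (x : H) :=
  Quat (r * q_re x) (r * q_i x) (r * q_j x) (r * q_k x).
Definition quat_mul (x y : H) :=
  let: Quat a b c d := x in let: Quat a' b' c' d' := y in
  Quat (a * a' - b * b' - c * c' - d * d')
       (a * b' + b * a' + c * d' - d * c')
       (a * c' - b * d' + c * a' + d * b')
       (a * d' + b * c' - c * b' + d * a').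
Definition quat_conj (x : H) := Quat (q_re x) (- q_i x) (- q_j x) (- q_k x).

Lemma quat_addA : associative quat_add.
Proof. by case=> a b c d [? ? ? ?] [? ? ? ?]; congr Quat => /=; ring. Qed.
Lemma quat_addC : commutative quat_add.
Proof. by case=> a b c d [? ? ? ?]; congr Quat => /=; ring. Qed.
Lemma quat_add0 : left_id (Quat 0 0 0 0) quat_add.
Proof. by case=> a b c d; congr Quat => /=; ring. Qed.
Lemma quat_addN : left_inverse (Quat 0 0 0 0) quat_opp quat_add.
Proof. by case=> a b c d; congr Quat => /=; ring. Qed.
HB.instance Definition _ :=
  GRing.isZmodule.Build H quat_addA quat_addC quat_add0 quat_addN.

Lemma quat_mulA : associative quat_mul.
Proof. by case=> a b c d [? ? ? ?] [? ? ? ?]; congr Quat => /=; ring. Qed.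
Lemma quat_mul1l : left_id (Quat 1 0 0 0) quat_mul.
Proof. by case=> a b c d; congr Quat => /=; ring. Qed.
Lemma quat_mul1r : right_id (Quat 1 0 0 0) quat_mul.
Proof. by case=> a b c d; congr Quat => /=; ring. Qed.
Lemma quat_mulDl : left_distributive quat_mul +%R.
Proof. by case=> a b c d [? ? ? ?] [? ? ? ?]; congr Quat => /=; ring. Qed.
Lemma quat_mulDr : right_distributive quat_mul +%R.
Proof. by case=> a b c d [? ? ? ?] [? ? ? ?]; congr Quat => /=; ring. Qed.
Lemma quat_1neq0 : Quat 1 0 0 0 != 0 :> H.
Proof. by apply/eqP => -[] /eqP; rewrite oner_eq0. Qed.
HB.instance Definition _ := GRing.Zmodule_isNzRing.Build H
  quat_mulA quat_mul1l quat_mul1r quat_mulDl quat_mulDr quat_1neq0.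

Lemma quat_scaleA (r s : R) (x : H) :
  quat_scale r (quat_scale s x) = quat_scale (r * s) x.
Proof. by case: x => a b c d; congr Quat => /=; ring. Qed.
Lemma quat_scale1 : left_id 1 quat_scale.
Proof. by case=> a b c d; congr Quat => /=; ring. Qed.
Lemma quat_scaleDr : right_distributive quat_scale +%R.
Proof. by move=> r [a b c d] [? ? ? ?]; congr Quat => /=; ring. Qed.
Lemma quat_scaleDl x : {morph quat_scale^~ x : r s / r + s}.
Proof. by case: x => a b c d r s; congr Quat => /=; ring. Qed.
HB.instance Definition _ := GRing.Zmodule_isLmodule.Build R H
  quat_scaleA quat_scale1 quat_scaleDr quat_scaleDl.

Lemma quat_scaleAl (r : R) (x y : H) : r *: (x * y) = (r *: x) * y.
Proof. by case: x y => a b c d [? ? ? ?]; congr Quat => /=; ring. Qed.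
HB.instance Definition _ := GRing.Lmodule_isLalgebra.Build R H quat_scaleAl.

End Quaternions.

Section SubalgebraTypes.
Variables (R : realType) (D : falgType R).

Definition alg_iso_onto (A : lalgType R) (U : {vspace D})
    (f : {lrmorphism A -> D}) : Prop :=
  injective f /\ forall d, d \in U <-> exists a, f a = d.

Definition isoR (U : {vspace D}) : bool := U == 1%VS.
Definition isoC (U : {vspace D}) : bool :=
  `[< exists f : {lrmorphism Rcomplex R -> D}, alg_iso_onto U f >].
Definition isoH (U : {vspace D}) : bool :=
  `[< exists f : {lrmorphism quaternion R -> D}, alg_iso_onto U f >].
Definition isoRxR (U : {vspace D}) : bool :=
  `[< exists f : {lrmorphism (R^o * R^o)%type -> D}, alg_iso_onto U f >].

(* Both conjugations are invariant under automorphisms of C and H, so it does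
   not matter which identification f of U with C or H is used. *)
Definition restricts_to_conj (phi : D -> D) (U : {vspace D}) : Prop :=
  [/\ isoR U -> {in U, phi =1 id},
      forall f : {lrmorphism Rcomplex R -> D},
        alg_iso_onto U f -> forall z : Rcomplex R, phi (f z) = f (conjc z)
    & forall f : {lrmorphism quaternion R -> D},
        alg_iso_onto U f -> forall q, phi (f q) = f (quat_conj q)].

(* The sign of r for d = r *: 1 with r real (0 if d is not real). *)
Definition real_sign (d : D) : int :=
  sgz (xget 0 [set r : R | d = r%:A]%classic).

End SubalgebraTypes.

(* Finite-dimensional real G-graded division algebras.  homog_direct and
   homog_total say that D is the direct sum of the components homog g: the
   finite sums of components are direct, and some finite sum is all of D. *)
Record gradedDivAlg (R : realType) (G : zmodType) := GradedDivAlg {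
  gda_sort :> falgType R;
  homog : G -> {vspace gda_sort};
  homog_direct : forall s : seq G, uniq s -> directv (\sum_(g <- s) homog g);
  homog_total : exists s : seq G, (\sum_(g <- s) homog g)%VS = fullv;
  homog1 : 1 \in homog 0;
  homogM : forall g h, {in homog g & homog h, forall a b, a * b \in homog (g + h)};
  homog_unit : forall g, {in homog g, forall a, a != 0 -> a \is a GRing.unit}
}.

Section Support.
Variables (R : realType) (G : zmodType) (D : gradedDivAlg R G).

Definition supp : {pred G} := [pred g | homog D g != 0%VS].

Lemma suppP g : reflect (exists2 d, d \in homog D g & d != 0) (g \in supp).
Proof.
rewrite inE -vpick0; apply: (iffP idP) => [nz | [d dg nz]].
  by exists (vpick (homog D g)); rewrite ?memv_pick.
rewrite vpick0; apply: contraNneq nz => g0.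
by move: dg; rewrite g0 memv0.
Qed.

Lemma supp0 : 0 \in supp.
Proof. by apply/suppP; exists 1; rewrite ?oner_eq0 ?homog1. Qed.

Lemma suppD g h : g \in supp -> h \in supp -> g + h \in supp.
Proof.
move=> /suppP[a ag a0] /suppP[b bh b0]; apply/suppP; exists (a * b).
  exact: homogM.
by rewrite mulrI_eq0 //; apply/mulrI/(homog_unit ag).
Qed.

Lemma suppN b : b \in supp -> - b \in supp.
Proof.
move=> /suppP[d db d0]; have dU := homog_unit db d0.
apply: contraT; rewrite inE negbK => /eqP hNb.
have [s0 s0T] := homog_total D.
pose s := [seq g <- undup s0 | g != - b].
have us : uniq s by rewrite filter_uniq ?undup_uniq.
have sT : (\sum_(g <- s) homog D g)%VS = fullv.
  apply/eqP; rewrite eqEsubv subvf /= -s0T big_seq.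
  apply: (big_ind (fun U => U <= \sum_(g <- s) homog D g)%VS) => [|U V hU hV|g gs0].
  - exact: sub0v.
  - by rewrite subv_add hU.
  have [->|gb] := eqVneq g (- b); first by rewrite hNb sub0v.
  by rewrite (big_rem g) ?addvSl // mem_filter gb mem_undup.
pose s' := [seq b + g | g <- s].
have us' : uniq (0 :: s').
  rewrite /= map_inj_uniq ?us ?andbT; last exact: addrI.
  apply/mapP => -[g]; rewrite mem_filter => /andP[/eqP gb _] /esym/eqP.
  by rewrite addrC addr_eq0 => /eqP.
have in1 : 1 \in (\sum_(h <- s') homog D h)%VS.
  rewrite big_map -(divrr dU) -[d / d]/(d * d^-1).
  have: d^-1 \in (\sum_(g <- s) homog D g)%VS by rewrite sT memvf.
  move/(memv_img (amull d)); rewrite lfunE /= limg_sum.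
  apply: subvP; apply: (big_ind2 (fun U V => U <= V)%VS) => [|U U' V V'|g _].
  - exact: subvv.
  - exact: addvS.
  by apply/subvP => _ /memv_imgP[v vg ->]; rewrite lfunE /= homogM.
have := homog_direct D us'; rewrite directvE /= !big_cons /= => /eqP dimE.
have := dimv_sum_cap (homog D 0) (\sum_(h <- s') homog D h)%VS.
rewrite dimE -addnA => /eqP; rewrite eqn_add2l => /eqP E0.
have := dimv_leq_sum s' predT (homog D).
rewrite -[X in (X <= _)%N]E0 -{2}[(\sum_(_ <- _) _)%N]addn0 leq_add2l leqn0.
rewrite dimv_eq0 => /eqP cap0.
have: 1 \in (homog D 0 :&: \sum_(h <- s') homog D h)%VS by rewrite memv_cap homog1.
by rewrite cap0 memv0 oner_eq0.
Qed.

Lemma supp_zmod_closed : zmod_closed supp.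
Proof.
by split=> [|g h gT hT]; [exact: supp0 | apply: suppD => //; exact: suppN].
Qed.
HB.instance Definition _ := GRing.isZmodClosed.Build G supp supp_zmod_closed.

End Support.

Section Classification.
Variables (R : realType) (G : zmodType) (D : gradedDivAlg R G).

Local Notation De := (homog D 0).
Local Notation T := (supp D).
Definition GmodT : zmodType := Quotient.quot T.
Definition piT (g : G) : GmodT := \pi_(Quotient.quot T) g.

Definition center_condition : Prop :=
  isoC 'Z({:D}) || isoRxR 'Z({:D}) /\ ~~ ('Z({:D}) <= De)%VS.

Definition inK : {pred G} :=
  [pred t | (t \in T) && (isoC De ==> (homog D t <= 'C(De))%VS)].

Definition degree_preserving_involution (phi0 : {linear D -> D}) : Prop :=
  [/\ involutive phi0,
      {morph phi0 : a b / a * b >-> b * a}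
    & forall g, {in homog D g, forall d, phi0 d \in homog D g}].

Section Data.
Variables (phi0 : D -> D) (X : G -> D).

Definition homogeneous_choice : Prop :=
  forall t, t \in T ->
    [/\ X t \in homog D t, X t != 0,
        isoH De -> X t \in 'C(De)%VS
      & isoC De -> t \in inK -> phi0 (X t) = X t].

(* For t in T one has phi0 (X t) = X t or phi0 (X t) = - X t. *)
Definition etaX (t : G) : int := if phi0 (X t) == X t then 1 else -1.

Variable xi : GmodT -> G.

(* x = gT satisfies g0 g^2 \in T. *)
Definition inGT (g0 : G) (x : GmodT) : bool := piT g0 + x *+ 2 == 0.

Definition tau (g0 : G) (x : GmodT) : G := g0 + xi x *+ 2.

Definition admissible_mult (g0 : G) (kappa : GmodT -> nat) : Prop :=
  [/\ exists x, kappa x != 0%N,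
      exists s : seq GmodT, forall x, kappa x != 0%N -> x \in s,
      forall x, kappa (- piT g0 - x) = kappa x,
      isoR De -> forall x, inGT g0 x -> etaX (tau g0 x) = -1 -> ~~ odd (kappa x)
    & isoC De -> forall x, inGT g0 x -> tau g0 x \notin inK ->
        etaX (tau g0 x) = -1 -> ~~ odd (kappa x)].

Definition signature (g0 : G) (kappa : GmodT -> nat) (sigma : GmodT -> int) :
    Prop :=
  [/\ forall x, (absz (sigma x) <= kappa x)%N,
      isoR De || isoH De -> forall x,
        if inGT g0 x && (etaX (tau g0 x) == 1)
        then (sigma x = kappa x %[mod 2])%Z else sigma x = 0
    & isoC De -> forall x,
        if inGT g0 x && (tau g0 x \in inK)
        then (sigma x = kappa x %[mod 2])%Z else sigma x = 0].

Record datum := Datum {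
  dat_g0 : G;
  dat_kappa : GmodT -> nat;
  dat_sigma : GmodT -> int
}.

(* The set X(G, D, phi0, 1). *)
Definition valid_datum (d : datum) : Prop :=
  admissible_mult (dat_g0 d) (dat_kappa d) /\
  signature (dat_g0 d) (dat_kappa d) (dat_sigma d).

Definition sign_act (eps : int) (d : datum) : datum :=
  Datum (dat_g0 d) (dat_kappa d) (fun x => eps * dat_sigma d x).

Definition group_act (g : G) (d : datum) : datum :=
  Datum (dat_g0 d - g *+ 2)
    (fun x => dat_kappa d (x - piT g))
    (fun x =>
       let y := x - piT g in
       let t := tau (dat_g0 d) y in
       let u := xi x - g - xi y in
       etaX u * real_sign ((X (t + u *+ 2))^-1 * X u * X t * X u)
         * dat_sigma d y).

Definition in_action_orbit (d d' : datum) : Prop :=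
  exists (g : G) (eps : int),
    (eps = 1 \/ eps = -1) /\ d' = group_act g (sign_act eps d).

Definition nu_twist (nu : G -> int) (d : datum) : datum :=
  Datum (dat_g0 d) (dat_kappa d)
    (fun x => nu (tau (dat_g0 d) x) * dat_sigma d x).

(* nu restricts to a homomorphism K -> {1, -1}; values off K are irrelevant. *)
Definition sign_character (nu : G -> int) : Prop :=
  {in inK, forall t, nu t = 1 \/ nu t = -1} /\
  {in inK &, {morph nu : s t / s + t >-> s * t}}.

(* An ordering of the support of kappa: first the x_i in (G/T)_{g0}, listed in
   ms, then the pairs ps with product g0^-1 T.  By uniqueness no component of
   such a pair lies in (G/T)_{g0}. *)
Definition support_seq (ms : seq GmodT) (ps : seq (GmodT * GmodT)) :
    seq GmodT :=
  ms ++ flatten [seq [:: p.1; p.2] | p <- ps].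

Definition support_ordering (d : datum) (ms : seq GmodT)
    (ps : seq (GmodT * GmodT)) : Prop :=
  [/\ uniq (support_seq ms ps),
      forall x, (x \in support_seq ms ps) = (dat_kappa d x != 0%N),
      all (inGT (dat_g0 d)) ms
    & all (fun p => p.1 + p.2 == - piT (dat_g0 d)) ps].

Variable qi : D.

(* A block, together with its size. *)
Local Notation block := {n : nat & 'M[D]_n}.
Local Notation mk_block A := (Tagged (fun n : nat => 'M[D]_n) A).

Definition block_single (d : datum) (x : GmodT) : block :=
  let t := tau (dat_g0 d) x in
  let k := dat_kappa d x in
  let p := absz ((k%:Z + dat_sigma d x) %/ 2)%Z in
  let q := absz ((k%:Z - dat_sigma d x) %/ 2)%Z in
  if ((isoR De || isoH De) && (etaX t == 1)) || (isoC De && (t \in inK)) then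
    mk_block (X t *: block_mx (1%:M : 'M_p) 0 0 (- 1%:M : 'M_q))
  else if (isoR De || isoC De) && (etaX t == -1) then
    mk_block (X t *: block_mx (0 : 'M_(k./2)) 1%:M (- 1%:M) 0)
  else if isoC De then mk_block (X t *: (1%:M : 'M_k))
  else mk_block (X t *: (qi%:M : 'M_k)).

Definition block_pair (d : datum) (p : GmodT * GmodT) : block :=
  let t := dat_g0 d + xi p.1 + xi p.2 in
  let k := dat_kappa d p.2 in
  mk_block (X t *: block_mx (0 : 'M_k) 1%:M ((etaX t)%:~R%:M) 0).

Definition blocks (d : datum) ms ps : seq block :=
  map (block_single d) ms ++ map (block_pair d) ps.

(* For a valid datum and a support ordering this is |kappa|. *)
Definition mx_dim (bs : seq block) : nat :=
  \sum_(b < size bs) tag (tnth (in_tuple bs) b).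

Definition mx_Phi (bs : seq block) : 'M[D]_(mx_dim bs) :=
  \mxdiag_(b < size bs) tagged (tnth (in_tuple bs) b).

(* invmx is restricted to commutative rings, hence this version. *)
Definition mx_inverse n (A : 'M[D]_n) : 'M[D]_n :=
  xget 0 [set B : 'M[D]_n | A *m B = 1%:M /\ B *m A = 1%:M]%classic.

(* The list of the g_i, each repeated k_i times. *)
Definition row_degrees (d : datum) ms ps : seq G :=
  flatten [seq nseq (dat_kappa d x) (xi x) | x <- support_seq ms ps].

(* A graded algebra with involution whose underlying algebra is M_n(D). *)
Record gradedInvMx := GradedInvMx {
  gim_dim : nat;
  gim_homog : G -> 'M[D]_gim_dim -> Prop;
  gim_inv : 'M[D]_gim_dim -> 'M[D]_gim_dim
}.

(* M(D, phi0, g0, kappa, sigma, 1).  As deg (E_ij (x) d) = g_i t g_j^-1 for d of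
   degree t, a matrix is of degree g iff its (i, j) entry is of degree
   g_i^-1 g g_j for all i, j. *)
Definition model (d : datum) ms ps : gradedInvMx :=
  let bs := blocks d ms ps in
  let r := row_degrees d ms ps in
  let Phi := mx_Phi bs in
  @GradedInvMx (mx_dim bs)
    (fun g A => forall i j, A i j \in homog D (- r`_i + g + r`_j))
    (fun A => mx_inverse Phi *m map_mx phi0 A^T *m Phi).

(* In M_n(D), c%:A *: A is the product of A by the real scalar c. *)
Definition isomorphic (M N : gradedInvMx) : Prop :=
  exists F : {rmorphism 'M[D]_(gim_dim M) -> 'M[D]_(gim_dim N)},
    [/\ bijective F,
        forall (c : R) A, F (c%:A *: A) = c%:A *: F A,
        forall g A, gim_homog g A -> gim_homog g (F A)
      & forall A, F (gim_inv A) = gim_inv (F A)].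

End Data.
End Classification.

(* Main.v *)
(* A graded isomorphism of the two matrix algebras has the form
   A |-> P psi(A) P^-1, where psi is a graded automorphism of D and P has
   homogeneous entries.  On K the signs beta(s,t) = X_s X_t X_s^-1 X_t^-1 form
   a bicharacter with radical {0, f}, and psi(X_t) = chi(t) X_t with chi(f) = 1
   or -1, so orthogonality of the characters beta(.,s) produces s in K such
   that, after composing psi with the inner automorphism of X_s, chi is either
   trivial or nu; this is how nu enters.  Preservation of the involutions then
   says that P is an isometry, up to a real factor w, between psi(Phi) and Phi'.
   Degrees give g_0' = g_0 g^-2, counting rows gives kappa', and Sylvester's law
   of inertia on each class of rows gives sigma' up to the sign of w.
   Conversely nu extends from K to a character of T, which defines psi, and for
   data in one orbit a monomial isometry P is written down class by class. *)
Require Import Defs.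
From HB Require Import structures.
From mathcomp Require Import all_boot all_order all_algebra all_field ring lra zify.
From mathcomp Require Import boolp classical_sets reals.
From mathcomp Require Import complex.

Set Implicit Arguments.
Unset Strict Implicit.
Unset Printing Implicit Defensive.

Import Order.TTheory GRing.Theory Num.Theory.
Local Open Scope ring_scope.

(** The recurring tool is that a nonzero homogeneous central element fixed by [phi0] is a real
    scalar of degree 0: since [phi0] is not the identity on the center, it acts by -1 on the central
    line of degree f. Applied to X_u^2, this makes T an elementary abelian 2-group, so that -u may
    be read as u throughout. Applied to the central factor relating psi(Phi) to the transported
    Phi', it makes that factor real and excludes degree f, which is why g_0' = g_0 g^-2 holds
    exactly and not just up to f. The complications come from D_e = C: elements outside K conjugate
    D_e, so commutation signs exist only when one of the two degrees lies in K, and psi must first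
    be made trivial on D_e. In the converse only the classes with a signature obstruct a change of
    sign: in skew classes two halves are exchanged, for t outside K a square root in C absorbs any
    scalar, and in the quaternionic case an element anticommuting with i does. *)

(** * Additive identities in a commutative group *)

(* The trivial square-zero extension of int by G is a commutative ring that
   contains G as an additive subgroup, so [ring] can decide identities in G. *)
Definition square_zero_ext (G : zmodType) : Type := (int * G)%type.

Section SquareZeroExtension.
Variable G : zmodType.
Local Notation A := (square_zero_ext G).

HB.instance Definition _ := GRing.Zmodule.on A.

Definition sze_mul (x y : A) : A := (x.1 * y.1, y.2 *~ x.1 + x.2 *~ y.1).

Lemma sze_mulA : associative sze_mul.
Proof.
move=> [a g] [b h] [c k]; congr pair => /=; first exact: mulrA.
by rewrite !mulrzDl -!mulrzA addrA [b * a]mulrC [c * a]mulrC.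
Qed.

Lemma sze_mulC : commutative sze_mul.
Proof. by move=> [a g] [b h]; congr pair => /=; rewrite 1?mulrC // addrC. Qed.

Lemma sze_mul1 : left_id ((1, 0) : A) sze_mul.
Proof. by move=> [a g]; congr pair; rewrite /= ?mul1r // mul0rz mulr1z addr0. Qed.

Lemma sze_mulDl : left_distributive sze_mul +%R.
Proof.
move=> [a g] [b h] [c k]; congr pair; rewrite /= ?mulrDl //.
by rewrite mulrzDr mulrzDl addrACA.
Qed.

Lemma sze_1neq0 : ((1, 0) : A) != 0.
Proof. by []. Qed.

HB.instance Definition _ := GRing.Zmodule_isComNzRing.Build A
  sze_mulA sze_mulC sze_mul1 sze_mulDl sze_1neq0.

Definition sze_in (g : G) : A := (0, g).

Lemma sze_inD g h : sze_in (g + h) = sze_in g + sze_in h.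
Proof. by congr pair; rewrite /= addr0. Qed.

Lemma sze_inN g : sze_in (- g) = - sze_in g.
Proof. by congr pair; rewrite /= oppr0. Qed.

Lemma sze_in0 : sze_in 0 = 0. Proof. by []. Qed.

Lemma sze_in_inj : injective sze_in. Proof. by move=> g h []. Qed.

Definition sze_inE := (sze_inD, sze_inN, sze_in0).

End SquareZeroExtension.

Ltac abelian := rewrite ?mulr2n; apply: sze_in_inj; rewrite !sze_inE; ring.

(** * Graded components *)

Section Components.
Variables (R : realType) (G : zmodType) (D : gradedDivAlg R G).
Local Notation T := (supp D).

Lemma homog_independent (s : seq G) (a : G -> D) : uniq s ->
  (forall g, g \in s -> a g \in homog D g) -> \sum_(g <- s) a g = 0 ->
  forall g, g \in s -> a g = 0.
Proof.
move=> us ha sum0 g gs; have := homog_direct D us.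
rewrite directvE /= !(big_nth (0 : G)) !big_mkord => dimE.
have /directv_sum_independent : directv (\sum_(i < size s) homog D s`_i).
  by rewrite directvE.
move=> /(_ (fun i => a s`_i)) H; rewrite -(nth_index 0 gs).
apply: (H _ _ (Ordinal (etrans (index_mem g s) gs))) => [i _|//|//].
  by rewrite ha ?mem_nth.
by move: sum0; rewrite (big_nth (0 : G)) big_mkord.
Qed.

(** [homog_total] only promises some list of degrees whose components span D. That the filtered list
    is all of T, so that T is finite, is [mem_supp_seq]. *)
Definition supp_seq : seq G :=
  [seq g <- undup (projT1 (cid (homog_total D))) | g \in T].

Lemma supp_seq_uniq : uniq supp_seq.
Proof. by rewrite filter_uniq ?undup_uniq. Qed.

Lemma supp_seq_full : (\sum_(g <- supp_seq) homog D g)%VS = fullv.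
Proof.
rewrite /supp_seq; case: cid => s /= sT; apply/eqP; rewrite eqEsubv subvf /= -sT.
rewrite big_seq; elim/big_ind: _ => [|U V hU hV|g gs]; first exact: sub0v.
  by rewrite subv_add hU.
have [gT|] := boolP (g \in T); last by rewrite inE negbK => /eqP ->; rewrite sub0v.
by rewrite (big_rem g) ?addvSl // mem_filter gT mem_undup.
Qed.

Definition hproj (g : G) : D -> D := sumv_pi_for (esym supp_seq_full) g.

Lemma hproj_homog g d : hproj g d \in homog D g.
Proof. exact: memv_sum_pi. Qed.

Lemma hproj_sum d : \sum_(g <- supp_seq) hproj g d = d.
Proof.
rewrite sumv_pi_uniq_sum ?memvf //; apply: filter_uniq; exact: supp_seq_uniq.
Qed.

Lemma hproj_is_linear g : linear (hproj g).
Proof. by move=> k a b; rewrite /hproj linearP. Qed.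

HB.instance Definition _ g :=
  GRing.isLinear.Build R D D _ (hproj g) (hproj_is_linear g).

(** A nonzero element of a component missing from the list would equal the sum of its projections to
    the other components, against directness. *)
Lemma mem_supp_seq t : (t \in supp_seq) = (t \in T).
Proof.
rewrite mem_filter; case tT: (t \in T) => //=; apply: contraT => nts.
have [d dt d0] := suppP _ _ tT; case/eqP: d0.
have us : uniq (t :: supp_seq).
  by rewrite /= supp_seq_uniq mem_filter (negPf nts) andbF.
have nt : t \notin supp_seq by case/andP: us.
pose a g := if g == t then - d else hproj g d.
suff: a t = 0 by rewrite /a eqxx => /eqP; rewrite oppr_eq0 => /eqP.
apply: (homog_independent us (a := a)) => [|/=|]; last exact: mem_head; first move=> g _.
- by rewrite /a; case: eqP => [->|_]; rewrite ?memvN // hproj_homog.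
rewrite big_cons {1}/a eqxx (eq_big_seq (fun g => hproj g d)).
  by rewrite hproj_sum addNr.
by move=> g gs; rewrite /a; case: eqP => // gt; rewrite -gt gs in nt.
Qed.

Lemma hproj_id g d : d \in homog D g -> hproj g d = d.
Proof.
move=> dg; have [->|d0] := eqVneq d 0; first by rewrite linear0.
have gT : g \in supp_seq by rewrite mem_supp_seq; apply/suppP; exists d.
pose a h := hproj h d - (if h == g then d else 0).
suff: a g = 0 by rewrite /a eqxx => /eqP; rewrite subr_eq0 => /eqP.
apply: (homog_independent supp_seq_uniq (a := a)) => [h _||//].
  by rewrite memvB ?hproj_homog //; case: eqP => [->|_]; rewrite ?mem0v.
rewrite sumrB hproj_sum -big_mkcond (big_rem g) //= eqxx big1_seq ?addr0 ?subrr //.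
move=> h /andP[/eqP ->]; rewrite mem_rem_uniq ?supp_seq_uniq //.
by rewrite !inE eqxx.
Qed.

Lemma homog_disjoint g h d :
  d \in homog D g -> d \in homog D h -> d != 0 -> g = h.
Proof.
move=> dg dh d0; have [//|gh] := eqVneq g h.
case/eqP: d0; have ug : uniq [:: g; h] by rewrite /= inE gh.
pose a i := if i == g then d else - d.
suff: a g = 0 by rewrite /a eqxx.
apply: (homog_independent ug (a := a)) => [|/=|]; last exact: mem_head; first move=> i.
- by rewrite !inE /a => /orP[] /eqP ->; rewrite ?eqxx // eq_sym (negPf gh) memvN.
by rewrite !big_cons big_nil /a eqxx eq_sym (negPf gh) addr0 subrr.
Qed.

Lemma hproj_other g h d : d \in homog D h -> g != h -> hproj g d = 0.
Proof.
move=> dh gh; have [->|d0] := eqVneq d 0; first by rewrite linear0.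
have hT : h \in supp_seq by rewrite mem_supp_seq; apply/suppP; exists d.
have := hproj_sum d; rewrite (big_rem h) //= (hproj_id dh).
move/(canRL (addKr _)); rewrite addNr => s0.
have [gT|gT] := boolP (g \in supp_seq); last first.
  apply/eqP; apply: contraNT gT => p0; rewrite mem_supp_seq.
  by apply/suppP; exists (hproj g d) => //; apply: hproj_homog.
apply: (homog_independent (rem_uniq h supp_seq_uniq) _ s0) => [k _|].
  exact: hproj_homog.
by rewrite mem_rem_uniq ?supp_seq_uniq // !inE gh.
Qed.

Lemma homog_ind (P : D -> Prop) :
  P 0 -> (forall a b, P a -> P b -> P (a + b)) ->
  (forall g a, g \in T -> a \in homog D g -> P a) -> forall d, P d.
Proof.
move=> P0 PD Ph d; rewrite -(hproj_sum d) big_seq.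
by elim/big_ind: _ => // g; rewrite mem_supp_seq => gT; apply: Ph gT (hproj_homog _ _).
Qed.

(** The component of degree h + g of a^-1 a = 1 is the degree h component of a^-1 times a, so only h
    = -g survives. *)
Lemma homogV g a : a \in homog D g -> a != 0 -> a^-1 \in homog D (- g).
Proof.
move=> ag a0; have aU := homog_unit ag a0.
have e h : hproj h a^-1 * a = hproj (h + g) 1.
  have := congr1 (hproj (h + g)) (mulVr aU).
  rewrite -{1}(hproj_sum a^-1) mulr_suml linear_sum /= => <-.
  have [hT|hT] := boolP (h \in supp_seq).
    rewrite (big_rem h) //= big1_seq ?addr0.
      by rewrite [RHS]hproj_id // homogM ?hproj_homog.
    move=> k /=; rewrite mem_rem_uniq ?supp_seq_uniq // !inE => /andP[kh _].
    rewrite (@hproj_other _ (k + g)) ?homogM ?hproj_homog //.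
    by rewrite (inj_eq (addIr g)) eq_sym.
  have -> : hproj h a^-1 = 0.
    apply/eqP; apply: contraNT hT => p0; rewrite mem_supp_seq.
    by apply/suppP; exists (hproj h a^-1) => //; apply: hproj_homog.
  rewrite mul0r big1_seq // => k /= kT.
  rewrite (@hproj_other _ (k + g)) ?homogM ?hproj_homog //.
  by rewrite (inj_eq (addIr g)); apply: contraNneq hT => ->.
have -> : a^-1 = hproj (- g) a^-1.
  apply: (mulIr aU); rewrite e addNr mulVr //.
  by rewrite hproj_id ?homog1.
exact: hproj_homog.
Qed.

Lemma homog_eq g h a : a \in homog D g -> g = h -> a \in homog D h.
Proof. by move=> + <-. Qed.

Lemma homog_neq0M g a b : a \in homog D g -> a != 0 -> b != 0 -> a * b != 0.
Proof. by move=> ag a0 b0; rewrite mulrI_eq0 //; apply/mulrI/(homog_unit ag). Qed.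

End Components.

(** * The identity component is R, C or H *)

Section RealPolynomials.
Local Open Scope complex_scope.
Variable R : realType.

(** For a nonreal root z, the real quadratic with root z divides p: a nonzero real remainder of
    degree at most 1 cannot vanish at z. *)
Lemma real_poly_factor (p : {poly R}) : (1 < size p)%N ->
  (exists x q, p = q * ('X - x%:P)) \/
  (exists x y q, y != 0 /\ p = q * (('X - x%:P) ^+ 2 + (y ^+ 2)%:P)).
Proof.
move=> sp; pose fp := map_poly (real_complex R) p.
have /closed_rootP[z] : size fp != 1 by rewrite size_map_poly; case: size sp => [|[]].
rewrite /root => /eqP pz.
have [y0|y0] := eqVneq (complex.Im z) 0.
  left; exists (complex.Re z); have : root p (complex.Re z).
    rewrite /root -(inj_eq (fmorph_inj (real_complex R))) rmorph0 -horner_map /=.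
    by rewrite -/fp -pz; apply/eqP; congr (_.[_]); case: (z) y0 => a b /= ->.
  by case/factor_theorem => q ->; exists q.
right; exists (complex.Re z), (complex.Im z); set m := _ + _%:P.
have ez : z = (complex.Re z)%:C + 'i * (complex.Im z)%:C by rewrite -complexE.
have mz : (map_poly (real_complex R) m).[z] = 0.
  rewrite /m rmorphD rmorphXn rmorphB /= map_polyX !map_polyC /= !hornerE.
  rewrite {1}ez [in _ - _]addrC addKr exprMn sqr_i rmorphXn /=; ring.
have sm : size m = 3%N.
  rewrite /m size_polyDl size_exp_XsubC //.
  by rewrite (leq_ltn_trans (size_polyC_leq1 _)).
have m0 : m != 0 by rewrite -size_poly_eq0 sm.
have := divp_eq p m; set q := p %/ m; set r := p %% m => pe.
have sr : (size r < 3)%N by rewrite -sm ltn_modp.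
have re : r = r`_1 *: 'X + (r`_0)%:P.
  apply/polyP => i; rewrite coefD coefZ coefX coefC.
  case: i => [|[|i]] /=; rewrite ?(mulr0, mulr1, addr0, add0r) //.
  by rewrite nth_default ?mulr0 ?addr0 // (leq_trans (n := 2)) // -ltnS.
have rz : (r`_1)%:C * z + (r`_0)%:C = 0.
  have := pz; rewrite /fp pe rmorphD rmorphM /= hornerD hornerM mz mulr0 add0r.
  by rewrite {1}re rmorphD /= map_polyZ map_polyX map_polyC /= !hornerE => ->.
have i0 : r`_1 = 0.
  move/eqP: rz; rewrite ez -complexE; case: (z) y0 => a b /= b0.
  rewrite eq_complex /= => /andP[_]; rewrite mul0r !addr0 mulf_eq0 (negPf b0) orbF.
  by move/eqP.
have r0 : r = 0.
  move: rz; rewrite i0 /= mul0r add0r => /eqP.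
  rewrite fmorph_eq0 => /eqP r00.
  by rewrite re i0 r00 scale0r addr0.
by exists q; split=> //; rewrite -/m {1}pe r0 addr0.
Qed.

End RealPolynomials.

Section Coordinates.
Variables (R : fieldType) (V : vectType R).

(** Coordinates turn an identity between linear combinations in an algebra into real identities that
    [ring] and [field] decide. *)
Definition vcoord i (v : V) : R := coord (vbasis {:V}) i v.

Lemma vcoord_inj u v : (forall i, vcoord i u = vcoord i v) -> u = v.
Proof.
move=> uv; rewrite (coord_vbasis (memvf u)) (coord_vbasis (memvf v)).
by apply: eq_bigr => i _; rewrite [coord _ i u]uv.
Qed.

Lemma vcoordD i u v : vcoord i (u + v) = vcoord i u + vcoord i v.
Proof. by rewrite /vcoord linearD. Qed.

Lemma vcoordZ i k v : vcoord i (k *: v) = k * vcoord i v.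
Proof. by rewrite /vcoord linearZ. Qed.

Lemma vcoordN i v : vcoord i (- v) = - vcoord i v.
Proof. by rewrite -scaleN1r vcoordZ mulN1r. Qed.

Definition vcoordE := (vcoordD, vcoordZ, vcoordN).

End Coordinates.

Section FrobeniusMaps.
Variables (R : realType) (D : falgType R) (I J : D).
Hypotheses (II : I * I = -1) (JJ : J * J = -1) (JI : J * I = - (I * J)).

Definition complex_map (z : Rcomplex R) : D :=
  (complex.Re z)%:A + complex.Im z *: I.

Lemma complex_map_linear : linear complex_map.
Proof.
move=> k [a b] [c d]; rewrite /complex_map /=.
by apply: vcoord_inj => i; rewrite !vcoordE; ring.
Qed.
HB.instance Definition _ := GRing.isLinear.Build R (Rcomplex R) D _
  complex_map complex_map_linear.

Lemma complex_map_monoid : monoid_morphism complex_map.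
Proof.
split=> [|[a b] [c d]]; rewrite /complex_map /= ?scale1r ?scale0r ?addr0 //.
rewrite !mulrDl !mulrDr -!scalerAl -!scalerAr !mul1r mulr1 II.
by apply: vcoord_inj => i; rewrite !vcoordE; ring.
Qed.

Definition quaternion_map (q : quaternion R) : D :=
  (q_re q)%:A + q_i q *: I + q_j q *: J + q_k q *: (I * J).

Lemma quaternion_map_linear : linear quaternion_map.
Proof.
move=> k [a b c d] [a' b' c' d']; rewrite /quaternion_map /=.
by apply: vcoord_inj => i; rewrite !vcoordE; ring.
Qed.
HB.instance Definition _ := GRing.isLinear.Build R (quaternion R) D _
  quaternion_map quaternion_map_linear.

Lemma quaternion_map_monoid : monoid_morphism quaternion_map.
Proof.
have JIJ : J * (I * J) = I by rewrite mulrA JI mulNr -mulrA JJ mulrN1 opprK.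
have IIJ : I * (I * J) = - J by rewrite mulrA II mulN1r.
have IJI : I * J * I = J by rewrite -mulrA JI mulrN IIJ opprK.
have IJJ : I * J * J = - I by rewrite -mulrA JJ mulrN1.
have IJIJ : I * J * (I * J) = -1 by rewrite -mulrA JIJ II.
split=> [|[a b c d] [a' b' c' d']].
  by rewrite /quaternion_map /= ?scale1r !scale0r !addr0.
rewrite /quaternion_map /= !mulrDl !mulrDr -!scalerAl -!scalerAr !mul1r !mulr1.
rewrite II JI JJ JIJ IIJ IJI IJJ IJIJ.
by apply: vcoord_inj => i; rewrite !vcoordE; ring.
Qed.

End FrobeniusMaps.

Section AlgebraicElements.
Variables (R : realType) (D : falgType R).

Lemma horner_alg_annihilated (a : D) :
  exists2 p : {poly R}, p != 0 & horner_alg a p = 0.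
Proof.
pose n := \dim {:D}; pose X := [tuple a ^+ i | i < n.+1].
have nfree : ~~ free X.
  apply/negP => /eqP; rewrite size_tuple => dX.
  by have := dimvS (subvf <<X>>%VS); rewrite dX ltnn.
apply: contrapT => H; case/negP: nfree; apply/freeP => k sum0 i.
pose p := \poly_(i < n.+1) k (inord i).
suff p0 : p = 0.
  by have := coef_poly n.+1 (fun i => k (inord i)) i; rewrite -/p p0 coef0 ltn_ord inord_val.
apply: contrapT => /eqP p0; apply: H; exists p => //.
rewrite /p poly_def rmorph_sum -[RHS]sum0; apply: eq_bigr => j _.
by rewrite -tnth_nth tnth_mktuple inord_val -mul_polyC rmorphM rmorphXn /= horner_algX horner_algC mulr_algl.
Qed.

End AlgebraicElements.

Section IdentityComponent.
Variables (R : realType) (G : zmodType) (D : gradedDivAlg R G).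
Local Notation De := (homog D 0).

Lemma De_mul a b : a \in De -> b \in De -> a * b \in De.
Proof. by move=> aD bD; have := homogM aD bD; rewrite addr0. Qed.

Lemma De_real k : k%:A \in De. Proof. by rewrite memvZ ?homog1. Qed.

Lemma De_domain a b : a \in De -> a * b = 0 -> a = 0 \/ b = 0.
Proof.
move=> aD ab0; have [->|a0] := eqVneq a 0; [by left | right].
by apply: (mulrI (homog_unit aD a0)); rewrite ab0 mulr0.
Qed.

Lemma De_inv a : a \in De -> a != 0 -> a^-1 \in De.
Proof. by move=> aD a0; have := homogV aD a0; rewrite oppr0. Qed.

(** Real factors of degree 1 or 2 are split off an annihilating polynomial of a. As De has no zero
    divisors, either the factor already kills a or the smaller cofactor does. *)
Lemma De_quadratic a : a \in De -> (exists x, a = x%:A) \/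
  exists x y, y != 0 /\ (a - x%:A) * (a - x%:A) = - (y ^+ 2)%:A.
Proof.
move=> aD; have [p] := horner_alg_annihilated a.
have [n] := ubnP (size p); elim: n p => // n IH p sp p0 pa.
have [s1|s1] := leqP (size p) 1.
  move: p0 pa; rewrite (size1_polyC s1) polyC_eq0 => p0.
  rewrite horner_algC => /eqP; rewrite scaler_eq0 (negPf p0) oner_eq0.
  by [].
case: (real_poly_factor s1) => [[x [q pe]]|[x [y [q [y0 pe]]]]].
  have q0 : q != 0 by apply: contraNneq p0 => q0; rewrite pe q0 mul0r.
  have lin : horner_alg a ('X - x%:P) = a - x%:A.
    by rewrite rmorphB /= horner_algX horner_algC.
  have [->|ax] := eqVneq a x%:A; first by left; exists x.
  apply: (IH q) => //.
    by move: sp; rewrite pe size_Mmonic ?monicXsubC // size_XsubC addn2 /= ltnS.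
  have := pa; rewrite pe mulrC rmorphM /= lin => /De_domain [] //.
    by rewrite memvB ?De_real.
  by move/eqP; rewrite subr_eq0 (negPf ax).
have q0 : q != 0 by apply: contraNneq p0 => q0; rewrite pe q0 mul0r.
have quad : horner_alg a (('X - x%:P) ^+ 2 + (y ^+ 2)%:P)
    = (a - x%:A) * (a - x%:A) + (y ^+ 2)%:A.
  by rewrite rmorphD rmorphXn rmorphB /= horner_algX !horner_algC expr2.
have := pa; rewrite pe mulrC rmorphM /= quad => /De_domain [].
- by rewrite memvD ?De_mul ?memvB ?De_real.
- by move/eqP; rewrite addr_eq0 => /eqP axy; right; exists x, y.
apply: (IH q) => //.
have m2 : size (('X - x%:P) ^+ 2 + (y ^+ 2)%:P) = 3%N.
  by rewrite size_polyDl size_exp_XsubC // (leq_ltn_trans (size_polyC_leq1 _)).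
have m0 : ('X - x%:P) ^+ 2 + (y ^+ 2)%:P != 0 :> {poly R}.
  by rewrite -size_poly_eq0 m2.
by move: sp; rewrite pe size_mul // m2 addn3 /= ltnS => /ltnW.
Qed.

End IdentityComponent.

Section Frobenius.
Variables (R : realType) (G : zmodType) (D : gradedDivAlg R G).
Local Notation De := (homog D 0).

Lemma real_comm (k : R) (a : D) : k%:A * a = a * k%:A.
Proof. by rewrite mulr_algl mulr_algr. Qed.

Lemma De_square_eq a b : a \in De -> b \in De -> a * b = b * a ->
  a * a = b * b -> a = b \/ a = - b.
Proof.
move=> aD bD ab aabb; have : (a - b) * (a + b) = 0.
  by rewrite mulrDr !mulrBl -ab addrA subrK aabb subrr.
case/De_domain => [|/eqP|/eqP]; first exact: memvB.
  by rewrite subr_eq0 => /eqP; left.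
by rewrite addr_eq0 => /eqP; right.
Qed.

(** For nonreal a, the elements a - x and y I commute and have the same square, so they agree up to
    sign in a domain. *)
Lemma De_commute_imaginary (I : D) : I \in De -> I * I = -1 ->
  forall a, a \in De -> a * I = I * a -> exists x y, a = x%:A + y *: I.
Proof.
move=> ID II a aD aI; case: (De_quadratic aD) => [[x ->]|[x [y [y0 axy]]]].
  by exists x, 0; rewrite scale0r addr0.
have [||||e|e] := @De_square_eq (a - x%:A) (y *: I).
- by rewrite memvB ?De_real.
- by rewrite memvZ.
- by rewrite -scalerAr -scalerAl mulrBl mulrBr aI real_comm.
- by rewrite axy -scalerAl -scalerAr II scalerA scalerN expr2.
- by exists x, y; rewrite -e addrC subrK.
by exists x, (- y); rewrite scaleNr -e addrC subrK.
Qed.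

Lemma anticommute_eq0 (a b : D) : b \in De -> b != 0 ->
  a * b = b * a -> a * b = - (b * a) -> a = 0.
Proof.
move=> bD b0 <- /eqP; rewrite -addr_eq0 -mulr2n -scaler_nat scaler_eq0.
rewrite pnatr_eq0 /= => /eqP ab0.
by apply: (mulIr (homog_unit bD b0)); rewrite ab0 mul0r.
Qed.

Lemma Frobenius : [|| isoR De, isoC De | isoH De].
Proof.
have [hR|/existsNP[a0 /not_implyP[a0D a0R]]] :=
    pselect (forall a, a \in De -> exists x, a = x%:A).
  rewrite /isoR [_ == _](_ : _ = true) //; apply/eqP/vspaceP => a.
  apply/idP/idP => [/hR[x ->]|/vlineP[x ->]]; last exact: De_real.
  by apply/vlineP; exists x.
have [I ID II] : exists2 I, I \in De & I * I = -1.
  case: (De_quadratic a0D) => [//|[x [y [y0 axy]]]].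
  exists (y^-1 *: (a0 - x%:A)); first by rewrite memvZ ?memvB ?De_real.
  rewrite -scalerAl -scalerAr axy !scalerA scalerN scalerA; congr (- _).
  by rewrite expr2 -[RHS]scale1r; congr (_ *: _); field.
have I0 : I != 0.
  by apply/eqP => I0; move/eqP: II; rewrite I0 mul0r eq_sym oppr_eq0 oner_eq0.
have span := De_commute_imaginary ID II.
have injl (a b : R) : a%:A + b *: I = 0 -> a = 0 /\ b = 0.
  move=> ab0; have : (a%:A + b *: I) * (a%:A - b *: I) = 0 by rewrite ab0 mul0r.
  have -> : (a%:A + b *: I) * (a%:A - b *: I) = (a ^+ 2 + b ^+ 2)%:A.
    rewrite mulrDl !mulrBr -!scalerAl -!scalerAr !mul1r mulr1 II.
    by apply: vcoord_inj => i; rewrite !vcoordE; ring.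
  move/eqP; rewrite scaler_eq0 oner_eq0 orbF paddr_eq0 ?sqr_ge0 // !sqrf_eq0.
  by case/andP => /eqP -> /eqP.
have [hC|/existsNP[a1 /not_implyP[a1D a1I]]] :=
    pselect (forall a, a \in De -> a * I = I * a).
  apply/orP; right; apply/orP; left; apply/asboolP.
  pose f : {lrmorphism Rcomplex R -> D} := HB.pack (complex_map I)
    (GRing.isLinear.Build R (Rcomplex R) D _ _ (complex_map_linear I))
    (GRing.isMonoidMorphism.Build (Rcomplex R) D _ (complex_map_monoid II)).
  exists f; split=> [z w /eqP|a].
    rewrite -subr_eq0 -raddfB => /eqP /injl [/= hr hi].
    move: hr hi; case: z w => x y [x' y'] /= /eqP + /eqP.
    by rewrite !subr_eq0 => /eqP -> /eqP ->.
  split=> [aD|[z <-]]; last by rewrite memvD ?De_real ?memvZ.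
  by have [x [y ->]] := span a aD (hC a aD); exists (Complex x y).
(* J0 is twice the projection of a1 to the elements anticommuting with I. *)
have [J0 J0E] : exists J0, J0 = a1 + I * a1 * I by eexists.
have J0D : J0 \in De by rewrite J0E memvD ?De_mul.
have IJ0 : I * J0 = I * a1 - a1 * I by rewrite J0E mulrDr !mulrA II !mulN1r mulNr.
have J0I : J0 * I = - (I * J0).
  by rewrite IJ0 opprB J0E mulrDl -(mulrA (I * a1)) II mulrN1.
have J00 : J0 != 0.
  apply/eqP => J00; apply: a1I; have := IJ0; rewrite J00 mulr0 => /eqP.
  by rewrite eq_sym subr_eq0 => /eqP.
have [x [y e]] : exists x y, J0 * J0 = x%:A + y *: I.
  apply: span; first exact: De_mul.
  by rewrite -mulrA J0I mulrN !mulrA J0I mulNr opprK.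
have y0 : y = 0.
  have yI : y *: I * J0 = J0 * (y *: I).
    have := congr1 (fun u => u * J0) e; rewrite -mulrA {1}e mulrDl mulrDr real_comm.
    by move/addrI.
  apply/eqP; have /eqP : y *: I = 0.
    apply: (anticommute_eq0 J0D J00 yI).
    by rewrite -scalerAl -scalerAr J0I scalerN opprK.
  by rewrite scaler_eq0 (negPf I0) orbF.
have {y y0} e : J0 * J0 = x%:A by rewrite e y0 scale0r addr0.
(* A nonnegative square would make J0 real, so that it would commute with I as well as
   anticommute. *)
have x0 : x < 0.
  rewrite ltNge; apply/negP => x0.
  have : J0 = (Num.sqrt x)%:A \/ J0 = - (Num.sqrt x)%:A.
    apply: De_square_eq; rewrite ?De_real ?real_comm //.
    by rewrite e -scalerAl mul1r scalerA -expr2 sqr_sqrtr.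
  have J0C : J0 * I = I * J0 -> False.
    by move/esym/anticommute_eq0 => /(_ J0D J00) H; case/eqP: I0; apply: H; rewrite J0I opprK.
  by case=> Je; apply: J0C; rewrite Je ?mulNr ?mulrN real_comm.
pose s := (Num.sqrt (- x))^-1.
have s0 : s != 0 by rewrite invr_eq0 sqrtr_eq0 -ltNge oppr_gt0.
have ss : s * s * x = -1.
  rewrite /s -invfM -expr2 sqr_sqrtr ?oppr_ge0 ?ltW //; field.
  by rewrite lt_eqF.
have [J [JD JJ JI]] : exists J, [/\ J \in De, J * J = -1 & J * I = - (I * J)].
  exists (s *: J0); split; first exact: memvZ.
    by rewrite -scalerAl -scalerAr e !scalerA ss scaleN1r.
  by rewrite -scalerAl J0I -scalerAr scalerN.
apply/orP; right; apply/orP; right; apply/asboolP.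
pose f : {lrmorphism quaternion R -> D} := HB.pack (quaternion_map I J)
    (GRing.isLinear.Build R (quaternion R) D _ _ (quaternion_map_linear I J))
    (GRing.isMonoidMorphism.Build (quaternion R) D _ (quaternion_map_monoid II JJ JI)).
have fE q : f q = quaternion_map I J q by [].
exists f; split=> [q q' /eqP|a].
  rewrite -subr_eq0 -raddfB => /eqP h; apply/eqP; rewrite -subr_eq0; apply/eqP.
  move: (q - q') h => {q q'} q fq0; have : f (quat_conj q * q) = 0 by rewrite rmorphM fq0 mulr0.
  have -> : quat_conj q * q = Quat (q_re q ^+ 2 + q_i q ^+ 2 + q_j q ^+ 2 + q_k q ^+ 2) 0 0 0.
    by case: q {fq0} => a b c d; congr Quat => /=; ring.
  rewrite fE /quaternion_map /= !scale0r !addr0 => /eqP.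
  rewrite scaler_eq0 oner_eq0 orbF !paddr_eq0 ?addr_ge0 ?sqr_ge0 // !sqrf_eq0.
  by case: q {fq0} => a b c d /= /andP[/andP[/andP[/eqP -> /eqP ->] /eqP ->] /eqP ->].
split=> [aD|[q <-]]; last by rewrite fE !memvD ?De_real ?memvZ ?De_mul.
(* Up to the factor 2 these are the parts of a commuting and anticommuting with I. The product of
   [am] with J commutes with I again, so both parts are covered by [span]. *)
pose ap := a - I * a * I; pose am := a + I * a * I.
have IaID : I * a * I \in De by rewrite !De_mul.
have [u [v ue]] : exists u v, ap = u%:A + v *: I.
  apply: span; rewrite ?memvB // mulrBl mulrBr !mulrA II -[_ * I * I]mulrA II.
  by rewrite mulrN1 opprK !mulN1r mulNr opprK addrC.
have [w [z we]] : exists w z, am * J = w%:A + z *: I.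
  apply: span; rewrite ?De_mul ?memvD //.
  rewrite -mulrA JI mulrN !mulrA -mulNr; congr (_ * J).
  rewrite mulrDl mulrDr !mulrA II -[_ * I * I]mulrA II mulrN1 mulN1r mulNr.
  by rewrite opprB addrC.
have ae : a = 2^-1 *: (ap + am).
  rewrite /ap /am addrACA addNr addr0 -mulr2n -scaler_nat scalerA mulVf ?scale1r //.
  by rewrite pnatr_eq0.
have ame : am = - (w *: J + z *: (I * J)).
  by rewrite -[am]opprK -[in LHS](mulrN1 am) -JJ mulrA we mulrDl -!scalerAl mul1r.
exists (Quat (u / 2) (v / 2) (- w / 2) (- z / 2)).
rewrite fE /quaternion_map ae ue ame /=.
by apply: vcoord_inj => i; rewrite !vcoordE; field.
Qed.

End Frobenius.

(** * Conjugation, norm and center of the identity component *)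

Section IdentityComponentTypes.
Variables (R : realType) (G : zmodType) (D : gradedDivAlg R G).
Local Notation De := (homog D 0).

Lemma realA_inj : injective (fun k : R => k%:A : D).
Proof.
move=> a b /eqP; rewrite -subr_eq0 -scalerBl scaler_eq0 oner_eq0 orbF subr_eq0.
by move/eqP.
Qed.

Lemma lrmorph_real (A : lalgType R) (f : {lrmorphism A -> D}) k : f k%:A = k%:A.
Proof. by rewrite linearZ /= rmorph1. Qed.

Lemma isoR_span : isoR De -> forall a, a \in De -> exists x, a = x%:A.
Proof. by move=> /eqP -> a /vlineP. Qed.

Lemma isoC_map : isoC De -> exists f : {lrmorphism Rcomplex R -> D},
  alg_iso_onto De f.
Proof. by move/asboolP. Qed.

Lemma isoH_map : isoH De -> exists f : {lrmorphism quaternion R -> D},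
  alg_iso_onto De f.
Proof. by move/asboolP. Qed.

Lemma isoC_comm : isoC De -> {in De &, commutative *%R}.
Proof.
case/isoC_map => f [_ fP] _ _ /fP[z <-] /fP[w <-].
by rewrite -!rmorphM mulrC.
Qed.

Lemma isoC_notR : isoC De -> isoR De = false.
Proof.
case/isoC_map => f [fi fP]; apply/negP => /isoR_span h.
have [x fx] : exists x, f (Complex 0 1) = x%:A by apply: h; apply/fP; eexists.
have : f (Complex 0 1) = f x%:A by rewrite lrmorph_real.
by move/fi => [] _ /eqP; rewrite mulr0 oner_eq0.
Qed.

Lemma isoH_notC : isoH De -> isoC De = false.
Proof.
case/isoH_map => f [fi fP]; apply/negP => /isoC_comm h.
have : f (Quat 0 1 0 0 * Quat 0 0 1 0) = f (Quat 0 0 1 0 * Quat 0 1 0 0).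
  by rewrite !rmorphM; apply: h; apply/fP; eexists.
move/fi => [] _ _ _ /eqP; rewrite !(mulr0, mul0r, mulr1, subr0, add0r, addr0, oppr0).
by rewrite -subr_eq0 opprK -mulr2n -mulr_natr mul1r pnatr_eq0.
Qed.

Lemma isoC_sqrt : isoC De -> forall a, a \in De -> exists2 z, z \in De & z * z = a.
Proof.
case/isoC_map => f [_ fP] _ /fP[z <-]; exists (f (sqrtc z)).
  by apply/fP; eexists.
by rewrite -rmorphM -expr2 sqr_sqrtc.
Qed.

Section Quaternionic.
Variable qi : D.
Hypotheses (hH : isoH De) (qiD : qi \in De) (qi2 : qi * qi = -1).

(** A nonzero real part a would, through the cross terms 2ab, 2ac, 2ad of the square, force b = c =
    d = 0 and a^2 = -1. This is needed because [qi] is only known by its square, not as a standard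
    unit. *)
Lemma pure_quaternion : exists f : {lrmorphism quaternion R -> D},
  alg_iso_onto De f /\ exists b c d, qi = f (Quat 0 b c d).
Proof.
have [f fO] := isoH_map hH; have [fi fP] := fO; exists f; split=> //.
have [[a b c d] fq] := (fP qi).1 qiD.
have : f (Quat a b c d * Quat a b c d) = f (- 1).
  by rewrite rmorphM rmorphN1 /= fq.
move/fi => [] ha hb hc hd.
suff a0 : a = 0 by exists b, c, d; rewrite -a0 fq.
apply/eqP/negPn/negP => a0.
have z x : a * x + x * a = 0 -> x = 0.
  by rewrite [x * a]mulrC -mulr2n => /eqP; rewrite mulrn_eq0 mulf_eq0 (negPf a0) => /eqP.
have b0 : b = 0 by apply: z; rewrite -[RHS]oppr0 -hb; ring.
have c0 : c = 0 by apply: z; rewrite -[RHS]oppr0 -hc; ring.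
have d0 : d = 0 by apply: z; rewrite -[RHS]oppr0 -hd; ring.
move: ha; rewrite b0 c0 d0 !mulr0 !subr0 => ha.
by have := mulr_ge0 (ltW (ltr01 : 0 < 1 :> R)) (sqr_ge0 a); rewrite mul1r expr2 ha oppr_ge0 leNgt ltr01.
Qed.

(** Conjugating by such a z reverses the sign of [qi]. This is why the quaternionic classes with
    block [qi] carry no signature. *)
Lemma quaternion_anticommute : exists2 z, z \in De & z != 0 /\ z * qi = - (qi * z).
Proof.
have [f [[fi fP] [b [c [d ->]]]]] := pure_quaternion.
have key z : z != 0 -> z * Quat 0 b c d = - (Quat 0 b c d * z) ->
    exists2 z, z \in De & z != 0 /\ z * f (Quat 0 b c d) = - (f (Quat 0 b c d) * z).
  move=> z0 e; exists (f z); first by apply/fP; eexists.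
  split; first by apply: contra z0; rewrite -(rmorph0 f) => /eqP/fi ->.
  by rewrite -!rmorphM e rmorphN.
have [b0|b0] := eqVneq b 0; last first.
  apply: (key (Quat 0 (- c) b 0)).
    by apply/eqP => -[] _ /eqP; rewrite (negPf b0).
  by congr Quat => /=; ring.
have [c0|c0] := eqVneq c 0; last first.
  apply: (key (Quat 0 (- c) b 0)).
    by apply/eqP => -[] /eqP; rewrite oppr_eq0 (negPf c0).
  by congr Quat => /=; ring.
apply: (key (Quat 0 1 0 0)).
  by apply/eqP => -[] /eqP; rewrite oner_eq0.
by rewrite b0 c0; congr Quat => /=; ring.
Qed.

End Quaternionic.

Section Conjugation.
Variable phi0 : {linear D -> D}.
Hypotheses (hphi0 : degree_preserving_involution phi0)
           (hconj : restricts_to_conj phi0 De).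

Lemma phiK : involutive phi0. Proof. by case: hphi0. Qed.
Lemma phiM a b : phi0 (a * b) = phi0 b * phi0 a. Proof. by case: hphi0. Qed.
Lemma phi_homog g d : d \in homog D g -> phi0 d \in homog D g.
Proof. by case: hphi0 => _ _; apply. Qed.

Lemma phi1 : phi0 1 = 1.
Proof. by have := phiM (phi0 1) 1; rewrite mulr1 !phiK mulr1. Qed.

Lemma phi_real k : phi0 k%:A = k%:A. Proof. by rewrite linearZ /= phi1. Qed.

Lemma phi_eq0 a : (phi0 a == 0) = (a == 0).
Proof. by rewrite -[X in _ == X](linear0 phi0) (inj_eq (can_inj phiK)). Qed.

Lemma phi_isoR : isoR De -> {in De, phi0 =1 id}.
Proof. by case: hconj. Qed.

(** Positivity of this norm is what lets Sylvester's law run over C and H as it does over R. *)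
Lemma De_norm a : a \in De -> a != 0 -> exists2 r, 0 < r & phi0 a * a = r%:A.
Proof.
move=> aD a0; case/or3P: (Frobenius D) => [hR|hC|hH].
- have [x ax] := isoR_span hR aD; exists (x ^+ 2).
    by rewrite exprn_even_gt0 //; apply: contraNneq a0 => x0; rewrite ax x0 scale0r.
  by rewrite phi_isoR // ax -scalerAl mul1r scalerA.
- have [f fO] := isoC_map hC; have [fi fP] := fO; have [z az] := (fP a).1 aD.
  have [_ /(_ f fO) hf _] := hconj.
  have hz : conjc z * z = (complex.Re z ^+ 2 + complex.Im z ^+ 2)%:A :> Rcomplex R.
    by case: (z) => x y; congr Complex => /=; ring.
  exists (complex.Re z ^+ 2 + complex.Im z ^+ 2); last first.
    by rewrite -az hf -rmorphM hz; apply: lrmorph_real.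
  rewrite lt_neqAle addr_ge0 ?sqr_ge0 // andbT eq_sym paddr_eq0 ?sqr_ge0 // !sqrf_eq0.
  apply: contraNN a0; rewrite -az; case: (z) => x y /= /andP[/eqP -> /eqP ->].
  by rewrite -[Complex 0 0]/(0 : Rcomplex R) rmorph0.
have [f fO] := isoH_map hH; have [fi fP] := fO; have [q aq] := (fP a).1 aD.
have [_ _ /(_ f fO) hf] := hconj.
pose n := q_re q ^+ 2 + q_i q ^+ 2 + q_j q ^+ 2 + q_k q ^+ 2.
have hz : quat_conj q * q = n%:A.
  by rewrite /n; case: (q) => x y z t; congr Quat => /=; ring.
exists n; last by rewrite -aq hf -rmorphM hz; apply: lrmorph_real.
rewrite lt_neqAle !addr_ge0 ?sqr_ge0 // andbT eq_sym /n !paddr_eq0 ?addr_ge0 ?sqr_ge0 //.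
rewrite !sqrf_eq0; apply: contraNN a0; rewrite -aq.
case: (q) => x y z t /= /andP[/andP[/andP[/eqP -> /eqP ->] /eqP ->] /eqP ->].
by rewrite -[Quat 0 0 0 0]/(0 : quaternion R) rmorph0.
Qed.

Lemma De_fixed a : a \in De -> phi0 a = a -> exists r, a = r%:A.
Proof.
move=> aD pa; case/or3P: (Frobenius D) => [hR|hC|hH].
- exact: isoR_span.
- have [f fO] := isoC_map hC; have [fi fP] := fO; have [[x y] az] := (fP a).1 aD.
  have [_ /(_ f fO) hf _] := hconj; exists x.
  move: pa; rewrite -az hf => /fi [] /eqP; rewrite eqNr => /eqP ->.
  have -> : Complex x 0 = x%:A :> Rcomplex R by congr Complex => /=; ring.
  exact: lrmorph_real.
have [f fO] := isoH_map hH; have [fi fP] := fO; have [[x y z t] aq] := (fP a).1 aD.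
have [_ _ /(_ f fO) hf] := hconj; exists x.
move: pa; rewrite -aq hf => /fi [] /eqP; rewrite eqNr => /eqP ->.
move=> /eqP; rewrite eqNr => /eqP -> /eqP; rewrite eqNr => /eqP ->.
have -> : Quat x 0 0 0 = x%:A by congr Quat => /=; ring.
exact: lrmorph_real.
Qed.

Lemma De_central a : isoC De = false -> a \in De ->
  (forall b, b \in De -> a * b = b * a) -> exists r, a = r%:A.
Proof.
move=> nC aD ac; case/or3P: (Frobenius D) => [hR|hC|hH].
- exact: isoR_span.
- by rewrite hC in nC.
have [f [fi fP]] := isoH_map hH; have [[x y z t] aq] := (fP a).1 aD.
have fD q : f q \in De by apply/fP; eexists.
have h q : Quat x y z t * q = q * Quat x y z t.
  by apply: fi; rewrite !rmorphM /= aq ac.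
have dbl (u : R) : u = - u -> u = 0 by move=> /esym/eqP; rewrite eqNr => /eqP.
have [_ _ h1 h2] := h (Quat 0 1 0 0); have [_ h3 _ _] := h (Quat 0 0 1 0).
have z0 : z = 0 by apply: dbl; move: h2; rewrite !(mulr0, mul0r, mulr1, mul1r); lra.
have t0 : t = 0 by apply: dbl; move: h1; rewrite !(mulr0, mul0r, mulr1, mul1r); lra.
have [_ _ _ h4] := h (Quat 0 0 1 0).
have y0 : y = 0 by apply: dbl; move: h4; rewrite !(mulr0, mul0r, mulr1, mul1r); lra.
exists x; rewrite -aq y0 z0 t0.
have -> : Quat x 0 0 0 = x%:A by congr Quat => /=; ring.
exact: lrmorph_real.
Qed.

Lemma isoC_imaginary : isoC De -> exists I, [/\ I \in De, I * I = -1, phi0 I = - I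
  & forall a, a \in De -> exists x y, a = x%:A + y *: I].
Proof.
move=> hC; have [f fO] := isoC_map hC; have [fi fP] := fO.
have [_ /(_ f fO) hf _] := hconj.
exists (f (Complex 0 1)); split.
- by apply/fP; eexists.
- by rewrite -rmorphM -(rmorphN1 f); congr (f _); congr Complex => /=; ring.
- by rewrite hf -rmorphN; congr (f _); congr Complex => /=; ring.
move=> a /fP[[x y] <-]; exists x, y.
rewrite -(rmorph1 f) -!linearZ -linearD; congr (f _); congr Complex => /=; ring.
Qed.

Lemma phi_qi qi : isoH De -> qi \in De -> qi * qi = -1 -> phi0 qi = - qi.
Proof.
move=> hH qiD qi2; have [f [fO [b [c [d ->]]]]] := pure_quaternion hH qiD qi2.
have [_ _ /(_ f fO) hf] := hconj.
by rewrite hf -rmorphN; congr (f _); congr Quat; rewrite /= oppr0.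
Qed.

End Conjugation.
End IdentityComponentTypes.

(** * The structure of D *)

Section Setting.
Variables (R : realType) (G : zmodType) (D : gradedDivAlg R G).
Variables (phi0 : {linear D -> D}) (X : G -> D) (f : G).
Local Notation De := (homog D 0).
Local Notation T := (supp D).
Local Notation K := (inK D).
Local Notation eta := (etaX phi0 X).

(** The field [set_f0] is the only one that is not literally a hypothesis of the theorem; it follows
    from nu f = -1. *)
Record setting : Prop := Setting {
  set_center : center_condition D;
  set_inv : degree_preserving_involution phi0;
  set_conj : restricts_to_conj phi0 De;
  set_phiZ : exists2 z, z \in 'Z({:D})%VS & phi0 z != z;
  set_X : homogeneous_choice phi0 X;
  set_f : forall g, ('Z({:D}) :&: homog D g != 0)%VS = (g \in [:: 0; f]);
  set_f0 : f != 0
}.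
Hypothesis S : setting.

Lemma centerP c : reflect (forall d, c * d = d * c) (c \in 'Z({:D})%VS).
Proof.
rewrite memv_cap memvf /=; apply: (iffP idP) => [/centvP h d|h].
  exact/h/memvf.
by apply/centvP => d _.
Qed.

Lemma oppr_selfE (c : D) : c = - c -> c = 0.
Proof.
move/eqP; rewrite -addr_eq0 -mulr2n -scaler_nat scaler_eq0 pnatr_eq0 /=.
by move/eqP.
Qed.

Lemma dim_center : (\dim 'Z({:D}) <= 2)%N.
Proof.
have key (u v : D) : ('Z({:D}) <= <<[:: u; v]>>)%VS -> (\dim 'Z({:D}) <= 2)%N.
  by move/dimvS => h; apply: leq_trans h (dim_span _).
have [/orP[] /asboolP[g [_ gP]] _] := set_center S.
  apply: (key (g 1) (g (Complex 0 1))); apply/subvP => _ /gP[[x y] <-].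
  have -> : Complex x y = x *: (1 : Rcomplex R) + y *: (Complex 0 1 : Rcomplex R).
    by congr Complex => /=; ring.
  by rewrite linearD !linearZ memvD // memvZ // memv_span // !inE eqxx ?orbT.
apply: (key (g (1, 0)) (g (0, 1))); apply/subvP => _ /gP[[x y] <-].
have -> : (x, y) = x *: ((1, 0) : (R^o * R^o)%type) + y *: ((0, 1) : (R^o * R^o)%type).
  by congr pair; rewrite /= ?scaler0 ?addr0 ?add0r /GRing.scale /= ?mulr1.
by rewrite linearD !linearZ memvD // memvZ // memv_span // !inE eqxx ?orbT.
Qed.

(** By [set_f] both intersections are nonzero, they are independent because f != 0, and the center
    has real dimension at most 2. *)
Lemma center_decomposition :
  [/\ 'Z({:D}) :&: De = 1, \dim ('Z({:D}) :&: homog D f) = 1%N &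
      'Z({:D}) = 'Z({:D}) :&: De + 'Z({:D}) :&: homog D f]%VS.
Proof.
set U0 := ('Z({:D}) :&: De)%VS; set Uf := ('Z({:D}) :&: homog D f)%VS.
have one0 : 1 \in U0.
  by rewrite memv_cap homog1 andbT; apply/centerP => d; rewrite mul1r mulr1.
have d0 : (0 < \dim U0)%N.
  by rewrite lt0n dimv_eq0 (set_f S) mem_head.
have df : (0 < \dim Uf)%N.
  by rewrite lt0n dimv_eq0 (set_f S) !inE eqxx orbT.
have cap0 : (U0 :&: Uf = 0)%VS.
  apply/eqP; rewrite -subv0; apply/subvP => v; rewrite memv_cap !memv_cap memv0.
  case/andP => /andP[_ v0] /andP[_ vf]; apply: contraTT (set_f0 S) => vn0.
  by rewrite negbK (homog_disjoint v0 vf vn0).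
have := dimv_disjoint_sum cap0.
have sub : (U0 + Uf <= 'Z({:D}))%VS by rewrite subv_add !capvSl.
have := leq_trans (dimvS sub) dim_center => + dE; rewrite dE => le2.
have e0 : \dim U0 = 1%N by lia.
have ef : \dim Uf = 1%N by lia.
split=> //.
  apply/esym/eqP; rewrite eqEdim e0 dimv1 leqnn andbT.
  by apply/subvP => _ /vlineP[k ->]; rewrite memvZ.
by apply/eqP; rewrite eq_sym eqEdim sub dE e0 ef dim_center.
Qed.

Lemma central_real c : (forall d, c * d = d * c) -> c \in De -> exists r, c = r%:A.
Proof.
move=> /centerP cZ cD; have [e _ _] := center_decomposition.
by apply/vlineP; rewrite -[<[1]>%VS]e memv_cap cZ.
Qed.

(** The central line of degree f is stable under [phi0], with eigenvalue 1 or -1; the eigenvalue 1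
    would make [phi0] the identity on the whole center. *)
Lemma central_f c : (forall d, c * d = d * c) -> c \in homog D f -> phi0 c = - c.
Proof.
move=> cC cf; have cZ : c \in 'Z({:D})%VS by apply/centerP.
have [e0 df eZ] := center_decomposition.
have [->|c0] := eqVneq c 0; first by rewrite linear0 oppr0.
have cU : c \in ('Z({:D}) :&: homog D f)%VS by rewrite memv_cap cZ.
have UE : ('Z({:D}) :&: homog D f = <[c]>)%VS.
  by apply/esym/eqP; rewrite eqEdim df dim_vline c0 -memvE cU.
have phiC d : phi0 c * d = d * phi0 c.
  by rewrite -[d](phiK (set_inv S)) -!(phiM (set_inv S)) cC.
have : phi0 c \in <[c]>%VS.
  by rewrite -UE memv_cap (phi_homog (set_inv S)) // andbT; apply/centerP.
case/vlineP => k ke; have : (k ^+ 2 - 1) *: c = 0.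
  apply/eqP; rewrite scalerBl subr_eq0 scale1r expr2 -scalerA.
  by have := phiK (set_inv S) c; rewrite ke linearZ /= ke => ->.
move/eqP; rewrite scaler_eq0 (negPf c0) orbF subr_eq0 sqrf_eq1 => /orP[] /eqP k1.
  have [z zZ] := set_phiZ S; case/eqP.
  move: zZ; rewrite eZ e0 UE => /memv_addP[_ /vlineP[a ->] [_ /vlineP[b ->] ->]].
  by rewrite linearD !linearZ /= (phi1 (set_inv S)) ke k1 scale1r.
by rewrite ke k1 scaleN1r.
Qed.

Lemma central_fixed g c : c != 0 -> (forall d, c * d = d * c) -> c \in homog D g ->
  phi0 c = c -> g = 0 /\ exists2 r, r != 0 & c = r%:A.
Proof.
move=> c0 cC cg pc; have : g \in [:: 0; f].
  rewrite -(set_f S) -vpick0; apply: contraNneq c0 => /eqP; rewrite vpick0 => /eqP e.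
  by rewrite -memv0 -e memv_cap cg andbT; apply/centerP.
rewrite !inE => /orP[] /eqP ge; rewrite ge in cg *.
  split=> //; have [r cr] := central_real cC cg; exists r => //.
  by apply: contraNneq c0 => r0; rewrite cr r0 scale0r.
have := central_f cC cg; rewrite pc => /oppr_selfE ce.
by rewrite ce eqxx in c0.
Qed.

Lemma X_homog t : t \in T -> X t \in homog D t.
Proof. by case/(set_X S). Qed.

Lemma X_neq0 t : t \in T -> X t != 0.
Proof. by case/(set_X S). Qed.

Lemma X_unit t : t \in T -> X t \is a GRing.unit.
Proof. by move=> tT; apply: homog_unit (X_homog tT) (X_neq0 tT). Qed.

Lemma homog_quotient g a b : a \in homog D g -> b \in homog D g -> b != 0 ->
  exists2 c, c \in De & a = c * b.
Proof.
move=> ag bg b0; exists (a / b); last by rewrite divrK // (homog_unit bg b0).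
by have := homogM ag (homogV bg b0); rewrite subrr.
Qed.

Lemma homog_X t d : t \in T -> d \in homog D t -> exists2 a, a \in De & d = a * X t.
Proof. by move=> tT dt; apply: homog_quotient dt (X_homog tT) (X_neq0 tT). Qed.

Lemma inKE t : (t \in K) = (t \in T) && (isoC De ==> (homog D t <= 'C(De))%VS).
Proof. by []. Qed.

Lemma inK_T t : t \in K -> t \in T. Proof. by rewrite inKE => /andP[]. Qed.

Lemma X_commute t a : t \in K -> a \in De -> X t * a = a * X t.
Proof.
rewrite inKE => /andP[tT tC] aD; case/or3P: (Frobenius D) => [hR|hC|hH].
- by have [x ->] := isoR_span hR aD; rewrite real_comm.
- by move: tC; rewrite hC => /subvP/(_ _ (X_homog tT)) /centvP ->.
by case: (set_X S tT) => _ _ /(_ hH) /centvP ->.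
Qed.

Lemma notC_K t : isoC De = false -> (t \in K) = (t \in T).
Proof. by move=> nC; rewrite inKE nC andbT. Qed.

Lemma notK_C t : t \in T -> t \notin K -> isoC De.
Proof. by rewrite inKE => ->; rewrite negb_imply => /andP[]. Qed.

(** Here D_e = C, and c = X_t I X_t^-1 has square -1, so it is I or -I. The value I would put t in
    K, hence X_t acts on D_e as the nontrivial automorphism. *)
Lemma X_conj t a : t \in T -> t \notin K -> a \in De -> X t * a = phi0 a * X t.
Proof.
move=> tT tK aD; have hC := notK_C tT tK.
have [I [ID II pI span]] := isoC_imaginary (set_conj S) hC.
have [c cD ce] : exists2 c, c \in De & X t * I = c * X t.
  by apply: homog_X => //; have := homogM (X_homog tT) ID; rewrite addr0.
have cc : c * c = I * I.
  apply: (mulIr (X_unit tT)); rewrite -mulrA -ce mulrA -ce -mulrA II.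
  by rewrite mulrN1 mulN1r.
have [cI|cI] := De_square_eq cD ID (isoC_comm hC cD ID) cc.
  case/negP: tK; rewrite inKE tT hC /=; apply/subvP => d /(homog_X tT)[b bD ->].
  apply/centvP => e /span[x [y ->]].
  have Xe : X t * (x%:A + y *: I) = (x%:A + y *: I) * X t.
    by rewrite mulrDr mulrDl real_comm -[_ * (y *: I)]scalerAr ce cI scalerAl.
  rewrite -mulrA Xe !mulrA; congr (_ * _); apply: isoC_comm => //.
  by rewrite memvD ?De_real ?memvZ.
have [x [y ->]] := span a aD.
rewrite linearD linearZ /= (phi1 (set_inv S)) linearZ /= pI mulrDr mulrDl real_comm.
by rewrite -[_ * (y *: I)]scalerAr ce cI !mulNr !scalerN !mulNr -scalerAl.
Qed.

(** Write phi0(X_t) = a X_t with a in D_e. If t is in K and D_e is not C, then a commutes with D_e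
    and is real, and a^2 = 1 since [phi0] is an involution. Outside K, moving [phi0 a] across X_t
    conjugates it back to a, so a^2 = 1 follows directly. *)
Lemma phi_X t : t \in T -> phi0 (X t) = X t \/ phi0 (X t) = - X t.
Proof.
move=> tT; have [tK|tK] := boolP (t \in K).
  have [hC|nC] := boolP (isoC De); first by left; case: (set_X S tT) => _ _ _; apply.
  have [a aD ae] := homog_X tT (phi_homog (set_inv S) (X_homog tT)).
  have [r ar] : exists r, a = r%:A.
    apply: (De_central (negPf nC) aD) => b bD; apply: (mulIr (X_unit tT)).
    rewrite -mulrA -(X_commute tK bD) mulrA -ae -mulrA -ae.
    rewrite -{1 2}[b](phiK (set_inv S)) -!(phiM (set_inv S)).
    by rewrite (X_commute tK) // (phi_homog (set_inv S)).
  have : (r ^+ 2 - 1) *: X t = 0.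
    apply/eqP; rewrite scalerBl subr_eq0 scale1r expr2 -scalerA.
    have pr : phi0 (X t) = r *: X t by rewrite ae ar -scalerAl mul1r.
    by have := phiK (set_inv S) (X t); rewrite pr linearZ /= pr => ->.
  move/eqP; rewrite scaler_eq0 (negPf (X_neq0 tT)) orbF subr_eq0 sqrf_eq1.
  rewrite ae ar -scalerAl mul1r.
  by case/orP => /eqP ->; rewrite ?scale1r ?scaleN1r; [left | right].
have hC := notK_C tT tK.
have [a aD ae] := homog_X tT (phi_homog (set_inv S) (X_homog tT)).
have aa : a * a = 1 * 1.
  apply: (mulIr (X_unit tT)); rewrite mulr1 mul1r -mulrA -ae.
  rewrite -{2}[X t](phiK (set_inv S)) ae (phiM (set_inv S)) ae.
  by rewrite -mulrA (X_conj tT tK) ?(phiK (set_inv S)) // (phi_homog (set_inv S)).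
have [e|e] := De_square_eq aD (homog1 D) (commr1 a) aa.
  by left; rewrite ae e mul1r.
by right; rewrite ae e mulN1r.
Qed.

Lemma etaE t : t \in T -> phi0 (X t) = (eta t)%:~R *: X t.
Proof.
move=> tT; rewrite /etaX; case: eqP => [->|ne]; first by rewrite scale1r.
by case: (phi_X tT) => // ->; rewrite scaleN1r.
Qed.

Lemma eta_sign t : eta t = 1 \/ eta t = -1.
Proof. by rewrite /etaX; case: ifP; [left | right]. Qed.

Lemma eta_C t : isoC De -> t \in K -> eta t = 1.
Proof.
move=> hC tK; rewrite /etaX; case: (set_X S (inK_T tK)) => _ _ _ -> //.
by rewrite eqxx.
Qed.

Lemma imaginary_not_real I : I \in De -> I * I = -1 -> forall r, I <> r%:A.
Proof.
move=> _ II r Ir; have : (r ^+ 2 + 1)%:A = 0 :> D.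
  have : r%:A * r%:A = -1 :> D by rewrite -Ir.
  by rewrite -scalerAl mul1r scalerA -expr2 scalerDl scale1r => ->; rewrite addNr.
move/eqP; rewrite scaler_eq0 oner_eq0 orbF paddr_eq0 ?sqr_ge0 ?ler01 //.
by rewrite oner_eq0 andbF.
Qed.

(** If K were T, the imaginary unit of D_e = C would be central of degree 0, but such elements are
    real. *)
Lemma exists_notK : isoC De -> exists2 w, w \in T & w \notin K.
Proof.
move=> hC; apply: contrapT => H.
have TK t : t \in T -> t \in K.
  by move=> tT; apply: contrapT => /negP tK; apply: H; exists t.
have [I [ID II _ _]] := isoC_imaginary (set_conj S) hC.
have [] := @central_real I _ ID; last by move=> r; apply: imaginary_not_real.
elim/homog_ind => [|a b ha hb|g a gT ag]; rewrite ?mulr0 ?mul0r //.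
  by rewrite mulrDr mulrDl ha hb.
have [b bD ->] := homog_X gT ag.
by rewrite mulrA (isoC_comm hC ID bD) -!mulrA (X_commute (TK _ gT) ID).
Qed.

Lemma central_of_X c : (forall a, a \in De -> c * a = a * c) ->
  (forall t, t \in T -> c * X t = X t * c) -> forall d, c * d = d * c.
Proof.
move=> cD cX; elim/homog_ind => [|a b ha hb|g a gT ag]; rewrite ?mulr0 ?mul0r //.
  by rewrite mulrDr mulrDl ha hb.
have [b bD ->] := homog_X gT ag.
by rewrite mulrA cD // -!mulrA cX.
Qed.

End Setting.

(** * Commutation signs and the exponent of the support *)

Section Commutation.
Variables (R : realType) (G : zmodType) (D : gradedDivAlg R G).
Variables (phi0 : {linear D -> D}) (X : G -> D) (f : G).
Local Notation De := (homog D 0).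
Local Notation T := (supp D).
Local Notation K := (inK D).
Hypothesis S : setting phi0 X f.

(** One nonzero element suffices: the component is D_e times that element, and D_e is commutative
    whenever the condition is not void. *)
Lemma inK_of_commute t d : d \in homog D t -> d != 0 ->
  (forall a, a \in De -> d * a = a * d) -> t \in K.
Proof.
move=> dt d0 dD; have tT : t \in T by apply/suppP; exists d.
rewrite inKE tT /=; apply/implyP => hC; apply/subvP => e et; apply/centvP => b bD.
have [c cD ->] := homog_quotient et dt d0.
by rewrite -mulrA dD // !mulrA (isoC_comm hC cD bD).
Qed.

Lemma inK0 : 0 \in K.
Proof.
apply: (inK_of_commute (homog1 D) (oner_neq0 _)) => a _; by rewrite mul1r mulr1.
Qed.

Lemma inKD s t : s \in K -> t \in K -> s + t \in K.
Proof.
move=> sK tK; have sT := inK_T sK; have tT := inK_T tK.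
apply: (inK_of_commute (homogM (X_homog S sT) (X_homog S tT))).
  exact: homog_neq0M (X_homog S sT) (X_neq0 S sT) (X_neq0 S tT).
by move=> a aD; rewrite -mulrA (X_commute S tK aD) !mulrA (X_commute S sK aD).
Qed.

Lemma notK_add s t : s \in T -> s \notin K -> t \in T -> t \notin K -> s + t \in K.
Proof.
move=> sT sK tT tK.
apply: (inK_of_commute (homogM (X_homog S sT) (X_homog S tT))).
  exact: homog_neq0M (X_homog S sT) (X_neq0 S sT) (X_neq0 S tT).
move=> a aD; rewrite -mulrA (X_conj S tT tK aD) mulrA (X_conj S sT sK).
  by rewrite (phiK (set_inv S)) mulrA.
exact: phi_homog (set_inv S) _ _ aD.
Qed.

Lemma notK_sub s t : s \in T -> s \notin K -> t \in T -> t \notin K -> s - t \in K.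
Proof.
move=> sT sK tT tK; apply: contraNT sK => stK.
by rewrite -[s](subrK t); apply: notK_add => //; apply: rpredB.
Qed.

(** The commutator X_s X_t X_s^-1 X_t^-1, encoded by a test for commutation. That failure of the
    test means anticommutation is [betaE], valid once the first degree lies in K and the other in
    T. *)
Definition beta s t : R := if X s * X t == X t * X s then 1 else -1.

Lemma betaC s t : beta s t = beta t s.
Proof. by rewrite /beta eq_sym. Qed.

Lemma beta_sqr s t : beta s t * beta s t = 1.
Proof. by rewrite /beta; case: ifP; rewrite ?mulr1 // mulrNN mulr1. Qed.

Lemma X_quotient s t : s \in T -> t \in T ->
  exists2 a, a \in De & X s * X t = a * (X t * X s).
Proof.
move=> sT tT; apply: homog_quotient (homogM (X_homog S sT) (X_homog S tT)) _ _.
  by rewrite addrC; apply: homogM (X_homog S tT) (X_homog S sT).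
exact: homog_neq0M (X_homog S tT) (X_neq0 S tT) (X_neq0 S sT).
Qed.

Lemma XX_unit s t : s \in T -> t \in T -> X s * X t \is a GRing.unit.
Proof. by move=> sT tT; rewrite unitrMr (X_unit S). Qed.

Lemma X_commutation_sign s t a : s \in T -> t \in T -> a \in De ->
  X s * X t = a * (X t * X s) -> a * a = 1 -> X s * X t = beta s t *: (X t * X s).
Proof.
move=> sT tT aD e aa; rewrite /beta; case: eqP => [->|ne]; first by rewrite scale1r.
have [a1|a1] := De_square_eq aD (homog1 D) (commr1 a) (etrans aa (esym (mulr1 1))).
  by case: ne; rewrite e a1 mul1r.
by rewrite e a1 mulN1r scaleN1r.
Qed.

Definition etaR t : R := (etaX phi0 X t)%:~R.

Lemma etaR_sqr t : etaR t * etaR t = 1.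
Proof.
by rewrite /etaR; case: (eta_sign phi0 X t) => ->; rewrite ?mulr1 // mulrNN mulr1.
Qed.

Lemma etaR_neq0 t : etaR t != 0.
Proof. by rewrite -sqrf_eq0 expr2 etaR_sqr oner_neq0. Qed.

Lemma phi_XX s t : s \in T -> t \in T ->
  phi0 (X s * X t) = (etaR s * etaR t) *: (X t * X s).
Proof.
move=> sT tT; rewrite (phiM (set_inv S)) !(etaE S) //.
by rewrite -scalerAl -scalerAr scalerA mulrC.
Qed.

(** The quotient a of the two products commutes with D_e, hence is real. Applying [phi0] reverses
    both products, and a^2 = 1. *)
Lemma betaE_notC s t : isoC De = false -> s \in T -> t \in T ->
  X s * X t = beta s t *: (X t * X s).
Proof.
move=> nC sT tT; have [a aD ae] := X_quotient sT tT.
have sK : s \in K by rewrite (notC_K _ nC).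
have tK : t \in K by rewrite (notC_K _ nC).
have [r ar] : exists r, a = r%:A.
  apply: (De_central nC aD) => b bD; apply: (mulIr (XX_unit tT sT)).
  have com u v : u \in K -> v \in K -> b * (X u * X v) = X u * X v * b.
    by move=> uK vK; rewrite -mulrA (X_commute S vK bD) mulrA -(X_commute S uK bD) mulrA.
  by rewrite -mulrA com // mulrA -ae -com // ae mulrA.
apply: (X_commutation_sign sT tT aD ae).
have := congr1 phi0 ae; rewrite ar -scalerAl mul1r linearZ /= !phi_XX // scalerA.
rewrite [r * _]mulrC -[in RHS]scalerA [etaR t * _]mulrC => /scalerI e.
apply: (mulIr (XX_unit tT sT)); rewrite mul1r -mulrA -ar -ae ar -scalerAl mul1r e //.
by rewrite mulf_neq0 // etaR_neq0.
Qed.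

(** Applying [phi0] replaces a by its conjugate, and moving that across X_t conjugates it once more.
    So a^2 = 1 comes out without knowing beforehand that a is real. *)
Lemma betaE_mixed s t : s \in K -> t \in T -> t \notin K ->
  X s * X t = beta s t *: (X t * X s).
Proof.
move=> sK tT tK; have sT := inK_T sK; have hC := notK_C tT tK.
have [a aD ae] := X_quotient sT tT.
have pD : phi0 a \in De by exact: phi_homog (set_inv S) _ _ aD.
apply: (X_commutation_sign sT tT aD ae).
have := congr1 phi0 ae; rewrite [phi0 (a * _)](phiM (set_inv S)) !phi_XX // -scalerAl -mulrA.
rewrite (X_conj S tT tK pD) (phiK (set_inv S)).
rewrite [X s * (_ * _)]mulrA (X_commute S sK aD) -!mulrA mulrC => /scalerI e.
apply: (mulIr (XX_unit tT sT)); rewrite mul1r -mulrA -ae e //.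
by rewrite mulf_neq0 // etaR_neq0.
Qed.

(** Here a must first be shown to be real. Moving X_w, with w outside K, across both products
    multiplies them by the same sign and replaces a by [phi0 a]. *)
Lemma betaE_C s t : isoC De -> s \in K -> t \in K ->
  X s * X t = beta s t *: (X t * X s).
Proof.
move=> hC sK tK; have sT := inK_T sK; have tT := inK_T tK.
have [w wT wK] := exists_notK S hC.
have [a aD ae] := X_quotient sT tT.
have pD : phi0 a \in De by exact: phi_homog (set_inv S) _ _ aD.
apply: (X_commutation_sign sT tT aD ae).
have pa : phi0 a = a.
  have conj u : u \in K -> X w * X u = beta u w *: (X u * X w).
    by move=> uK; rewrite (betaE_mixed uK wT wK) scalerA beta_sqr scale1r.
  have conj2 u v : u \in K -> v \in K ->
      X w * (X u * X v) = (beta u w * beta v w) *: (X u * X v * X w).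
    by move=> uK vK; rewrite mulrA conj // -scalerAl -[X u * X w * X v]mulrA conj // -scalerAr scalerA mulrA.
  have b0 u : beta u w != 0 by rewrite -sqrf_eq0 expr2 beta_sqr oner_neq0.
  have := congr1 (fun u => X w * u) ae.
  rewrite conj2 // [X w * (a * _)]mulrA (X_conj S wT wK aD) -[phi0 a * _ * _]mulrA conj2 //.
  rewrite -scalerAr mulrC => /scalerI e.
  apply: (mulIr (XX_unit tT sT)); apply: (mulIr (X_unit S wT)).
  by rewrite -ae e ?mulf_neq0 // !mulrA.
have := congr1 phi0 ae; rewrite [phi0 (a * _)](phiM (set_inv S)) !phi_XX // -scalerAl pa.
rewrite -mulrA (X_commute S tK aD) mulrA (X_commute S sK aD) -!mulrA mulrC.
move=> /scalerI e.
apply: (mulIr (XX_unit tT sT)); rewrite mul1r -mulrA -ae e //.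
by rewrite mulf_neq0 // etaR_neq0.
Qed.

Lemma betaE s t : s \in K -> t \in T -> X s * X t = beta s t *: (X t * X s).
Proof.
move=> sK tT; have [hC|nC] := boolP (isoC De); last first.
  by apply: betaE_notC (negPf nC) (inK_T sK) tT.
by have [tK|tK] := boolP (t \in K); [apply: betaE_C | apply: betaE_mixed].
Qed.

Lemma commute_square a b (k : R) : k * k = 1 -> a * b = k *: (b * a) ->
  (a * a * b = b * (a * a) :> D) /\ (a * (b * b) = b * b * a).
Proof.
move=> kk e; split.
  by rewrite -mulrA e -scalerAr [a * (b * a)]mulrA e -scalerAl scalerA kk scale1r mulrA.
by rewrite mulrA e -scalerAl -[b * a * b]mulrA e -scalerAr scalerA kk scale1r mulrA.
Qed.

(** Only a sign arises when X_u passes X_t and one of t, u lies in K. If neither does, X_t is a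
    D_e-multiple of X_{t-u} X_u with t - u in K. *)
Lemma X_square_central u : u \in T -> forall d, X u * X u * d = d * (X u * X u).
Proof.
move=> uT; have DeC a : a \in De -> X u * X u * a = a * (X u * X u).
  move=> aD; have [uK|uK] := boolP (u \in K).
    by rewrite -mulrA (X_commute S uK aD) !mulrA (X_commute S uK aD).
  rewrite -mulrA (X_conj S uT uK aD) mulrA (X_conj S uT uK).
    by rewrite (phiK (set_inv S)) mulrA.
  exact: phi_homog (set_inv S) _ _ aD.
have XC t : t \in K -> X u * X u * X t = X t * (X u * X u).
  by move=> tK; have [_ ->] := commute_square (beta_sqr t u) (betaE tK uT).
apply: (central_of_X S DeC) => t tT; have [tK|tK] := boolP (t \in K); first exact: XC.
have [uK|uK] := boolP (u \in K).
  by have [-> _] := commute_square (beta_sqr u t) (betaE uK tT).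
have tuK := notK_sub tT tK uT uK; have tuT := inK_T tuK.
have Xtu : X (t - u) * X u \in homog D t.
  by have := homogM (X_homog S tuT) (X_homog S uT); rewrite subrK.
have [|a aD ->] := homog_quotient (X_homog S tT) Xtu.
  exact: homog_neq0M (X_homog S tuT) (X_neq0 S tuT) (X_neq0 S uT).
rewrite mulrA DeC // -!mulrA; congr (a * _).
by rewrite !mulrA XC // !mulrA.
Qed.

Lemma X_square u : u \in T -> u + u = 0 /\ exists2 r, r != 0 & X u * X u = r%:A.
Proof.
move=> uT; apply: (central_fixed S _ (X_square_central uT)).
- exact: homog_neq0M (X_homog S uT) (X_neq0 S uT) (X_neq0 S uT).
- exact: homogM (X_homog S uT) (X_homog S uT).
by rewrite phi_XX // etaR_sqr scale1r.
Qed.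

Lemma oppT u : u \in T -> - u = u.
Proof. by move=> /X_square[e _]; apply/eqP; rewrite eq_sym -addr_eq0 e. Qed.

Lemma central_of_K c : (forall a, a \in De -> c * a = a * c) ->
  (forall t, t \in K -> c * X t = X t * c) ->
  (forall w, w \in T -> w \notin K -> c * X w = X w * c) -> forall d, c * d = d * c.
Proof.
move=> cD cK cw; apply: (central_of_X S cD) => t tT.
by have [tK|tK] := boolP (t \in K); [apply: cK | apply: cw].
Qed.

(** T is the union of K and the coset K + w, so testing a single X_w outside K is enough. *)
Lemma commute_notK c w : w \in T -> w \notin K -> (forall a, a \in De -> c * a = a * c) ->
  (forall t, t \in K -> c * X t = X t * c) -> c * X w = X w * c ->
  forall d, c * d = d * c.
Proof.
move=> wT wK cD cK cw; apply: central_of_K => // t tT tK.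
have twK := notK_sub tT tK wT wK; have twT := inK_T twK.
have Xtu : X (t - w) * X w \in homog D t.
  by have := homogM (X_homog S twT) (X_homog S wT); rewrite subrK.
have [|a aD ->] := homog_quotient (X_homog S tT) Xtu.
  exact: homog_neq0M (X_homog S twT) (X_neq0 S twT) (X_neq0 S wT).
by rewrite mulrA cD // -!mulrA; congr (a * _); rewrite mulrA cK // -!mulrA cw.
Qed.

Lemma central_support g c : c \in homog D g -> c != 0 -> (forall d, c * d = d * c) ->
  g = 0 \/ g = f.
Proof.
move=> cg c0 cC; have : g \in [:: 0; f].
  rewrite -(set_f S) -vpick0; apply: contraNneq c0 => /eqP; rewrite vpick0 => /eqP e.
  by rewrite -memv0 -e memv_cap cg andbT; apply/centerP.
by rewrite !inE => /orP[] /eqP; [left | right].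
Qed.

(** When D_e = C, X_t may commute with all X_s for s in K and still anticommute with X_w. In that
    case I X_t is central, because X_w anticommutes with I as well. *)
Lemma radical t : t \in K -> (forall s, s \in K -> beta t s = 1) -> t = 0 \/ t = f.
Proof.
move=> tK tb; have tT := inK_T tK.
have XK s : s \in K -> X t * X s = X s * X t.
  by move=> sK; rewrite (betaE tK (inK_T sK)) tb // scale1r.
have [hC|nC] := boolP (isoC De); last first.
  apply: (central_support (X_homog S tT) (X_neq0 S tT)).
  apply: (central_of_X S) => [a aD|s sT]; first exact: X_commute S _ _ tK aD.
  by apply: XK; rewrite notC_K // (negPf nC).
have [w wT wK] := exists_notK S hC.
have := betaE tK wT; rewrite /beta; case: eqP => [ctw _|_ ctw].
  apply: (central_support (X_homog S tT) (X_neq0 S tT)).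
  apply: (commute_notK wT wK) => // a aD; exact: X_commute S _ _ tK aD.
have [I [ID II pI span]] := isoC_imaginary (set_conj S) hC.
have I0 : I != 0.
  by apply/eqP => I0; move/eqP: II; rewrite I0 mul0r eq_sym oppr_eq0 oner_eq0.
apply: (@central_support _ (I * X t)).
- by have := homogM ID (X_homog S tT); rewrite add0r.
- exact: homog_neq0M ID I0 (X_neq0 S tT).
apply: (commute_notK wT wK) => [a aD|s sK|].
- by rewrite -mulrA (X_commute S tK aD) !mulrA (isoC_comm hC ID aD).
- by rewrite -mulrA XK // !mulrA (X_commute S sK ID).
by rewrite -mulrA ctw [RHS]mulrA (X_conj S wT wK ID) pI scaleN1r mulrN !mulNr mulrA.
Qed.

Lemma central_generator : exists z, [/\ z \in homog D f, z != 0 & forall d, z * d = d * z].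
Proof.
have : ('Z({:D}) :&: homog D f != 0)%VS by rewrite (set_f S) !inE eqxx orbT.
rewrite -vpick0 => z0; exists (vpick ('Z({:D}) :&: homog D f)%VS).
have := memv_pick ('Z({:D}) :&: homog D f)%VS; rewrite memv_cap => /andP[zZ zf].
by split=> //; apply/centerP.
Qed.

Lemma inKf : f \in K.
Proof.
have [z [zf z0 zC]] := central_generator.
by apply: (inK_of_commute zf z0) => a _; apply: zC.
Qed.

End Commutation.

(** * Graded endomorphisms of D *)

Section GradedEndomorphisms.
Variables (R : realType) (G : zmodType) (D : gradedDivAlg R G).
Local Notation De := (homog D 0).

(** Only triviality of the kernel is recorded; surjectivity follows on each finite-dimensional
    component by [endo_surj_on]. *)
Record graded_endo (psi : D -> D) : Prop := GradedEndo {
  endo_linear : linear psi;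
  endoM : {morph psi : a b / a * b};
  endo1 : psi 1 = 1;
  endo_homog : forall g d, d \in homog D g -> psi d \in homog D g;
  endo_inj : forall d, psi d = 0 -> d = 0
}.

Section Endo.
Variable psi : D -> D.
Hypothesis E : graded_endo psi.

Lemma endo0 : psi 0 = 0.
Proof.
have := endo_linear E (-1) 1 1; rewrite scaleN1r addNr scaleN1r addNr.
by [].
Qed.

Lemma endoZ k d : psi (k *: d) = k *: psi d.
Proof. by have := endo_linear E k d 0; rewrite endo0 !addr0. Qed.

Lemma endoD a b : psi (a + b) = psi a + psi b.
Proof. by have := endo_linear E 1 a b; rewrite !scale1r. Qed.

Lemma endoN a : psi (- a) = - psi a.
Proof. by rewrite -scaleN1r endoZ scaleN1r. Qed.

Lemma endo_real k : psi k%:A = k%:A.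
Proof. by rewrite endoZ (endo1 E). Qed.

Lemma endo_surj_on g b : b \in homog D g -> exists2 a, a \in homog D g & psi a = b.
Proof.
pose h : {linear D -> D} := HB.pack psi (GRing.isLinear.Build R D D _ psi (endo_linear E)).
pose l := linfun h; have lE d : l d = psi d by rewrite lfunE.
have k0 : (lker l == 0)%VS.
  by rewrite -subv0; apply/subvP => v; rewrite memv_ker memv0 => /eqP vk; apply/eqP/(endo_inj E); rewrite -lE.
have : (l @: homog D g)%VS = homog D g.
  apply/eqP; rewrite eqEdim; apply/andP; split.
    by apply/subvP => _ /memv_imgP[v vg ->]; rewrite lE; apply: endo_homog.
  by rewrite limg_dim_eq // (eqP k0) capv0.
by move=> e; rewrite -[in b \in _]e => /memv_imgP[v vg ->]; exists v; rewrite ?lE.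
Qed.

Lemma endo_surj b : exists a, psi a = b.
Proof.
elim/homog_ind: b => [|a b [u <-] [v <-]|g a _ /endo_surj_on[u _ <-]].
- by exists 0; rewrite endo0.
- by exists (u + v); rewrite endoD.
by exists u.
Qed.

Lemma endo_conj g c : c \in homog D g -> c != 0 ->
  graded_endo (fun d => c^-1 * psi d * c).
Proof.
move=> cg c0; have cU := homog_unit cg c0; split.
- move=> k a b; rewrite endoD endoZ mulrDr mulrDl.
  by rewrite -scalerAr -scalerAl.
- by move=> a b; rewrite (endoM E) !mulrA mulrK ?mulrA.
- by rewrite (endo1 E) mulr1 mulVr.
- move=> h d dh; have := homogM (homogM (homogV cg c0) (endo_homog E dh)) cg.
  by rewrite addrC addNKr || rewrite [- g + h]addrC subrK.
move=> d /(congr1 (fun u => c * u * c^-1)); rewrite !mulrA mulrV // mul1r mulrK //.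
by rewrite mulr0 mul0r; apply: endo_inj.
Qed.

End Endo.
End GradedEndomorphisms.

(** * Normalizing a graded automorphism by inner ones *)

Section Normalization.
Variables (R : realType) (G : zmodType) (D : gradedDivAlg R G).
Variables (phi0 : {linear D -> D}) (X : G -> D) (f : G).
Local Notation De := (homog D 0).
Local Notation T := (supp D).
Local Notation K := (inK D).
Hypothesis S : setting phi0 X f.

(** Trace and norm are real. The defect psi(phi0 a) - phi0(psi a) is the difference t - t' of two
    traces, and its product with psi a is a difference of norms. So either the defect is 0, or psi
    a, hence a, is real. *)
Lemma endo_phi_De psi a : graded_endo psi -> a \in De -> psi (phi0 a) = phi0 (psi a).
Proof.
move=> E aD; have pI := set_inv S; have pC := set_conj S.
have trace b : b \in De -> exists t, b + phi0 b = t%:A.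
  move=> bD; apply: (De_fixed pC); first by rewrite memvD ?(phi_homog pI).
  by rewrite linearD /= (phiK pI) addrC.
have norm b : b \in De -> exists n, phi0 b * b = n%:A.
  move=> bD; apply: (De_fixed pC); first by rewrite De_mul ?(phi_homog pI).
  by rewrite (phiM pI) (phiK pI).
have pD := endo_homog E aD.
have [t te] := trace _ aD; have [t' te'] := trace _ pD.
have [n ne] := norm _ aD; have [n' ne'] := norm _ pD.
have e1 : psi (phi0 a) - phi0 (psi a) = (t - t')%:A.
  rewrite scalerBl -te' -(endo_real E) -te (endoD E) opprD addrACA subrr add0r.
  by [].
have e2 : (t - t') *: psi a = (n - n')%:A.
  rewrite -[psi a]mul1r scalerAl -e1 mulrBl -(endoM E) ne ne' (endo_real E).
  by rewrite -scalerBl.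
have [tt|tt] := eqVneq t t'.
  by apply/eqP; rewrite -subr_eq0 e1 tt subrr scale0r.
have pr : psi a = ((t - t')^-1 * (n - n'))%:A.
  by rewrite -scalerA -e2 scalerA mulVf ?scale1r // subr_eq0.
have ar : a = ((t - t')^-1 * (n - n'))%:A.
  apply/eqP; rewrite -subr_eq0; apply/eqP; apply: (endo_inj E).
  by rewrite (endoD E) (endoN E) (endo_real E) pr subrr.
by rewrite ar (phi_real pI) (endo_real E) (phi_real pI).
Qed.

(** On D_e = C, psi is the identity or the conjugation, and X_w with w outside K undoes the latter.
    For R and H nothing has to be done: the arguments on K meet only elements of D_e commuting with
    D_e, and these are real. *)
Lemma normalize_De psi : graded_endo psi -> exists g c,
  [/\ c \in homog D g, c != 0 &
      isoC De -> forall a, a \in De -> c^-1 * psi a * c = a].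
Proof.
move=> E; have [hC|nC] := boolP (isoC De); last first.
  by exists 0, 1; split=> [||//]; rewrite ?homog1 ?oner_neq0.
have [I [ID II pI span]] := isoC_imaginary (set_conj S) hC.
have pID := endo_homog E ID.
have [e|e] := De_square_eq pID ID (isoC_comm hC pID ID) (etrans (esym (endoM E I I))
    (etrans (congr1 psi II) (etrans (endoN E 1) (etrans (congr1 -%R (endo1 E)) (esym II))))).
  exists 0, 1; split=> [||_ a /span[x [y ->]]]; rewrite ?homog1 ?oner_neq0 //.
  by rewrite invr1 mul1r mulr1 (endoD E) (endo_real E) (endoZ E) e.
have [w wT wK] := exists_notK S hC; exists w, (X w).
split=> [||_ a aD]; [exact: X_homog S _ wT | exact: X_neq0 S _ wT|].
rewrite -mulrA; apply: (mulrI (X_unit S wT)); rewrite mulVKr ?(X_unit S) //.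
rewrite (X_conj S wT wK aD); congr (_ * _).
have [x [y ->]] := span a aD.
rewrite (endoD E) (endo_real E) (endoZ E) e linearD linearZ /= (phi1 (set_inv S)).
by rewrite linearZ /= pI.
Qed.

Definition K_seq := [seq t <- supp_seq D | t \in K].

Lemma mem_K_seq t : (t \in K_seq) = (t \in K).
Proof.
rewrite mem_filter mem_supp_seq; case tK: (t \in K) => //=.
exact: inK_T tK.
Qed.

Lemma sum_K_shift (A : nzRingType) (h : G -> A) u : u \in K ->
  \sum_(t <- K_seq) h (u + t) = \sum_(t <- K_seq) h t.
Proof.
move=> uK; rewrite -(big_map (fun t => u + t) predT h); apply: perm_big.
have uS : uniq K_seq by rewrite filter_uniq ?supp_seq_uniq.
apply: uniq_perm => //; first by rewrite map_inj_uniq //; apply: addrI.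
move=> t; rewrite mem_K_seq; apply/mapP/idP => [[v]|tK].
  by rewrite mem_K_seq => vK ->; apply: inKD S _ _ uK vK.
have uu := oppT S (inK_T uK).
by exists (u + t); rewrite ?mem_K_seq ?(inKD S) // -{1}uu addKr.
Qed.

(** Translation by u permutes the summands. In a domain, a nonzero sum therefore forces h u = 1. *)
Lemma character_sum (A : nzRingType) (h : G -> A) u : u \in K ->
  {in K &, {morph h : s t / s + t >-> s * t}} ->
  h u * \sum_(t <- K_seq) h t = \sum_(t <- K_seq) h t.
Proof.
move=> uK hM; rewrite -[RHS](sum_K_shift h uK) mulr_sumr big_seq [RHS]big_seq.
by apply: eq_bigr => t; rewrite mem_K_seq => tK; rewrite hM.
Qed.

Lemma XD s t : s \in T -> t \in T ->
  exists2 a, a \in De /\ a != 0 & X s * X t = a * X (s + t).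
Proof.
move=> sT tT; have stT := suppD sT tT.
have [a aD ae] := homog_X S stT (homogM (X_homog S sT) (X_homog S tT)).
exists a => //; split=> //; apply/eqP => a0; move/eqP: ae.
by rewrite a0 mul0r (negPf (homog_neq0M (X_homog S sT) (X_neq0 S sT) (X_neq0 S tT))).
Qed.

Lemma betaDr t : t \in K -> {in K &, {morph beta X t : s u / s + u >-> s * u}}.
Proof.
move=> tK s u sK uK; have sT := inK_T sK; have uT := inK_T uK.
have suT := inK_T (inKD S sK uK); have tT := inK_T tK.
have [a [aD a0] ae] := XD sT uT.
have : X t * (X s * X u) = (beta X t s * beta X t u) *: (X s * X u * X t).
  rewrite mulrA (betaE S tK sT) -scalerAl -[X s * X t * X u]mulrA (betaE S tK uT).
  by rewrite -scalerAr scalerA mulrA.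
rewrite ae mulrA (X_commute S tK aD) -mulrA (betaE S tK suT) -scalerAr -mulrA => /eqP.
rewrite -subr_eq0 -scalerBl scaler_eq0 subr_eq0 => /orP[/eqP //|].
rewrite mulrI_eq0; last exact/mulrI/(homog_unit aD).
by rewrite (negPf (homog_neq0M (X_homog S suT) (X_neq0 S suT) (X_neq0 S tT))).
Qed.

Lemma beta0 s : s \in K -> beta X 0 s = 1.
Proof.
move=> sK; rewrite /beta (X_commute S sK) ?eqxx //.
exact: X_homog S _ (supp0 D).
Qed.

(** X_f itself need not be central: when D_e = C, [phi0] fixes X_f but negates z, so that a is
    purely imaginary. *)
Lemma X_f : exists a z, [/\ a \in De, z \in homog D f /\ z != 0, forall d, z * d = d * z,
  X f = a * z & forall t, t \in K -> X t * a = a * X t].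
Proof.
have [z [zf z0 zC]] := central_generator S.
have fT := inK_T (inKf S).
have [a aD ae] := homog_quotient (X_homog S fT) zf z0.
by exists a, z; split=> // t tK; apply: X_commute S _ _ tK aD.
Qed.

Lemma betaf s : s \in K -> beta X f s = 1.
Proof.
move=> sK; have [a [z [aD _ zC fE aX]]] := X_f.
by rewrite /beta fE -mulrA zC mulrA -aX // -mulrA eqxx.
Qed.

Lemma sum_beta t : t \in K -> t != 0 -> t != f -> \sum_(s <- K_seq) beta X t s = 0.
Proof.
move=> tK t0 tf; apply: contrapT => /eqP s0.
have [e|e] : t = 0 \/ t = f; last 2 first.
- by rewrite e eqxx in t0.
- by rewrite e eqxx in tf.
apply: (radical S tK) => s sK.
have := character_sum sK (betaDr tK) => /eqP.
by rewrite -{2}[\sum_(_ <- _) _]mul1r (inj_eq (mulIf s0)) => /eqP.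
Qed.

Section ScalarEndomorphism.
Variable psi : D -> D.
Hypotheses (E : graded_endo psi)
  (psiC : isoC De -> forall a, a \in De -> psi a = a).

Lemma psi_commutant a : a \in De -> (forall b, b \in De -> a * b = b * a) -> psi a = a.
Proof.
move=> aD ac; have [hC|nC] := boolP (isoC De); first exact: psiC.
by have [r ->] := De_central (negPf nC) aD ac; rewrite (endo_real E).
Qed.

Lemma psi_X_scalar t : t \in K -> exists a, [/\ a \in De, a != 0,
  forall b, b \in De -> a * b = b * a & psi (X t) = a * X t].
Proof.
move=> tK; have tT := inK_T tK.
have [a aD ae] := homog_X S tT (endo_homog E (X_homog S tT)).
exists a; split=> // [|b bD].
  apply/eqP => a0; have := X_neq0 S tT; rewrite (endo_inj E (d := X t)) ?eqxx //.
  by rewrite ae a0 mul0r.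
have [c cD ce] := endo_surj_on E bD.
apply: (mulIr (X_unit S tT)).
by rewrite -mulrA -(X_commute S tK bD) mulrA -ae -mulrA -ae -ce -!(endoM E) (X_commute S tK cD).
Qed.

Definition chi t : D := locked (psi (X t) / X t).

Lemma chiE t : t \in K -> psi (X t) = chi t * X t.
Proof. by move=> tK; rewrite /chi -lock divrK // (X_unit S (inK_T tK)). Qed.

Lemma chiP t : t \in K ->
  [/\ chi t \in De, chi t != 0 & forall b, b \in De -> chi t * b = b * chi t].
Proof.
move=> tK; have [a [aD a0 ac ae]] := psi_X_scalar tK.
by rewrite /chi -lock ae mulrK ?(X_unit S (inK_T tK)).
Qed.

(** The factor a in X_s X_t = a X_{s+t} is a quotient of elements commuting with D_e, so psi fixes
    it and it cancels. *)
Lemma chiM : {in K &, {morph chi : s t / s + t >-> s * t}}.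
Proof.
move=> s t sK tK; have sT := inK_T sK; have tT := inK_T tK.
have stK := inKD S sK tK; have stT := inK_T stK.
have [a [aD a0] ae] := XD sT tT.
have [sD _ sc] := chiP sK; have [tD _ tc] := chiP tK; have [_ _ stc] := chiP stK.
have pa : psi a = a.
  apply: psi_commutant => // b bD; apply: (mulIr (X_unit S stT)).
  rewrite -!mulrA -ae -(X_commute S stK bD) !mulrA -ae.
  by rewrite -[X s * X t * b]mulrA (X_commute S tK bD) !mulrA (X_commute S sK bD).
have : psi (X s * X t) = a * (chi s * chi t) * X (s + t).
  rewrite (endoM E) !chiE // -[LHS]mulrA [X s * (_ * _)]mulrA (X_commute S sK tD).
  rewrite -[chi t * X s * X t]mulrA ae !mulrA.
  by rewrite -[chi s * chi t * a]mulrA tc // !mulrA sc // -[a * chi s * _]mulrA.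
rewrite ae (endoM E) pa chiE // mulrA => /(mulIr (X_unit S stT)).
by move/(mulrI (homog_unit aD a0)).
Qed.

(** psi preserves the central line spanned by z, and z^2 is real, so psi multiplies z by a sign. The
    remaining factor of X_f in D_e is fixed by psi. *)
Lemma chi_f : chi f = 1 \/ chi f = -1.
Proof.
have [a [z [aD [zf z0] zC fE aX]]] := X_f.
have fK := inKf S; have fT := inK_T fK.
have pz : forall d, psi z * d = d * psi z.
  by move=> d; have [c <-] := endo_surj E d; rewrite -!(endoM E) zC.
have [_ df _] := center_decomposition S.
have cZ d : (forall e, d * e = e * d) -> d \in homog D f ->
    d \in ('Z({:D}) :&: homog D f)%VS.
  by move=> dC dd; rewrite memv_cap dd andbT; apply/centerP.
have UE : ('Z({:D}) :&: homog D f = <[z]>)%VS.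
  by apply/esym/eqP; rewrite eqEdim df dim_vline z0 -memvE cZ.
have /vlineP[k ke] : psi z \in <[z]>%VS by rewrite -UE cZ // (endo_homog E).
have zz0 : z * z != 0 by exact: (homog_neq0M zf).
have [_ [r r0 zr]] : f + f = 0 /\ exists2 r, r != 0 & z * z = r%:A.
  apply: (central_fixed S zz0) => [d||]; last 2 first.
  - exact: homogM.
  - by rewrite (phiM (set_inv S)) (central_f S zC zf) mulrNN.
  by rewrite -mulrA zC -mulrA zC mulrA.
have kk : k * k = 1.
  have : psi (z * z) = z * z by rewrite zr (endo_real E).
  rewrite (endoM E) ke -scalerAl -scalerAr scalerA => /eqP.
  rewrite -subr_eq0 -{2}[z * z]scale1r -scalerBl scaler_eq0 (negPf zz0) orbF.
  by rewrite subr_eq0 => /eqP.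
have ca b : b \in De -> a * b = b * a.
  move=> bD; apply: (mulIr (homog_unit zf z0)).
  by rewrite -mulrA -zC mulrA -fE (X_commute S fK bD) fE mulrA.
have pf : psi (X f) = k *: X f.
  by rewrite fE (endoM E) ke psi_commutant // -scalerAr.
rewrite /chi -lock pf -scalerAl divrr ?(X_unit S) //.
have /eqP := kk; rewrite -expr2 sqrf_eq1 => /orP[] /eqP ->; [left | right].
  by rewrite scale1r.
by rewrite scaleN1r.
Qed.

(** Each [th s] is a D_e-valued character of K, trivial as soon as its sum over K is nonzero. If all
    these sums vanished, so would their total over s. But by orthogonality only t = 0 and t = f
    contribute to the total, each with the order of K; for t = f this is where chi f = m f
    enters. *)
Lemma chi_inner (m : G -> R) : (forall t, t \in K -> m t * m t = 1) ->
  {in K &, {morph m : s t / s + t >-> s * t}} -> chi f = (m f)%:A ->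
  exists2 s, s \in K & forall t, t \in K -> chi t = (m t * beta X t s)%:A.
Proof.
move=> mm mM mf.
pose th s t := (m t * beta X t s) *: chi t.
have thM s : s \in K -> {in K &, {morph th s : u v / u + v >-> u * v}}.
  move=> sK u v uK vK; rewrite /th mM // chiM // !(betaC X _ s) betaDr //.
  by rewrite -scalerAl -scalerAr scalerA; congr (_ *: _); ring.
have [s sK s0] : exists2 s, s \in K & \sum_(t <- K_seq) th s t != 0.
  apply: contrapT => H.
  have all0 s : s \in K -> \sum_(t <- K_seq) th s t = 0.
    by move=> sK; apply/eqP; apply: contrapT => /negP s0; apply: H; exists s.
  have : \sum_(s <- K_seq) \sum_(t <- K_seq) th s t = 0.
    by rewrite big_seq big1 // => s; rewrite mem_K_seq => /all0.
  rewrite exchange_big /=.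
  pose n : R := (size K_seq)%:R.
  have m0 : m 0 = 1.
    have := mM 0 0 (inK0 D) (inK0 D); rewrite addr0 mm ?(inK0 D) //.
  have chi0 : chi 0 = 1.
    have [cD c0 _] := chiP (inK0 D); have := chiM (inK0 D) (inK0 D); rewrite addr0.
    by move/(congr1 (fun u => u / chi 0)); rewrite mulrK ?divrr // (homog_unit cD).
  have sum1 t : (forall s, s \in K -> beta X t s = 1) -> \sum_(s <- K_seq) beta X t s = n.
    move=> b1; rewrite big_seq (eq_bigr (fun _ => 1)).
      by rewrite -big_seq big_const_seq count_predT iter_addr_0.
    by move=> u; rewrite mem_K_seq => /b1.
  have inner t : t \in K -> \sum_(s <- K_seq) th s t =
      (if t == 0 then n%:A else 0) + (if t == f then n%:A else 0).
    move=> tK; rewrite -scaler_suml -mulr_sumr.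
    have [te|t0] := eqVneq t 0.
      rewrite te sum1; last exact: beta0.
      by rewrite m0 chi0 mul1r eq_sym (negPf (set_f0 S)) addr0.
    have [te|tf] := eqVneq t f; last by rewrite sum_beta // mulr0 scale0r addr0.
    rewrite te sum1; last exact: betaf.
    by rewrite mf scalerA mulrAC mm ?(inKf S) // mul1r add0r.
  rewrite (eq_big_seq (fun t => (if t == 0 then n%:A else 0) + (if t == f then n%:A else 0)));
    last by move=> t; rewrite mem_K_seq => /inner.
  have uS : uniq K_seq by rewrite filter_uniq ?supp_seq_uniq.
  have pick u : u \in K_seq -> \sum_(t <- K_seq) (if t == u then n%:A else 0) = n%:A :> D.
    by move=> uK; rewrite (bigD1_seq u) //= eqxx big1_seq ?addr0 // => t /andP[/negPf ->].
  rewrite big_split /=.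
  rewrite !pick ?mem_K_seq ?(inK0 D) ?(inKf S) // -scalerDl => /eqP.
  rewrite scaler_eq0 oner_eq0 orbF -mulr2n mulrn_eq0 /= pnatr_eq0 => /eqP /size0nil e.
  by have := inK0 D; rewrite -mem_K_seq e.
exists s => // t tK.
have sD : \sum_(t <- K_seq) th s t \in De.
  rewrite big_seq; apply: memv_suml => u; rewrite mem_K_seq => uK.
  by have [cD _ _] := chiP uK; rewrite memvZ.
have := character_sum tK (thM s sK) => /eqP; rewrite -subr_eq0.
rewrite -{2}[\sum_(_ <- _) _]mul1r -mulrBl => /eqP ths.
have [cD _ _] := chiP tK.
have [|/eqP|s1] := De_domain _ ths; first by rewrite memvB ?homog1 // memvZ.
  rewrite subr_eq0 => /eqP t1; rewrite -t1 /th scalerA -[LHS]scale1r; congr (_ *: _).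
  by rewrite mulrACA mm // beta_sqr mulr1.
by rewrite s1 eqxx in s0.
Qed.

End ScalarEndomorphism.

(** Outside K the factor b in psi(X_t) = b X_t is unknown, but it drops out: phi0(b X_t) = phi0(X_t)
    phi0(b) = eta(t) b X_t, since X_t conjugates D_e. *)
Lemma endo_phi psi (m : G -> R) : graded_endo psi ->
  (isoC De -> forall a, a \in De -> psi a = a) ->
  (forall t, t \in K -> psi (X t) = m t *: X t) ->
  forall d, psi (phi0 d) = phi0 (psi d).
Proof.
move=> E psiC psiX; elim/homog_ind => [|a b ha hb|t d tT dt].
- by rewrite linear0 (endo0 E) linear0.
- by rewrite linearD !(endoD E) ha hb linearD.
have [a aD ->] := homog_X S tT dt.
have paD := endo_homog E aD.
rewrite (phiM (set_inv S)) !(endoM E) (phiM (set_inv S)) -(endo_phi_De E aD).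
congr (_ * _); have [tK|tK] := boolP (t \in K).
  by rewrite psiX // linearZ /= !(etaE S) // (endoZ E) psiX // scalerA mulrC -scalerA.
have hC := notK_C tT tK.
have [b bD be] := homog_X S tT (endo_homog E (X_homog S tT)).
rewrite be (phiM (set_inv S)) !(etaE S) // (endoZ E) be -scalerAl.
rewrite (X_conj S tT tK) ?(phiK (set_inv S)) //.
exact: phi_homog (set_inv S) _ _ bD.
Qed.

Lemma normalize psi (nu : G -> int) : graded_endo psi -> sign_character D nu ->
  nu f = -1 -> exists g c (m : G -> R),
  [/\ c \in homog D g, c != 0,
      (forall t, t \in K -> m t = 1) \/ (forall t, t \in K -> m t = (nu t)%:~R),
      forall t, t \in K -> c^-1 * psi (X t) * c = m t *: X t &
      forall d, c^-1 * psi (phi0 d) * c = phi0 (c^-1 * psi d * c)].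
Proof.
move=> E [nu1 nuM] nuf; have [g [c [cg c0 psiC]]] := normalize_De E.
have E1 := endo_conj E cg c0.
set psi1 := (fun d => _) in E1.
have fin (m : G -> R) : (forall t, t \in K -> m t = 1) \/
      (forall t, t \in K -> m t = (nu t)%:~R) ->
    (forall t, t \in K -> m t * m t = 1) -> {in K &, {morph m : s t / s + t >-> s * t}} ->
    chi psi1 f = (m f)%:A ->
    exists g c (m : G -> R), [/\ c \in homog D g, c != 0,
      (forall t, t \in K -> m t = 1) \/ (forall t, t \in K -> m t = (nu t)%:~R),
      forall t, t \in K -> c^-1 * psi (X t) * c = m t *: X t &
      forall d, c^-1 * psi (phi0 d) * c = phi0 (c^-1 * psi d * c)].
  move=> m12 mm mM mf; have [s sK sE] := chi_inner E1 psiC mm mM mf.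
  have sT := inK_T sK; have sU := X_unit S sT; have cU := homog_unit cg c0.
  have E2 := endo_conj E1 (X_homog S sT) (X_neq0 S sT).
  have e2 d : (c * X s)^-1 * psi d * (c * X s) = (X s)^-1 * psi1 d * X s.
    by rewrite invrM // /psi1 !mulrA.
  have X2 t : t \in K -> (X s)^-1 * psi1 (X t) * X s = m t *: X t.
    move=> tK; rewrite (chiE psi1 tK) sE // -scalerAl mul1r -scalerAr -scalerAl.
    rewrite -mulrA (betaE S tK sT) -scalerAr mulKr // scalerA.
    by rewrite -mulrA beta_sqr mulr1.
  exists (g + s), (c * X s), m; split=> //.
  - exact: homogM cg (X_homog S sT).
  - exact: homog_neq0M cg c0 (X_neq0 S sT).
  - by move=> t tK; rewrite e2 X2.
  move=> d; rewrite !e2; apply: (endo_phi E2 _ X2) => hC a aD.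
  by rewrite [psi1 a]psiC // -mulrA -(X_commute S sK aD) mulKr.
have [cf|cf] := chi_f E1 psiC.
  apply: (fin (fun _ => 1)) => [|t _|s t _ _|]; rewrite ?mulr1 ?scale1r //.
  by left.
apply: (fin (fun t => (nu t)%:~R)) => [|t tK|s t sK tK|].
- by right.
- by case: (nu1 t tK) => ->; rewrite ?mulr1 // mulrNN mulr1.
- by rewrite nuM // intrM.
by rewrite nuf scaleN1r.
Qed.

End Normalization.

(** * The form of a graded isomorphism *)

Section GradedMorita.
Variables (R : realType) (G : zmodType) (D : gradedDivAlg R G).
Variables (n n' : nat) (r : 'I_n -> G) (r' : 'I_n' -> G).
Variable F : {rmorphism 'M[D]_n -> 'M[D]_n'}.
Hypotheses (Fbij : bijective F)
  (Flin : forall (c : R) A, F (c%:A *: A) = c%:A *: F A)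
  (Fgr : forall g (A : 'M[D]_n),
    (forall i j, A i j \in homog D (- r i + g + r j)) ->
    forall i j, F A i j \in homog D (- r' i + g + r' j)).
Variable i0 : 'I_n.

Local Notation E i j := (delta_mx i j : 'M[D]_n).

Lemma FM A B : F (A *m B) = F A *m F B. Proof. exact: (rmorphM F). Qed.
Lemma F1 : F 1%:M = 1%:M. Proof. exact: (rmorph1 F). Qed.

Lemma scaled_delta_mul (a b : D) i j k l :
  (a *: E i j) *m (b *: E k l) = (if j == k then a * b else 0) *: E i l.
Proof.
apply/matrixP => u v; rewrite !mxE (bigD1 j) //= big1 => [|w wj]; last first.
  by rewrite !mxE (negPf wj) andbF mulr0 mul0r.
rewrite !mxE eqxx andbT addr0; case: (j == k) => /=; last by rewrite !mulr0 mul0r.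
by case: (u == i) => /=; rewrite ?mulr1 ?mulrA // !(mulr0, mul0r).
Qed.

Lemma delta_homog (d : D) g i j : d \in homog D g ->
  forall u v, (d *: E i j) u v \in homog D (- r u + (r i + g - r j) + r v).
Proof.
move=> dg u v; rewrite !mxE.
case: (u =P i) => [->|_]; last by rewrite mulr0 mem0v.
case: (v =P j) => [->|_]; last by rewrite mulr0 mem0v.
by rewrite mulr1 addrA addrNK addKr.
Qed.

(** The image of the idempotent eps = F(E_00) is a free right D-module on one column v with
    homogeneous entries. On it F(d E_00) acts as multiplication by psi(d), the columns of P are
    F(E_i0) v, and g is the difference between the degrees attached to the column k of eps and to
    i0. *)
Lemma morita : exists psi g (P : 'M[D]_(n', n)) (Q : 'M[D]_(n, n')),
  [/\ graded_endo psi, P *m Q = 1%:M, Q *m P = 1%:M,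
      forall A, F A = P *m map_mx psi A *m Q &
      (forall i j, P i j \in homog D (- r' i + g + r j)) /\
      (forall i j, Q i j \in homog D (- r i - g + r' j))].
Proof.
have [Fi FiK FKi] := Fbij; have Finj := can_inj FiK.
pose eps := F (1 *: E i0 i0).
have epsM : eps *m eps = eps by rewrite -FM scaled_delta_mul eqxx mulr1.
have eps_homog i j : eps i j \in homog D (- r' i + r' j).
  have /Fgr/(_ i j) := delta_homog i0 i0 (homog1 D).
  by rewrite addr0 subrr addr0.
have [j [k jk0]] : exists j k, eps j k != 0.
  apply: contrapT => H; have : eps = F 0.
    rewrite rmorph0; apply/matrixP => j k; rewrite mxE; apply/eqP.
    by apply: contrapT => /negP jk; apply: H; exists j, k.
  move/Finj/matrixP/(_ i0 i0); rewrite !mxE !eqxx mulr1 => /eqP.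
  by rewrite oner_eq0.
pose v : 'cV[D]_n' := col k eps.
have vE i : v i 0 = eps i k by rewrite mxE.
have epsv : eps *m v = v by rewrite /v colE mulmxA epsM.
have vh i : v i 0 \in homog D (- r' i + r' k) by rewrite vE.
have vj0 : v j 0 != 0 by rewrite vE.
have vjU := homog_unit (vh j) vj0.
pose lam (w : 'cV[D]_n') : D := (v j 0)^-1 * w j 0.
have lamv : lam v = 1 by rewrite /lam mulVr.
have homv (A : 'M[D]_n') g : (forall i l, A i l \in homog D (- r' i + g + r' l)) ->
    forall i, (A *m v) i 0 \in homog D (- r' i + g + r' k).
  move=> Ah i; rewrite mxE; apply: memv_suml => l _.
  by apply: (homog_eq (homogM (Ah i l) (vh l))); rewrite addrA addrK.
(* A removes the v-part of a column, so w = v * [lam w] means that eps A eps kills w. By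
   surjectivity of F, eps A eps is the image of some b E_00 that kills v; a nonzero homogeneous
   component of b would be invertible and could not kill v. *)
have line w : eps *m w = w -> forall i, w i 0 = v i 0 * lam w.
  pose A := \matrix_(i, l) ((i == l)%:R - v i 0 * (v j 0)^-1 *+ (l == j)) : 'M[D]_n'.
  have AE u i : (A *m u) i 0 = u i 0 - v i 0 * lam u.
    rewrite mxE; under eq_bigr => l _ do rewrite mxE mulrBl !mulrnAl !mulrb mul1r.
    rewrite sumrB -!big_mkcond /= (big_pred1 i) => [|l]; last by rewrite eq_sym.
    by rewrite (big_pred1 j) // mulrA.
  pose B := Fi (eps *m A *m eps); pose b := B i0 i0.
  have FB : F B = eps *m A *m eps by exact: FKi.
  have Bb : B = b *: E i0 i0.
    have -> : B = (1 *: E i0 i0) *m B *m (1 *: E i0 i0).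
      by apply: Finj; rewrite !FM -/eps FB !mulmxA epsM -!mulmxA epsM.
    apply/matrixP => u w'; rewrite !mxE (bigD1 i0) //= big1 ?addr0 => [|l li]; last first.
      by rewrite !mxE (negPf li) /= mulr0 mulr0.
    rewrite !mxE (bigD1 i0) //= big1 ?addr0 => [|l li]; last first.
      by rewrite !mxE (negPf li) andbF mulr0 mul0r.
    rewrite !mxE !eqxx /= !mul1r andbT.
    by case: (u == i0); case: (w' == i0); rewrite /= ?mul1r ?mul0r ?mulr1 ?mulr0.
  have FBv : F B *m v = 0.
    rewrite FB -!mulmxA epsv; apply/matrixP => u u'; rewrite ord1 !mxE big1 // => l _.
    by rewrite AE lamv mulr1 subrr mulr0.
  (* The contributions of the components of b to one entry lie in different degrees, so each of them
     vanishes separately. *)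
  have b0 : b = 0.
    rewrite -[b]hproj_sum big1 // => g _; set bg := hproj g b.
    have bgh : bg \in homog D g by exact: hproj_homog.
    have z : F (bg *: E i0 i0) *m v = 0.
      apply/matrixP => u u'; rewrite ord1 [RHS]mxE.
      have sum0 : \sum_(h <- supp_seq D) (F (hproj h b *: E i0 i0) *m v) u 0 = 0.
        rewrite -summxE -mulmx_suml -rmorph_sum /= -scaler_suml hproj_sum -Bb FBv.
        by rewrite mxE.
      have [gs|gs] := boolP (g \in supp_seq D); last first.
        have -> : bg = 0.
          apply/eqP; apply: contraNT gs => b0; rewrite mem_supp_seq.
          by apply/suppP; exists bg.
        by rewrite scale0r rmorph0 mul0mx mxE.
      have hh h : (F (hproj h b *: E i0 i0) *m v) u 0 \in homog D (- r' u + h + r' k).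
        apply: homv => i l; have /Fgr/(_ i l) := delta_homog i0 i0 (hproj_homog h b).
        by rewrite [r i0 + h]addrC addrK.
      have := congr1 (hproj (- r' u + g + r' k)) sum0.
      rewrite linear_sum linear0 (bigD1_seq g) ?supp_seq_uniq //= hproj_id // big1 ?addr0 //.
      move=> h hg; apply: hproj_other (hh h) _.
      by rewrite (inj_eq (addIr _)) (inj_eq (addrI _)) eq_sym.
    apply/eqP/negPn/negP => bg0.
    have : F (bg^-1 *: E i0 i0) *m (F (bg *: E i0 i0) *m v) = v.
      rewrite mulmxA -FM scaled_delta_mul eqxx mulVr ?(homog_unit bgh) // -/eps.
    by rewrite z mulmx0 => /matrixP/(_ j 0); rewrite [LHS]mxE => /esym/eqP; rewrite (negPf vj0).
  move=> ew i; have : eps *m A *m eps *m w = 0 by rewrite -FB Bb b0 scale0r rmorph0 mul0mx.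
  rewrite -!mulmxA ew; have -> : A *m w = w - v *m (lam w)%:M.
    by apply/matrixP => u u'; rewrite ord1 AE !mxE big_ord1 !mxE eqxx.
  rewrite mulmxBr mulmxA ew epsv => /matrixP/(_ i 0); rewrite !mxE big_ord1 !mxE eqxx.
  by move/eqP; rewrite subr_eq0 => /eqP.
pose psi d := lam (F (d *: E i0 i0) *m v).
have psiE d i : (F (d *: E i0 i0) *m v) i 0 = v i 0 * psi d.
  by apply: line; rewrite mulmxA -FM scaled_delta_mul eqxx mul1r.
have FMv A B : F (A *m B) *m v = F A *m (F B *m v) by rewrite FM mulmxA.
have mulv (M : 'M[D]_n') d i : (M *m (F (d *: E i0 i0) *m v)) i 0 = (M *m v) i 0 * psi d.
  by rewrite !mxE mulr_suml; apply: eq_bigr => l _; rewrite psiE mulrA.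
have lamE (w : 'cV[D]_n') d : (forall i, w i 0 = v i 0 * d) -> lam w = d.
  by move=> we; rewrite /lam we mulKr.
have psiD k' a b : psi (k' *: a + b) = k' *: psi a + psi b.
  rewrite {1}/psi; have -> : (k' *: a + b) *: E i0 i0 = k'%:A *: (a *: E i0 i0) + b *: E i0 i0.
    by rewrite scalerDl scalerA mulr_algl.
  apply: lamE => i; rewrite rmorphD /= Flin mulmxDl mxE psiE -scalemxAl mxE psiE.
  by rewrite mulrDr -scalerAr mulr_algl.
have epsF d : F (d *: E i0 i0) *m eps = F (d *: E i0 i0).
  by rewrite -FM scaled_delta_mul eqxx mulr1.
have psi_endo : graded_endo psi.
  split; first exact: psiD.
  - move=> a b; apply: lamE => i.
    have -> : (a * b) *: E i0 i0 = (a *: E i0 i0) *m (b *: E i0 i0).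
      by rewrite scaled_delta_mul eqxx.
    by rewrite FMv mulv psiE mulrA.
  - by rewrite /psi epsv.
  - move=> g d dg; have := homogM (homogV (vh j) vj0) (homv _ g _ j).
    move=> /(_ (F (d *: E i0 i0))) h; apply: homog_eq (h _) _.
      by move=> i l; have /Fgr/(_ i l) := delta_homog i0 i0 dg; rewrite [r i0 + g]addrC addrK.
    abelian.
  move=> d pd0; have : d *: E i0 i0 = 0.
    apply: Finj; rewrite rmorph0 -epsF; apply/matrixP => i l; rewrite [RHS]mxE.
    have -> : (F (d *: E i0 i0) *m eps) i l = (F (d *: E i0 i0) *m col l eps) i 0.
      by rewrite !mxE; apply: eq_bigr => l' _; rewrite mxE.
    have le : eps *m col l eps = col l eps by rewrite colE mulmxA epsM.
    rewrite mxE (eq_bigr (fun l' => F (d *: E i0 i0) i l' * v l' 0 * lam (col l eps))).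
      have := psiE d i; rewrite mxE pd0 mulr0 -mulr_suml => ->.
      by rewrite mul0r.
    by move=> l' _; rewrite (line _ le) mulrA.
  by move/matrixP/(_ i0 i0); rewrite !mxE !eqxx mulr1.
pose P : 'M[D]_(n', n) := \matrix_(l, i) (F (1 *: E i i0) *m v) l 0.
pose Q : 'M[D]_(n, n') := \matrix_(i, l) ((v j 0)^-1 * F (1 *: E i0 i) j l).
have QE (w : 'cV[D]_n') i : (Q *m w) i 0 = lam (F (1 *: E i0 i) *m w).
  by rewrite /lam !mxE mulr_sumr; apply: eq_bigr => l _; rewrite !mxE mulrA.
have PE i l : P l i = (F (1 *: E i i0) *m v) l 0 by rewrite mxE.
have colP i : col i P = F (1 *: E i i0) *m v.
  by apply/matrixP => l u; rewrite ord1 mxE PE.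
have QP : Q *m P = 1%:M.
  apply/matrixP => i i'; have -> : (Q *m P) i i' = (Q *m col i' P) i 0.
    by rewrite !mxE; apply: eq_bigr => l _; rewrite !mxE.
  rewrite QE colP -FMv scaled_delta_mul mulr1 mxE; case: (i == i').
    by rewrite epsv lamv.
  by rewrite scale0r rmorph0 mul0mx /lam [X in _ * X]mxE mulr0.
have PQ : P *m Q = 1%:M.
  apply/matrixP => l l'; have -> : (P *m Q) l l' = (P *m (Q *m delta_mx l' 0)) l (0 : 'I_1).
    by rewrite mulmxA -colE [RHS]mxE.
  rewrite mxE (eq_bigr (fun i => (F (1 *: E i i) *m delta_mx l' (0 : 'I_1)) l 0)).
    rewrite -summxE -mulmx_suml -rmorph_sum /=.
    have -> : \sum_i 1 *: E i i = 1%:M.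
      apply/matrixP => a b; rewrite summxE (bigD1 a) //= big1 => [|c ca].
        by rewrite !mxE eqxx addr0 mul1r eq_sym.
      by rewrite !mxE eq_sym (negPf ca) mulr0.
    by rewrite F1 mul1mx !mxE andbT.
  move=> i _; rewrite QE PE.
  set w := F (1 *: E i0 i) *m _.
  have ew : eps *m w = w by rewrite mulmxA -FM scaled_delta_mul eqxx mulr1.
  have -> : F (1 *: E i i) = F (1 *: E i i0) *m F (1 *: E i0 i).
    by rewrite -FM scaled_delta_mul eqxx mulr1.
  rewrite -mulmxA -/w !mxE mulr_suml; apply: eq_bigr => a _.
  by rewrite (line _ ew) mulrA.
have FP A : F A *m P = P *m map_mx psi A.
  apply/matrixP => l i; have -> : (F A *m P) l i = (F A *m col i P) l 0.
    by rewrite !mxE; apply: eq_bigr => a _; rewrite !mxE.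
  rewrite colP -FMv.
  have -> : A *m (1 *: E i i0) = \sum_k (1 *: E k i0) *m (A k i *: E i0 i0).
    apply/matrixP => a b; rewrite mxE summxE (bigD1 i) //= big1 => [|c ci]; last first.
      by rewrite !mxE (negPf ci) /= !mulr0.
    rewrite (bigD1 a) //= big1 => [|c ca].
      rewrite scaled_delta_mul eqxx !mxE !eqxx /= !mul1r !addr0.
      by case: (b == i0); rewrite ?mulr1 ?mulr0.
    by rewrite scaled_delta_mul !mxE eq_sym (negPf ca) mulr0.
  rewrite rmorph_sum mulmx_suml summxE mxE; apply: eq_bigr => a _.
  by rewrite FMv mulv -PE [map_mx _ _ _ _]mxE.
exists psi, (r' k - r i0), P, Q; split=> //.
  by move=> A; rewrite -FP -mulmxA PQ mulmx1.
split=> [l i|i l].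
  rewrite PE; apply: homog_eq (homv _ (r i - r i0) _ l) _.
    by move=> a b; have /Fgr/(_ a b) := delta_homog i i0 (homog1 D); rewrite addr0.
  abelian.
rewrite mxE; have /Fgr/(_ j l) h := delta_homog i0 i (homog1 D).
apply: homog_eq (homogM (homogV (vh j) vj0) h) _; abelian.
Qed.

End GradedMorita.

(** * The form Phi as a monomial matrix *)

(** Giving block entries by a function on natural numbers removes the cast between block sizes that
    are only provably equal. *)
Lemma conform_diag_entry (V : nzRingType) m (p : 'I_m -> nat) (B : forall i, 'M[V]_(p i))
  (h : 'I_m -> nat -> nat -> V) : (forall i (u v : 'I_(p i)), B i u v = h i u v) ->
  forall i j (u : 'I_(p i)) (v : 'I_(p j)),
  (if i == j then conform_mx 0 (B i) else 0 : 'M_(p i, p j)) u v =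
    if i == j then h i u v else 0.
Proof.
move=> Bh i j u v; case: eqP => [e|_]; last by rewrite mxE.
by case: _ / e v => v; rewrite conform_mx_id Bh.
Qed.

Section BlockDiagonal.
Variables (V : nzRingType) (C : eqType) (x0 : C).
Variables (partner : C -> C) (coef : C -> V).
Local Notation block := {n : nat & 'M[V]_n}.

(** The list cs names the rows of b; its closure under [partner] keeps the nonzero entry of each row
    inside the block. *)
Definition monomial_block (b : block) (cs : seq C) : Prop :=
  [/\ size cs = tag b,
      forall i j : 'I_(tag b), tagged b i j =
        if nth x0 cs j == partner (nth x0 cs i) then coef (nth x0 cs i) else 0 &
      forall x, x \in cs -> partner x \in cs].

Lemma uniq_flatten_nth (css : seq (seq C)) x a b : uniq (flatten css) ->
  (a < size css)%N -> (b < size css)%N ->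
  x \in nth [::] css a -> x \in nth [::] css b -> a = b.
Proof.
elim: css a b => // cs css IH [|a] [|b] //=; rewrite cat_uniq => /and3P[_ dj u].
- move=> _ lb xa xb; case/hasP: dj; exists x => //.
  by apply/flattenP; exists (nth [::] css b); rewrite ?mem_nth.
- move=> la _ xa xb; case/hasP: dj; exists x => //.
  by apply/flattenP; exists (nth [::] css a); rewrite ?mem_nth.
by move=> la lb xa xb; rewrite (IH a b).
Qed.

Variables (bs : seq block) (css : seq (seq C)).
Hypotheses (size_css : size css = size bs) (uniq_css : uniq (flatten css))
  (blocks_ok : forall i, (i < size bs)%N ->
     monomial_block (nth (Tagged (fun n => 'M[V]_n) (0 : 'M_0)) bs i) (nth [::] css i)).

Local Notation p := (fun i => tag (tnth (in_tuple bs) i)).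
Local Notation dim := (\sum_(i < size bs) p i)%N.

Lemma block_ok (i : 'I_(size bs)) :
  monomial_block (tnth (in_tuple bs) i) (nth [::] css i).
Proof.
have := blocks_ok (ltn_ord i).
by rewrite (tnth_nth (Tagged (fun n => 'M[V]_n) (0 : 'M_0))).
Qed.

Lemma shape_css : shape css = [seq tag b | b <- bs].
Proof.
apply: (@eq_from_nth _ 0%N) => [|i]; rewrite ?size_map ?size_css // => ib.
rewrite (nth_map [::]) ?size_css // (nth_map (Tagged (fun n => 'M[V]_n) (0 : 'M_0))) //.
by have [-> _ _] := blocks_ok ib.
Qed.

Lemma size_flatten_css : size (flatten css) = dim.
Proof. by rewrite size_flatten shape_css sumnE big_map big_tnth. Qed.

Lemma nth_flatten_css (k : 'I_dim) :
  nth x0 (flatten css) k = nth x0 (nth [::] css (tagnat.sig1 k)) (tagnat.sig2 k).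
Proof.
set s := tagnat.sig1 k; have [sz _ _] := block_ok s.
have lt2 : (tagnat.sig2 k < nth 0%N (shape css) s)%N.
  by rewrite (nth_map [::]) ?size_css // sz.
have -> : (k : nat) = flatten_index (shape css) s (tagnat.sig2 k).
  rewrite [LHS]tagnat.rect -/s /flatten_index; congr (_ + _)%N.
  rewrite shape_css sumnE (big_nth 0%N) size_takel ?size_map ?(ltnW (ltn_ord s)) //.
  rewrite big_mkord (big_ord_widen _ (fun i => nth 0%N (take s [seq tag b | b <- bs]) i)
    (ltnW (ltn_ord s))).
  apply: eq_bigr => i is_; rewrite nth_take //.
  rewrite (nth_map (Tagged (fun n => 'M[V]_n) (0 : 'M_0))) //.
  by rewrite (tnth_nth (Tagged (fun n => 'M[V]_n) (0 : 'M_0))).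
by rewrite nth_flatten flatten_indexKl // flatten_indexKr.
Qed.

(** Off the diagonal blocks the test on labels fails: the partner of a row label stays in its own
    block, and no label occurs twice. *)
Lemma block_diagonal_entry (k l : 'I_dim) :
  (\mxdiag_(b < size bs) tagged (tnth (in_tuple bs) b)) k l =
    if nth x0 (flatten css) l == partner (nth x0 (flatten css) k)
    then coef (nth x0 (flatten css) k) else 0.
Proof.
rewrite !nth_flatten_css /mxdiag /mxblock mxE.
pose h (i : 'I_(size bs)) (u v : nat) := let cs := nth [::] css i in
  if nth x0 cs v == partner (nth x0 cs u) then coef (nth x0 cs u) else 0.
apply: etrans (@conform_diag_entry V _ p (fun i => tagged (tnth (in_tuple bs) i)) h _
  (tagnat.sig1 k) (tagnat.sig1 l) (tagnat.sig2 k) (tagnat.sig2 l)) _ => [i u v|].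
  by have [_ -> _] := block_ok i.
rewrite /h; set a := tagnat.sig1 k; set b := tagnat.sig1 l.
have [szk _ pk] := block_ok a; have [szl _ _] := block_ok b.
case: eqP => [ab|ab]; first by rewrite -(congr1 val ab : (a : nat) = b).
case: eqP => // e; case: ab; apply: val_inj => /=.
apply: (@uniq_flatten_nth css (partner (nth x0 (nth [::] css a) (tagnat.sig2 k)))) => //.
- by rewrite size_css.
- by rewrite size_css.
- by apply: pk; rewrite mem_nth // szk.
by rewrite -e mem_nth // szl.
Qed.

End BlockDiagonal.

Section BlockEntries.
Variable V : nzRingType.

Lemma sign_block_entry p q (u v : 'I_(p + q)) :
  block_mx (1%:M : 'M[V]_p) 0 0 (- 1%:M : 'M_q) u v =
    if v == u then (if (u < p)%N then 1 else -1) else 0.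
Proof.
rewrite !mxE -!val_eqE /=; case: splitP => a ->; rewrite !mxE; case: splitP => b ->.
- by rewrite !mxE -val_eqE /= eq_sym; case: eqP.
- by rewrite !mxE gtn_eqF // ltn_addr.
- by rewrite !mxE ltn_eqF // ltn_addr.
rewrite !mxE eqn_add2l -val_eqE /= eq_sym.
by case: eqP => _; rewrite ?oppr0.
Qed.

Lemma swap_block_entry h e (u v : 'I_(h + h)) :
  block_mx (0 : 'M[V]_h) 1%:M e%:M 0 u v =
    if v == (if u < h then u + h else u - h)%N :> nat
    then (if (u < h)%N then 1 else e) else 0.
Proof.
rewrite !mxE; case: splitP => a ->; rewrite !mxE; case: splitP => b ->.
- by rewrite !mxE ltn_eqF // ltn_addl.
- by rewrite !mxE addnC eqn_add2r -val_eqE /= eq_sym; case: eqP.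
- rewrite !mxE addKn -val_eqE /= eq_sym.
  by case: eqP.
by rewrite !mxE addKn gtn_eqF // ltn_addr.
Qed.

End BlockEntries.

Lemma uniq_pairs (C : eqType) (ps : seq (C * C)) :
  uniq (flatten [seq [:: p.1; p.2] | p <- ps]) ->
  forall p q, p \in ps -> q \in ps -> p.2 != q.1.
Proof.
elim: ps => [//|r ps IH] /=; rewrite inE negb_or => /and3P[/andP[r12 n1] n2 u] p q.
have mem2 s : s \in ps -> s.1 \in flatten [seq [:: p.1; p.2] | p <- ps] /\
    s.2 \in flatten [seq [:: p.1; p.2] | p <- ps].
  move=> sps; split; apply/flatten_mapP; exists s; rewrite // !inE eqxx ?orbT //.
rewrite !inE => /orP[/eqP ->|pps] /orP[/eqP ->|qps]; last exact: IH.
- by rewrite eq_sym.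
- by apply: contraNneq n2 => ->; case: (mem2 _ qps).
by apply: contraNneq n1 => <-; case: (mem2 _ pps).
Qed.

(** * Rows of a model named by class and position *)

Section ModelDescription.
Variables (R : realType) (G : zmodType) (D : gradedDivAlg R G).
Variables (phi0 : {linear D -> D}) (X : G -> D) (f : G).
Variables (xi : GmodT D -> G) (qi : D).
Local Notation De := (homog D 0).
Local Notation T := (supp D).
Local Notation K := (inK D).
Local Notation eta := (etaX phi0 X).
Local Notation tau := (tau xi).

Definition sig_class (g0 : G) (x : GmodT D) : bool :=
  ((isoR De || isoH De) && (eta (tau g0 x) == 1)) || (isoC De && (tau g0 x \in K)).

(** The classes whose block pairs two halves of the rows. The self-dual classes in neither group
    have a constant block: X_t over C, X_t times [qi] over H. *)
Definition sym_class (g0 : G) (x : GmodT D) : bool :=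
  [&& ~~ sig_class g0 x, isoR De || isoC De & eta (tau g0 x) == -1].

Definition dual_class (g0 : G) (x : GmodT D) : GmodT D := - piT D g0 - x.

Definition pos_count (d : datum D) (x : GmodT D) : nat :=
  absz (((dat_kappa d x)%:Z + dat_sigma d x) %/ 2)%Z.

(** A row is named by its class and its position in the class, so that rows of two models can be
    matched independently of the chosen support orderings. *)
Definition label : Type := (GmodT D * nat)%type.

(** The label of the column that holds the only nonzero entry of row y of Phi. *)
Definition partner (d : datum D) (y : label) : label :=
  let: (x, a) := y in
  if inGT (dat_g0 d) x then
    let h := (dat_kappa d x)./2 in
    (x, if sym_class (dat_g0 d) x then (if a < h then a + h else a - h)%N else a)
  else (dual_class (dat_g0 d) x, a).

Definition coef (d : datum D) (ps : seq (GmodT D * GmodT D)) (y : label) : D :=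
  let: (x, a) := y in
  if inGT (dat_g0 d) x then
    let t := tau (dat_g0 d) x in
    if sig_class (dat_g0 d) x then X t * (if (a < pos_count d x)%N then 1 else -1)
    else if sym_class (dat_g0 d) x then
      X t * (if (a < (dat_kappa d x)./2)%N then 1 else -1)
    else if isoC De then X t else X t * qi
  else
    let t := dat_g0 d + xi x + xi (dual_class (dat_g0 d) x) in
    X t * (if x \in [seq p.1 | p <- ps] then 1 else (eta t)%:~R).

Lemma dual_classK g0 x : dual_class g0 (dual_class g0 x) = x.
Proof. by rewrite /dual_class; abelian. Qed.

Lemma dual_class_fixed g0 x : (dual_class g0 x == x) = inGT g0 x.
Proof.
rewrite /dual_class /inGT -subr_eq0 -oppr_eq0; congr (_ == 0).
by rewrite mulr2n; abelian.
Qed.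

Lemma inGT_dual g0 x : inGT g0 (dual_class g0 x) = inGT g0 x.
Proof. by rewrite -!dual_class_fixed dual_classK eq_sym. Qed.

Section Datum.
Variables (d : datum D) (ms : seq (GmodT D)) (ps : seq (GmodT D * GmodT D)).
Hypotheses (vd : valid_datum phi0 X xi d) (ord : support_ordering d ms ps).
Local Notation g0 := (dat_g0 d).
Local Notation kappa := (dat_kappa d).
Local Notation sigma := (dat_sigma d).

Lemma kappa_dual x : kappa (dual_class g0 x) = kappa x.
Proof. by case: vd => -[_ _ h _ _] _; apply: h. Qed.

Lemma sigma_bound x : (absz (sigma x) <= kappa x)%N.
Proof. by case: vd => _ []. Qed.

Lemma sigma_parity x : inGT g0 x -> sig_class g0 x ->
  (sigma x = kappa x %[mod 2])%Z.
Proof.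
move=> xG; case: vd => _ [_ h1 h2] /orP[/andP[hD e]|/andP[hC hK]].
  by have := h1 hD x; rewrite xG e.
by have := h2 hC x; rewrite xG hK.
Qed.

Lemma sigma_eq0 x : ~~ (inGT g0 x && sig_class g0 x) -> sigma x = 0.
Proof.
case: vd => _ [_ h1 h2] nx; case/or3P: (Frobenius D) => [hR|hC|hH].
- have := h1 (introT orP (or_introl hR)) x; case: ifP => // /andP[xG e].
  by case/negP: nx; rewrite xG /sig_class hR e.
- have := h2 hC x; case: ifP => // /andP[xG e].
  by case/negP: nx; rewrite xG /sig_class hC e orbT.
have := h1 (introT orP (or_intror hH)) x; case: ifP => // /andP[xG e].
by case/negP: nx; rewrite xG /sig_class hH orbT e.
Qed.

Lemma pos_neg_count x : inGT g0 x -> sig_class g0 x ->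
  (pos_count d x + absz (((kappa x)%:Z - sigma x) %/ 2)%Z)%N = kappa x.
Proof.
move=> xG xs; have := sigma_bound x; have := sigma_parity xG xs; rewrite /pos_count.
by move: (sigma x) (kappa x) => s k; lia.
Qed.

Lemma sigma_pos_count x : inGT g0 x -> sig_class g0 x ->
  sigma x = (pos_count d x)%:Z *+ 2 - (kappa x)%:Z.
Proof.
move=> xG xs; have := sigma_bound x; have := sigma_parity xG xs; rewrite /pos_count.
by move: (sigma x) (kappa x) => s k; lia.
Qed.

Lemma kappa_even x : inGT g0 x -> sym_class g0 x -> (kappa x)./2.*2 = kappa x.
Proof.
move=> xG /and3P[ns /orP[hR|hC] /eqP e]; apply/eqP; rewrite halfK; apply/eqP.
  by case: vd => -[_ _ _ /(_ hR _ xG e) /negPf -> _] _; rewrite subn0.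
case: vd => -[_ _ _ _ /(_ hC _ xG)] h _; rewrite (negPf (h _ e)) ?subn0 //.
by apply: contra ns => tK; rewrite /sig_class hC tK orbT.
Qed.

Definition label_seq (x : GmodT D) : seq label := [seq (x, a) | a <- iota 0 (kappa x)].

Lemma nth_label_seq x0 x i : (i < kappa x)%N -> nth x0 (label_seq x) i = (x, i).
Proof. by move=> ik; rewrite (nth_map 0%N) ?size_iota // nth_iota. Qed.

Lemma mem_label_seq x y a : ((y, a) \in label_seq x) = (y == x) && (a < kappa x)%N.
Proof.
apply/mapP/andP => [[b]|[/eqP -> ak]].
  by rewrite mem_iota /= => bk [-> ->].
by exists a; rewrite ?mem_iota.
Qed.

Lemma size_label_seq x : size (label_seq x) = kappa x.
Proof. by rewrite size_map size_iota. Qed.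

Lemma partner_bound x a : (a < kappa x)%N ->
  ((partner d (x, a)).2 < kappa (partner d (x, a)).1)%N.
Proof.
move=> ak; rewrite /partner; case: ifP => xG /=; last by rewrite kappa_dual.
by case: ifP => // xs; have := kappa_even xG xs; case: ifP; lia.
Qed.

Lemma partnerK x a : (a < kappa x)%N -> partner d (partner d (x, a)) = (x, a).
Proof.
move=> ak; rewrite {2}/partner; case: ifP => xG; rewrite /partner.
  rewrite xG; case xs: (sym_class g0 x) => //; congr (_, _); have := kappa_even xG xs.
  by case: (ltnP a (kappa x)./2) => h1; case: ifP; lia.
by rewrite inGT_dual xG dual_classK.
Qed.

Lemma block_single_monomial x0 x : inGT g0 x ->
  monomial_block x0 (partner d) (coef d ps) (block_single phi0 X xi qi d x) (label_seq x).
Proof.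
move=> xG; have clo y : y \in label_seq x -> partner d y \in label_seq x.
  case: y => y a; rewrite mem_label_seq => /andP[/eqP -> ak].
  have := partner_bound ak; rewrite /partner xG mem_label_seq eqxx /=.
  by [].
rewrite /block_single -/(sig_class g0 x); case: ifP => xs.
  split; rewrite ?size_label_seq /= ?pos_neg_count // => u v.
  rewrite !nth_label_seq; last 2 first.
  - by rewrite -[X in (_ < X)%N](pos_neg_count xG xs).
  - by rewrite -[X in (_ < X)%N](pos_neg_count xG xs).
  rewrite mxE sign_block_entry /partner /coef xG /sym_class xs /=.
  rewrite xpair_eqE eqxx /= -val_eqE /=.
  by case: eqP => _; rewrite ?mulr0.
case: ifP => ys.
  have xy : sym_class g0 x by rewrite /sym_class xs.
  have k2 : ((kappa x)./2 + (kappa x)./2 = kappa x)%N by rewrite addnn kappa_even.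
  split; rewrite ?size_label_seq /= ?k2 // => u v.
  have uk : (u < kappa x)%N by rewrite -[X in (_ < X)%N]k2.
  have vk : (v < kappa x)%N by rewrite -[X in (_ < X)%N]k2.
  have -> : - 1%:M = (-1)%:M :> 'M[D]_((kappa x)./2) by rewrite raddfN.
  rewrite !nth_label_seq // mxE swap_block_entry.
  rewrite /partner /coef xG xs xy xpair_eqE eqxx /=.
  by case: eqP => _; rewrite ?mulr0.
have xy : sym_class g0 x = false by rewrite /sym_class xs /= ys.
case: ifP => hC; split; rewrite ?size_label_seq //= => u v.
  rewrite !nth_label_seq // !mxE /partner /coef xG xs xy hC xpair_eqE eqxx /=.
  by rewrite val_eqE eq_sym; case: eqP => _; rewrite ?mulr0 ?mulr1.
rewrite !nth_label_seq // !mxE /partner /coef xG xs xy hC xpair_eqE eqxx /=.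
by rewrite val_eqE eq_sym; case: eqP => _; rewrite ?mulr0 ?mulr1.
Qed.

Lemma support_uniq : uniq (support_seq ms ps). Proof. by case: ord. Qed.

Lemma pair_dual p : p \in ps -> p.2 = dual_class g0 p.1.
Proof.
case: ord => _ _ _ /allP h /h /eqP e.
by rewrite /dual_class -e addrC addKr.
Qed.

Lemma pair_neq p q : p \in ps -> q \in ps -> p.2 != q.1.
Proof.
by have := support_uniq; rewrite cat_uniq => /and3P[_ _ /uniq_pairs]; apply.
Qed.

Lemma pair_notGT p : p \in ps -> inGT g0 p.1 = false.
Proof.
move=> pps; have := pair_neq pps pps.
by rewrite (pair_dual pps) dual_class_fixed => /negbTE.
Qed.

Lemma firsts_pair p : p \in ps -> p.1 \in [seq q.1 | q <- ps].
Proof. exact: map_f. Qed.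

Lemma seconds_pair p : p \in ps -> (p.2 \in [seq q.1 | q <- ps]) = false.
Proof.
move=> pps; apply/negP => /mapP[q qps e].
by have := pair_neq pps qps; rewrite e eqxx.
Qed.

Lemma block_pair_monomial x0 p : p \in ps ->
  monomial_block x0 (partner d) (coef d ps) (block_pair phi0 X xi d p)
    (label_seq p.1 ++ label_seq p.2).
Proof.
move=> pps; have nG := pair_notGT pps; have e2 := pair_dual pps.
have nG2 : inGT g0 p.2 = false by rewrite e2 inGT_dual.
have e1 : p.1 = dual_class g0 p.2 by rewrite e2 dual_classK.
have k12 : kappa p.1 = kappa p.2 by rewrite e2 kappa_dual.
have nthE i : (i < kappa p.2 + kappa p.2)%N -> nth x0 (label_seq p.1 ++ label_seq p.2) i =
    if (i < kappa p.2)%N then (p.1, i) else (p.2, (i - kappa p.2)%N).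
  move=> ik; rewrite nth_cat size_label_seq k12.
  by case: (ltnP i) => ik'; rewrite nth_label_seq ?k12 //; lia.
split; first by rewrite size_cat !size_label_seq k12.
  move=> u v; rewrite !nthE ?ltn_ord // mxE swap_block_entry.
  have t2 : g0 + xi p.2 + xi p.1 = g0 + xi p.1 + xi p.2 by rewrite addrAC.
  have n12 : (p.2 == p.1) = false by apply/negbTE/pair_neq.
  have vb := ltn_ord v; have ub := ltn_ord u.
  rewrite /partner /coef; case: (ltnP u) => uk; case: (ltnP v) => vk.
  - rewrite nG -e2 xpair_eqE [p.1 == _]eq_sym n12 /= ltn_eqF ?mulr0 //.
    exact: leq_trans vk (leq_addl _ _).
  - rewrite nG -e2 firsts_pair // xpair_eqE eqxx /=.
    have -> : (v - kappa p.2 == u)%N = (v == (u + kappa p.2)%N :> nat).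
      by rewrite -(eqn_add2r (kappa p.2)) subnK.
    by case: eqP => _; rewrite ?mulr0.
  - rewrite nG2 -e1 seconds_pair // xpair_eqE eqxx /= t2.
    by case: eqP => _; rewrite ?mulr0.
  rewrite nG2 -e1 xpair_eqE n12 /= gtn_eqF ?mulr0 //.
  by apply: leq_trans vk; rewrite ltn_subLR.
case=> y a; rewrite !mem_cat !mem_label_seq => /orP[] /andP[/eqP -> ak].
  by rewrite /partner nG -e2 !mem_label_seq eqxx -k12 ak orbT.
by rewrite /partner nG2 -e1 !mem_label_seq eqxx k12 ak.
Qed.

Definition labels := flatten [seq label_seq x | x <- support_seq ms ps].

Lemma mem_labels x a : ((x, a) \in labels) = (a < kappa x)%N.
Proof.
have [_ sE _ _] := ord; apply/flatten_mapP/idP => [[y _]|ak].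
  by rewrite mem_label_seq => /andP[/eqP ->].
exists x; last by rewrite mem_label_seq eqxx.
by rewrite sE -lt0n (leq_ltn_trans _ ak).
Qed.

Lemma labels_uniq : uniq labels.
Proof.
rewrite /labels; elim: (support_seq ms ps) support_uniq => //= x s IH /andP[xs us].
rewrite cat_uniq IH // map_inj_uniq ?iota_uniq /= ?andbT => [|a b []//].
apply/hasPn => -[y a] /flatten_mapP[z zs]; rewrite mem_label_seq => /andP[/eqP -> _].
by rewrite /= mem_label_seq; apply: contraNN xs => /andP[/eqP <-].
Qed.

(** What later arguments use of Phi and the row degrees: rows correspond bijectively to pairs (x, a)
    with a < kappa x, and Phi is monomial along [partner]. *)
Record form_desc n (r : 'I_n -> G) (Phi : 'M[D]_n) (cls : 'I_n -> GmodT D)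
    (pos : 'I_n -> nat) (pi : 'I_n -> 'I_n) : Prop := FormDesc {
  form_inj : forall k l, cls k = cls l -> pos k = pos l -> k = l;
  form_pos : forall k, (pos k < kappa (cls k))%N;
  form_surj : forall x a, (a < kappa x)%N -> exists k, cls k = x /\ pos k = a;
  form_deg : forall k, r k = xi (cls k);
  form_pi : forall k, (cls (pi k), pos (pi k)) = partner d (cls k, pos k);
  form_Phi : forall k l, Phi k l = if l == pi k then coef d ps (cls k, pos k) else 0
}.

Lemma model_description : exists cls pos pi,
  @form_desc (mx_dim (blocks phi0 X xi qi d ms ps))
    (fun k => (row_degrees xi d ms ps)`_k) (mx_Phi (blocks phi0 X xi qi d ms ps)) cls pos pi.
Proof.
set bs := blocks phi0 X xi qi d ms ps.
pose css := map label_seq ms ++ [seq label_seq p.1 ++ label_seq p.2 | p <- ps].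
pose x0 : label := (0, 0%N).
have flat : flatten css = labels.
  rewrite /labels /support_seq map_cat !flatten_cat; congr (_ ++ _).
  by elim: (ps) => //= p s ->; rewrite catA.
have [_ _ /allP msG _] := ord.
have szb : size bs = (size ms + size ps)%N by rewrite /bs /blocks size_cat !size_map.
have szc : size css = size bs by rewrite szb /css size_cat !size_map.
have ok i : (i < size bs)%N -> monomial_block x0 (partner d) (coef d ps)
    (nth (Tagged (fun n => 'M[D]_n) (0 : 'M_0)) bs i) (nth [::] css i).
  rewrite szb => ib; rewrite /bs /blocks /css !nth_cat !size_map.
  case: (ltnP i) => im.
    rewrite !(nth_map 0) //; apply: block_single_monomial.
    by apply: msG; rewrite mem_nth.
  have ip : (i - size ms < size ps)%N by lia.
  rewrite !(nth_map (0, 0)) //; apply: block_pair_monomial.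
  by rewrite mem_nth.
have uc : uniq (flatten css) by rewrite flat labels_uniq.
pose lab (k : 'I_(mx_dim bs)) := nth x0 labels k.
have szl : size labels = mx_dim bs.
  by rewrite -flat; apply: (size_flatten_css szc ok).
have labm k : lab k \in labels by rewrite mem_nth // szl.
have labK y : y \in labels -> exists k, lab k = y.
  move=> yl; have yi : (index y labels < mx_dim bs)%N by rewrite -szl index_mem.
  by exists (Ordinal yi); rewrite /lab nth_index.
have labI : injective lab.
  move=> k l /eqP; rewrite nth_uniq ?szl ?labels_uniq // => /eqP e.
  exact: val_inj.
have part y : y \in labels -> partner d y \in labels.
  case: y => x a; rewrite mem_labels => /partner_bound.
  by case: (partner d (x, a)) => x' a'; rewrite mem_labels.
have [pi piE] : exists pi : 'I_(mx_dim bs) -> 'I_(mx_dim bs),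
    forall k, lab (pi k) = partner d (lab k).
  exists (fun k => projT1 (cid (labK _ (part _ (labm k))))) => k.
  exact: projT2 (cid (labK _ (part _ (labm k)))).
exists (fun k => (lab k).1), (fun k => (lab k).2), pi; split.
- move=> k l e1 e2; apply: labI; rewrite [LHS]surjective_pairing e1 e2.
  by rewrite -surjective_pairing.
- by move=> k; have := labm k; case: (lab k) => x a; rewrite mem_labels.
- move=> x a ak; have [|k ke] := labK (x, a); first by rewrite mem_labels.
  by exists k; rewrite ke.
- move=> k; rewrite /lab -(nth_map x0 0 (fun y => xi y.1)) ?szl //; congr nth.
  rewrite /row_degrees /labels map_flatten -map_comp; congr flatten.
  by apply: eq_map => x /=; rewrite -map_comp -[in LHS](size_iota 0 (kappa x)); elim: (iota 0 _) => //= a s ->.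
- by move=> k; rewrite -!surjective_pairing piE.
move=> k l; rewrite -surjective_pairing -(inj_eq labI) piE /lab -flat.
exact: (block_diagonal_entry szc uc ok).
Qed.

End Datum.
End ModelDescription.

Section QuotientByT.
Variables (R : realType) (G : zmodType) (D : gradedDivAlg R G).

Lemma piTD g h : piT D (g + h) = piT D g + piT D h.
Proof. exact: raddfD. Qed.

Lemma piTN g : piT D (- g) = - piT D g.
Proof. exact: raddfN. Qed.

Lemma piT_eq0 g : (piT D g == 0) = (g \in supp D).
Proof.
have -> : 0 = piT D 0 by rewrite /piT; exact/esym/raddf0.
by rewrite /piT -Quotient.idealrBE subr0.
Qed.

End QuotientByT.

Section ConjugateTranspose.
Variables (R : realType) (G : zmodType) (D : gradedDivAlg R G).
Variable phi0 : {linear D -> D}.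
Hypothesis hphi0 : degree_preserving_involution phi0.

Definition star m n (A : 'M[D]_(m, n)) : 'M[D]_(n, m) := map_mx phi0 A^T.

Lemma starE m n (A : 'M[D]_(m, n)) i j : star A i j = phi0 (A j i).
Proof. by rewrite !mxE. Qed.

Lemma starM m n p (A : 'M[D]_(m, n)) (B : 'M[D]_(n, p)) :
  star (A *m B) = star B *m star A.
Proof.
apply/matrixP => i j; rewrite starE !mxE linear_sum; apply: eq_bigr => k _.
by rewrite !starE (phiM hphi0).
Qed.

Lemma starK m n (A : 'M[D]_(m, n)) : star (star A) = A.
Proof. by apply/matrixP => i j; rewrite !starE (phiK hphi0). Qed.

Lemma star1 n : star (1%:M : 'M[D]_n) = 1%:M.
Proof.
apply/matrixP => i j; rewrite starE !mxE eq_sym.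
by case: eqP => _; rewrite ?(phi1 hphi0) ?linear0.
Qed.

End ConjugateTranspose.

(** * Hermitian symmetry and inverse of the form *)

Section Coefficients.
Variables (R : realType) (G : zmodType) (D : gradedDivAlg R G).
Variables (phi0 : {linear D -> D}) (X : G -> D) (f : G).
Variables (xi : GmodT D -> G) (qi : D).
Hypotheses (S : setting phi0 X f) (hxi : cancel xi (@piT R G D)).
Hypothesis (hqi : isoH (homog D 0) -> qi \in homog D 0 /\ qi * qi = -1).
Local Notation De := (homog D 0).
Local Notation T := (supp D).
Local Notation K := (inK D).
Local Notation eta := (etaX phi0 X).
Local Notation tau := (tau xi).

Lemma tau_supp g0 x : inGT g0 x = (tau g0 x \in T).
Proof. by rewrite -piT_eq0 /Defs.tau mulr2n !piTD hxi -mulr2n. Qed.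

Lemma dual_supp g0 x : g0 + xi x + xi (dual_class g0 x) \in T.
Proof. by rewrite -piT_eq0 !piTD !hxi /dual_class; apply/eqP; abelian. Qed.

Variables (d : datum D) (ms : seq (GmodT D)) (ps : seq (GmodT D * GmodT D)).
Hypotheses (vd : valid_datum phi0 X xi d) (ord : support_ordering d ms ps).
Local Notation g0 := (dat_g0 d).
Local Notation kappa := (dat_kappa d).
Local Notation sigma := (dat_sigma d).
Local Notation prt := (partner phi0 X xi d).
Local Notation cf := (coef phi0 X xi qi d ps).
Local Notation sigc := (sig_class phi0 X xi).
Local Notation symc := (sym_class phi0 X xi).

Lemma sig_class_eta x : sigc g0 x -> eta (tau g0 x) = 1.
Proof.
case/orP => [/andP[_ /eqP] //|/andP[hC tK]]; exact: eta_C S _ hC tK.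
Qed.

Lemma sig_class_K x : inGT g0 x -> sigc g0 x -> tau g0 x \in K.
Proof.
rewrite tau_supp => tT /orP[/andP[hRH _]|/andP[]//].
rewrite notC_K //; case/orP: hRH => h.
  by apply/negP => hC; rewrite (isoC_notR hC) in h.
exact: isoH_notC.
Qed.

Lemma sign_homog (b : bool) : (if b then 1 else -1 : D) \in De.
Proof. by case: b; rewrite ?memvN homog1. Qed.

Lemma sign_neq0 (b : bool) : (if b then 1 else -1 : D) != 0.
Proof. by case: b; rewrite ?oppr_eq0 oner_neq0. Qed.

Lemma eta_int t : (eta t)%:~R = 1 :> D \/ (eta t)%:~R = -1 :> D.
Proof. by case: (eta_sign phi0 X t) => ->; [left | right]. Qed.

Lemma coef_factor y : exists t e, [/\ t \in T, e \in De, e != 0, cf y = X t * e &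
  t = g0 + xi y.1 + xi (prt y).1].
Proof.
case: y => x a; rewrite /coef /partner; case: ifP => xG /=; last first.
  exists (g0 + xi x + xi (dual_class g0 x)), (if x \in [seq p.1 | p <- ps] then 1 else
    (eta (g0 + xi x + xi (dual_class g0 x)))%:~R).
  split; rewrite ?dual_supp //.
    by case: ifP => _; rewrite ?homog1 //; case: (eta_int (g0 + xi x + xi (dual_class g0 x))) => ->;
      rewrite ?memvN homog1.
  by case: ifP => _; rewrite ?oner_neq0 //;
    case: (eta_int (g0 + xi x + xi (dual_class g0 x))) => ->; rewrite ?oppr_eq0 oner_neq0.
have te : tau g0 x = g0 + xi x + xi x by rewrite /Defs.tau mulr2n addrA.
have tT : tau g0 x \in T by rewrite -tau_supp.
case: ifP => xs.
  by eexists (tau g0 x), _; split=> //; [exact: sign_homog | exact: sign_neq0].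
case: ifP => xy.
  by eexists (tau g0 x), _; split=> //; [exact: sign_homog | exact: sign_neq0].
case: ifP => hC.
  by exists (tau g0 x), 1; split; rewrite ?homog1 ?oner_neq0 ?mulr1.
have hH : isoH De.
  case/or3P: (Frobenius D) => // [hR|]; last by rewrite hC.
  move: xs xy; rewrite /sym_class /sig_class hR hC /=.
  by case: (eta_sign phi0 X (tau g0 x)) => ->.
have [qD q2] := hqi hH; exists (tau g0 x), qi; split=> //.
by apply/eqP => q0; move/eqP: q2; rewrite q0 mul0r eq_sym oppr_eq0 oner_eq0.
Qed.

Lemma coef_homog y : cf y \in homog D (g0 + xi y.1 + xi (prt y).1).
Proof.
have [t [e [tT eD e0 -> <-]]] := coef_factor y.
by have := homogM (X_homog S tT) eD; rewrite addr0.
Qed.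

Lemma coef_neq0 y : cf y != 0.
Proof.
have [t [e [tT eD e0 -> _]]] := coef_factor y.
exact: homog_neq0M (X_homog S tT) (X_neq0 S tT) e0.
Qed.

(** Consequently the factor eta sits on exactly one of the two coefficients of a dual pair. *)
Lemma firsts_or_seconds x : kappa x != 0%N -> inGT g0 x = false ->
  (dual_class g0 x \in [seq p.1 | p <- ps]) = ~~ (x \in [seq p.1 | p <- ps]).
Proof.
move=> xk xG; have [_ sE /allP msG _] := ord.
have := sE x; rewrite xk mem_cat => /orP[/msG|/flatten_mapP[p pps]]; first by rewrite xG.
have e2 := pair_dual ord pps; have f2 := seconds_pair ord pps; have f1 := firsts_pair pps.
rewrite !inE => /orP[] /eqP ->; first by rewrite -e2 f2 f1.
by rewrite [X in dual_class _ X]e2 dual_classK f1 f2.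
Qed.

Lemma phi_X_eta t : t \in T -> phi0 (X t) = X t * (eta t)%:~R.
Proof.
move=> tT; rewrite (etaE S) //; case: (eta_sign phi0 X t) => ->.
  by rewrite scale1r mulr1.
by rewrite scaleN1r mulrN1.
Qed.

(** This is the hermitian symmetry of Phi, entry by entry. The signs in the blocks are arranged for
    it; in the quaternionic case eta = -1 cancels against phi0(qi) = -qi. *)
Lemma phi_coef y : (y.2 < kappa y.1)%N -> phi0 (cf y) = cf (prt y).
Proof.
case: y => x a /= ak; rewrite /partner /coef /=; case xG: (inGT g0 x); last first.
  rewrite inGT_dual xG dual_classK firsts_or_seconds //; last by rewrite -lt0n (leq_ltn_trans _ ak).
  have -> : g0 + xi (dual_class g0 x) + xi x = g0 + xi x + xi (dual_class g0 x) by rewrite addrAC.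
  set t := g0 + _ + _; have tT : t \in T by exact: dual_supp.
  have e := phi_X_eta tT; case: ifP => _ /=; rewrite ?mulr1 //.
  rewrite (phiM (set_inv S)) e.
  by case: (eta_int t) => ->; rewrite ?linearN (phi1 (set_inv S)) ?mulN1r ?mulrN ?opprK ?mulr1 ?mul1r.
have tT : tau g0 x \in T by rewrite -tau_supp.
have e := phi_X_eta tT; rewrite xG.
case: ifP => xs.
  have -> : symc g0 x = false by rewrite /sym_class xs.
  rewrite (phiM (set_inv S)) e (sig_class_eta xs) mulr1.
  by case: ifP => _; rewrite ?linearN (phi1 (set_inv S)) ?mulN1r ?mulrN ?mulr1 ?mul1r.
case: ifP => xy.
  have := kappa_even vd xG xy; have := xy => /and3P[_ _ /eqP e1] ke.
  rewrite (phiM (set_inv S)) e e1.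
  have -> : ((if a < (kappa x)./2 then a + (kappa x)./2 else a - (kappa x)./2) < (kappa x)./2)%N
      = ~~ (a < (kappa x)./2)%N.
    by case: (ltnP a (kappa x)./2) => h1; [rewrite ltnNge leq_addl | lia].
  by case: ifP => _; rewrite /= ?linearN (phi1 (set_inv S)) ?mulN1r ?mulrN ?mulr1 ?mul1r ?opprK.
case: ifP => hC.
  rewrite e; move: xs xy; rewrite /sym_class /sig_class hC orbT /=.
  case: (eta_sign phi0 X (tau g0 x)) => ->; rewrite ?mulr1 //.
  by rewrite andbT => ->.
have hH : isoH De.
  case/or3P: (Frobenius D) => // [hR|]; last by rewrite hC.
  move: xs xy; rewrite /sym_class /sig_class hR hC /=.
  by case: (eta_sign phi0 X (tau g0 x)) => ->.
have [qD q2] := hqi hH.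
have e1 : eta (tau g0 x) = -1.
  move: xs; rewrite /sig_class hH orbT /= hC /= orbF.
  by case: (eta_sign phi0 X (tau g0 x)) => ->.
have tK : tau g0 x \in K by rewrite notC_K.
rewrite (phiM (set_inv S)) (phi_qi (set_conj S) hH qD q2) e e1 mulrN mulr1 mulNr mulrN opprK.
by rewrite (X_commute S tK qD).
Qed.

Section Form.
Variables (n : nat) (r : 'I_n -> G) (Phi : 'M[D]_n).
Variables (cls : 'I_n -> GmodT D) (pos : 'I_n -> nat) (pi : 'I_n -> 'I_n).
Hypothesis F : form_desc phi0 X xi qi d ps r Phi cls pos pi.
Local Notation c := (fun k => cf (cls k, pos k)).

Lemma form_partner k : prt (cls k, pos k) = (cls (pi k), pos (pi k)).
Proof. by rewrite -(form_pi F). Qed.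

Lemma form_piK : involutive pi.
Proof.
move=> k; have := form_pi F (pi k); rewrite -(form_partner k) (partnerK vd) ?(form_pos F) //.
by case=> e1 e2; apply: (form_inj F).
Qed.

Lemma form_coef_phi k : phi0 (c k) = c (pi k).
Proof. by rewrite phi_coef ?(form_pos F) // form_partner. Qed.

Lemma form_coef_homog k : c k \in homog D (g0 + r k + r (pi k)).
Proof. by have := coef_homog (cls k, pos k); rewrite form_partner !(form_deg F). Qed.

Lemma form_coef_unit k : c k \is a GRing.unit.
Proof. exact: homog_unit (coef_homog _) (coef_neq0 _). Qed.

Lemma form_hermitian : star phi0 Phi = Phi.
Proof.
apply/matrixP => k l; rewrite starE !(form_Phi F) -(inj_eq (inv_inj form_piK)) form_piK eq_sym.
by case: eqP => [->|_]; rewrite ?linear0 // -form_coef_phi (phiK (set_inv S)).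
Qed.

Lemma form_homog k l : Phi k l \in homog D (g0 + r k + r l).
Proof.
rewrite (form_Phi F); case: eqP => [->|_]; last exact: mem0v.
exact: form_coef_homog.
Qed.

Definition form_inverse : 'M[D]_n := \matrix_(k, l) if k == pi l then (c l)^-1 else 0.

Lemma form_mulV : Phi *m form_inverse = 1%:M.
Proof.
apply/matrixP => k l; rewrite !mxE (bigD1 (pi k)) //= big1 ?addr0 => [|i ik].
  rewrite (form_Phi F) eqxx mxE (inj_eq (inv_inj form_piK)).
  by case: eqP => [->|_]; rewrite ?mulr0 // divrr ?form_coef_unit.
by rewrite (form_Phi F) (negPf ik) mul0r.
Qed.

Lemma form_Vmul : form_inverse *m Phi = 1%:M.
Proof.
apply/matrixP => k l; rewrite !mxE (bigD1 (pi k)) //= big1 ?addr0 => [|i ik].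
  rewrite (form_Phi F) mxE form_piK eqxx eq_sym.
  by case: eqP => _; rewrite ?mulr0 // mulVr ?form_coef_unit.
rewrite mxE; case: eqP => [e|]; last by rewrite mul0r.
by rewrite e form_piK eqxx in ik.
Qed.

Lemma mx_inverse_form : mx_inverse Phi = form_inverse.
Proof.
rewrite /mx_inverse; case: xgetP => [B _ [PB BP]|/(_ form_inverse) []]; last first.
  by split; [exact: form_mulV | exact: form_Vmul].
by rewrite -[B]mulmx1 -form_mulV mulmxA BP mul1mx.
Qed.

End Form.
End Coefficients.

(** * Isomorphisms are isometries *)

Section EndoMatrix.
Variables (R : realType) (G : zmodType) (D : gradedDivAlg R G).
Variable psi : D -> D.
Hypothesis E : graded_endo psi.

Lemma endo_sum (I : finType) (P : pred I) (a : I -> D) :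
  psi (\sum_(i | P i) a i) = \sum_(i | P i) psi (a i).
Proof. exact: (big_morph psi (endoD E) (endo0 E)). Qed.

Lemma map_endoM m n p (A : 'M[D]_(m, n)) (B : 'M[D]_(n, p)) :
  map_mx psi (A *m B) = map_mx psi A *m map_mx psi B.
Proof.
apply/matrixP => i j; rewrite !mxE endo_sum; apply: eq_bigr => k _.
by rewrite (endoM E) !mxE.
Qed.

Lemma map_endo1 n : map_mx psi (1%:M : 'M[D]_n) = 1%:M.
Proof.
apply/matrixP => i j; rewrite !mxE.
by case: eqP => _; rewrite ?(endo1 E) ?(endo0 E).
Qed.

End EndoMatrix.

Lemma scalar_mx_commuting (D : nzRingType) n (W : 'M[D]_n) (i0 : 'I_n) :
  (forall b i j, W *m (b *: delta_mx i j) = (b *: delta_mx i j) *m W) ->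
  exists w, (forall i j, W i j = if i == j then w else 0) /\ forall b, w * b = b * w.
Proof.
move=> comm; have L b i j k l : (W *m (b *: delta_mx i j)) k l = if l == j then W k i * b else 0.
  rewrite mxE (bigD1 i) //= big1 ?addr0 => [|u ui]; last by rewrite !mxE (negPf ui) !mulr0.
  by rewrite !mxE eqxx /=; case: eqP; rewrite ?mulr1 ?mulr0.
have Rt b i j k l : ((b *: delta_mx i j) *m W) k l = if k == i then b * W j l else 0.
  rewrite mxE (bigD1 j) //= big1 ?addr0 => [|u uj].
    by rewrite !mxE eqxx andbT; case: eqP; rewrite ?mulr1 ?mulr0 ?mul0r.
  by rewrite !mxE (negPf uj) andbF mulr0 mul0r.
have eqW b i j k l : (if l == j then W k i * b else 0) = if k == i then b * W j l else 0.
  by rewrite -L -Rt comm.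
exists (W i0 i0); split=> [i j|b]; last by have := eqW b i0 i0 i0 i0; rewrite !eqxx.
have := eqW 1 j i0 i i0; rewrite eqxx mulr1 mul1r => ->.
by [].
Qed.

Section IsometryOfIso.
Variables (R : realType) (G : zmodType) (D : gradedDivAlg R G).
Variables (phi0 : {linear D -> D}) (X : G -> D) (f : G) (nu : G -> int).
Hypotheses (S : setting phi0 X f) (hnu : sign_character D nu) (hnuf : nu f = -1).
Local Notation De := (homog D 0).
Local Notation T := (supp D).
Local Notation K := (inK D).
Local Notation star := (star phi0).
Variables (n n' : nat) (r : 'I_n -> G) (r' : 'I_n' -> G) (g0 g0' : G).
Variables (Phi Psi : 'M[D]_n) (Phi' Psi' : 'M[D]_n').
Hypotheses (PhiV : Phi *m Psi = 1%:M) (VPhi : Psi *m Phi = 1%:M)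
  (PhiV' : Phi' *m Psi' = 1%:M)
  (Phi_star : star Phi = Phi) (Phi_star' : star Phi' = Phi')
  (Phi_homog : forall i j, Phi i j \in homog D (g0 + r i + r j))
  (Phi_homog' : forall i j, Phi' i j \in homog D (g0' + r' i + r' j)).
Variable i0 : 'I_n.

(** Put C = star P Phi' P. Compatibility with the involutions says that C psi(Phi)^-1 commutes with
    the image of every matrix, so it is a central scalar w. One nonzero entry of Phi shows that w is
    homogeneous of degree g0' + 2g - g0, hermitian symmetry gives phi0(w) = w, and [central_fixed]
    yields at once that w is real and that this degree is 0. *)
Lemma isometry_of_iso (F : {rmorphism 'M[D]_n -> 'M[D]_n'}) :
  bijective F -> (forall (c : R) A, F (c%:A *: A) = c%:A *: F A) ->
  (forall g (A : 'M[D]_n), (forall i j, A i j \in homog D (- r i + g + r j)) ->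
    forall i j, F A i j \in homog D (- r' i + g + r' j)) ->
  (forall A, F (Psi *m star A *m Phi) = Psi' *m star (F A) *m Phi') ->
  exists psi g (P : 'M[D]_(n', n)) (Q : 'M[D]_(n, n')) m omega,
  [/\ P *m Q = 1%:M, Q *m P = 1%:M,
      (forall i j, P i j \in homog D (- r' i + g + r j)) /\
      (forall i j, Q i j \in homog D (- r i - g + r' j)) & g0 = g0' + g *+ 2] /\
  [/\ omega != 0,
      (forall t, t \in K -> m t = 1) \/ (forall t, t \in K -> m t = (nu t)%:~R),
      graded_endo psi, forall t, t \in K -> psi (X t) = m t *: X t &
      forall i j, (star P *m Phi' *m P) i j = omega *: psi (Phi i j)].
Proof.
move=> Fb Fl Fg Finv.
have [psi0 [h [P0 [Q0 [E0 PQ0 QP0 FE0 [P0h Q0h]]]]]] := morita Fb Fl Fg i0.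
have [hc [c [m [cg c0 m12 psiX psiphi]]]] := normalize S E0 hnu hnuf.
have cU := homog_unit cg c0; have E := endo_conj E0 cg c0.
set psi := (fun d => _) in E.
have pp d : psi (phi0 d) = phi0 (psi d) by exact: psiphi.
(* Rescaling by c moves the inner automorphism used in normalizing psi0 from psi to P and Q. *)
pose P := P0 *m c%:M; pose Q := c^-1 *: Q0.
have PE i j : P i j = P0 i j * c.
  rewrite /P mxE (bigD1 j) //= big1 ?addr0 => [|k kj]; last by rewrite !mxE (negPf kj) mulr0.
  by rewrite mxE eqxx.
have cc : c%:M *m (c^-1)%:M = 1%:M :> 'M[D]_n by rewrite -scalar_mxM divrr.
have cc' : (c^-1)%:M *m c%:M = 1%:M :> 'M[D]_n by rewrite -scalar_mxM mulVr.
have QE : Q = (c^-1)%:M *m Q0 by rewrite mul_scalar_mx.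
have PQ : P *m Q = 1%:M by rewrite QE /P mulmxA -(mulmxA P0) cc mulmx1 PQ0.
have QP : Q *m P = 1%:M by rewrite QE /P mulmxA -(mulmxA _ Q0) QP0 mulmx1 cc'.
have psiE A : map_mx psi A = (c^-1)%:M *m map_mx psi0 A *m c%:M.
  apply/matrixP => i j; rewrite [RHS]mxE (bigD1 j) //= big1 ?addr0 => [|k kj].
    by rewrite mul_scalar_mx !mxE eqxx.
  by rewrite mul_scalar_mx !mxE (negPf kj) mulr0.
have FE A : F A = P *m map_mx psi A *m Q.
  rewrite psiE QE /P !mulmxA -(mulmxA P0) cc mulmx1.
  by rewrite -(mulmxA (P0 *m _)) cc mulmx1 FE0.
have Qh i j : Q i j \in homog D (- r i - (h + hc) + r' j).
  by rewrite mxE; apply: homog_eq (homogM (homogV cg c0) (Q0h i j)) _; abelian.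
clearbody P Q.
pose g := h + hc.
have Ph i j : P i j \in homog D (- r' i + g + r j).
  by rewrite PE; apply: homog_eq (homogM (P0h i j) cg) _; rewrite /g; abelian.
have starpsi A : star (map_mx psi A) = map_mx psi (star A) :> 'M[D]_n.
  by apply/matrixP => i j; rewrite !mxE pp.
pose C := star P *m Phi' *m P.
have Ccomm A : C *m map_mx psi Psi *m map_mx psi (star A) =
    map_mx psi (star A) *m (C *m map_mx psi Psi).
  have := congr1 (fun M => star P *m Phi' *m M *m P *m map_mx psi Psi) (Finv A).
  rewrite /= !FE !(starM (set_inv S)) starpsi !(map_endoM E) !mulmxA.
  rewrite -(mulmxA _ Q P) QP mulmx1 -(mulmxA _ (map_mx psi Phi)) -(map_endoM E) PhiV.
  rewrite (map_endo1 E) mulmx1 -(mulmxA _ Phi' Psi') PhiV' mulmx1.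
  rewrite -(starM (set_inv S)) QP (star1 (set_inv S)) mul1mx => e.
  exact: e.
have [|w [wE wC]] := scalar_mx_commuting (W := C *m map_mx psi Psi) i0.
  move=> b i j; have [a <-] := endo_surj E b.
  have -> : psi a *: delta_mx i j = map_mx psi (star (star (a *: delta_mx i j))) :> 'M[D]_n.
    rewrite (starK (set_inv S)); apply/matrixP => k l; rewrite !mxE.
    by case: (_ && _); rewrite ?mulr1 ?mulr0 ?(endo0 E).
  exact: Ccomm.
have CE i j : C i j = w * psi (Phi i j).
  have -> : C = C *m map_mx psi Psi *m map_mx psi Phi.
    by rewrite -mulmxA -(map_endoM E) VPhi (map_endo1 E) mulmx1.
  rewrite mxE (bigD1 i) //= big1 ?addr0 => [|k ki]; last by rewrite wE eq_sym (negPf ki) mul0r.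
  by rewrite wE eqxx mxE.
have w0 : w != 0.
  apply/eqP => w0; have C0 : C = 0 by apply/matrixP => i j; rewrite CE w0 mul0r mxE.
  have P'0 : Phi' = 0.
    have -> : Phi' = star Q *m C *m Q.
      rewrite /C !mulmxA -(starM (set_inv S)) PQ (star1 (set_inv S)) mul1mx.
      by rewrite -mulmxA PQ mulmx1.
    by rewrite C0 mulmx0 mul0mx.
  have : (1%:M : 'M[D]_n) = 0.
    by rewrite -QP -[P]mul1mx -PhiV' P'0 mul0mx mul0mx mulmx0.
  by move/matrixP/(_ i0 i0); rewrite !mxE eqxx => /eqP; rewrite oner_eq0.
have C_star : star C = C.
  by rewrite /C !(starM (set_inv S)) (starK (set_inv S)) Phi_star' mulmxA.
have [k k0] : exists k, Phi i0 k != 0.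
  apply: contrapT => H; have /matrixP/(_ i0 i0) := PhiV; rewrite !mxE eqxx big1 => [|k _].
    by move/esym/eqP; rewrite oner_eq0.
  have -> : Phi i0 k = 0 by apply/eqP; apply: contrapT => /negP ?; apply: H; exists k.
  by rewrite mul0r.
have pk0 : psi (Phi i0 k) != 0 by apply: contraNneq k0 => /(endo_inj E) ->.
have pkh := endo_homog E (Phi_homog i0 k).
have pkU := homog_unit pkh pk0.
have Ch : C i0 k \in homog D (g0' + g *+ 2 + r i0 + r k).
  rewrite mxE; apply: memv_suml => j _; rewrite mxE mulr_suml; apply: memv_suml => i _.
  rewrite starE; apply: homog_eq (homogM (homogM (phi_homog (set_inv S) (Ph i i0))
    (Phi_homog' i j)) (Ph j k)) _.
  by abelian.
have wh : w \in homog D (g0' + g *+ 2 - g0).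
  have -> : w = C i0 k * (psi (Phi i0 k))^-1 by rewrite CE mulrK.
  by apply: homog_eq (homogM Ch (homogV pkh pk0)) _; abelian.
have pw : phi0 w = w.
  have := C_star => /matrixP/(_ i0 k); rewrite starE !CE (phiM (set_inv S)) -pp.
  have -> : phi0 (Phi k i0) = Phi i0 k by rewrite -(starE phi0) Phi_star.
  by rewrite [w * _]wC => /(mulrI pkU).
have [gE [omega om0 wO]] := central_fixed S w0 wC wh pw.
exists psi, g, P, Q, m, omega; split; split=> //.
  by apply/eqP; rewrite eq_sym -subr_eq0 gE.
by move=> i j; rewrite -/C CE wO mulr_algl.
Qed.

End IsometryOfIso.

(** * Inertia and the orbit of the datum *)

Section Kernel.
Variables (R : realType) (G : zmodType) (D : gradedDivAlg R G).
Local Notation De := (homog D 0).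

(** A linear system over D_e with one equation for each k in B and fewer equations than unknowns.
    Dimensions are counted over R, each unknown and each equation contributing dim D_e. *)
Lemma kernel_vector (I J : finType) (A : {set I}) (B : {set J}) (p : J -> I -> D) :
  (forall k i, p k i \in De) -> (#|B| < #|A|)%N ->
  exists v : I -> D, [/\ forall i, v i \in De, forall i, i \notin A -> v i = 0,
    exists i, v i != 0 & forall k, k \in B -> \sum_i p k i * v i = 0].
Proof.
move=> pD BA; pose U := subvs_of De.
(* The right summand indexes the additional equations v i = 0 for i outside A. *)
pose J' := ({k | k \in B} + {i | i \notin A})%type.
pose L (v : {ffun I -> U}) : {ffun J' -> U} := [ffun j => match j with
  | inl k => vsproj De (\sum_i p (val k) i * vsval (v i))
  | inr i => v (val i) end].
have L_lin : linear L.
  move=> c u w; apply/ffunP => -[k|i]; rewrite !ffunE //=.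
  rewrite -linearP /=; congr (vsproj De _).
  rewrite scaler_sumr -big_split /=; apply: eq_bigr => i _.
  by rewrite !ffunE linearP /= mulrDr scalerAr.
pose Ll : {linear {ffun I -> U} -> {ffun J' -> U}} :=
  HB.pack L (GRing.isLinear.Build R _ _ _ L L_lin).
have dU : (0 < dim U)%N.
  rewrite lt0n -dimvf dimv_eq0; apply/eqP => e.
  have : vsproj De 1 \in (fullv : {vspace U}) by exact: memvf.
  rewrite e memv0 => /eqP/(congr1 vsval); rewrite vsprojK ?homog1 // linear0.
  by apply/eqP; rewrite oner_eq0.
have cJ : #|{: J'}| = (#|B| + #|~: A|)%N.
  rewrite card_sum !card_sig; congr (_ + _)%N; apply: eq_card => i; rewrite !inE //.
have : lker (linfun Ll) != 0%VS.
  apply/negP => /eqP k0; have := limg_ker_dim (linfun Ll) fullv.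
  rewrite k0 capv0 dimv0 add0n => e.
  have := dimvS (subvf (limg (linfun Ll))); rewrite e !dimvf /dim /=.
  rewrite leq_mul2r -[X in (X == 0)%N]/(dim U) eqn0Ngt dU /= cJ leqNgt.
  by rewrite -(cardsC A) ltn_add2r BA.
rewrite -vpick0 => v0; pose v := vpick (lker (linfun Ll)).
have : L v = 0.
  by have := memv_pick (lker (linfun Ll)); rewrite memv_ker lfunE => /eqP.
move=> Lv; exists (fun i => vsval (v i)); split.
- by move=> i; apply: subvsP.
- move=> i iA; have /ffunP/(_ (inr (exist _ i iA))) := Lv.
  by rewrite !ffunE /= => ->; rewrite linear0.
- apply: contrapT => H; case/eqP: v0; apply/ffunP => i; rewrite [RHS]ffunE.
  apply: contrapT => ne; apply: H; exists i; apply/eqP => vi0; apply: ne.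
  by apply: val_inj; rewrite [LHS]vi0 -(linear0 (vsval : {linear U -> D})).
move=> k kB; have /ffunP/(_ (inl (exist _ k kB))) := Lv.
rewrite !ffunE /= => /(congr1 vsval); rewrite vsprojK ?linear0 //.
by apply: memv_suml => i _; rewrite De_mul // subvsP.
Qed.

End Kernel.

Section Inertia.
Variables (R : realType) (G : zmodType) (D : gradedDivAlg R G).
Variable phi0 : {linear D -> D}.
Local Notation De := (homog D 0).
Hypotheses (hphi0 : degree_preserving_involution phi0)
           (hconj : restricts_to_conj phi0 De).

Lemma De_norm_function : exists N : D -> R,
  [/\ forall a, a \in De -> phi0 a * a = (N a)%:A,
      forall a, a \in De -> 0 <= N a & forall a, a \in De -> a != 0 -> 0 < N a].
Proof.
have ex a : exists r, a \in De -> [/\ phi0 a * a = r%:A, 0 <= r & (a != 0 -> 0 < r)].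
  have [aD|] := boolP (a \in De); last by exists 0.
  have [->|a0] := eqVneq a 0; first by exists 0; rewrite mulr0 scale0r.
  by have [r r0 e] := De_norm hconj aD a0; exists r; split=> //; apply: ltW.
exists (fun a => projT1 (cid (ex a))); split=> a /(projT2 (cid (ex a))) [] //.
Qed.

(** Otherwise some nonzero v supported on A is killed by the rows in B. The form at v is positive by
    its diagonal shape on A, yet not positive because only rows outside B still contribute. *)
Lemma inertia_le (I J : finType) (A : {set I}) (B : {set J}) (c : I -> R) (s : J -> R)
    (p : J -> I -> D) : (forall k i, p k i \in De) ->
  (forall i j, i \in A -> j \in A ->
    \sum_k s k *: (phi0 (p k i) * p k j) = if i == j then (c i)%:A else 0) ->
  (forall i, i \in A -> 0 < c i) -> (forall k, k \notin B -> s k <= 0) ->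
  (#|A| <= #|B|)%N.
Proof.
move=> pD form cpos sneg; rewrite leqNgt; apply/negP => BA.
have [v [vD vA [i1 vi1] v0]] := kernel_vector pD BA.
have [N [NE N0 Npos]] := De_norm_function.
pose y k := \sum_i p k i * v i.
have yD k : y k \in De by apply: memv_suml => i _; rewrite De_mul.
have i1A : i1 \in A by apply: contraNT vi1 => /vA ->.
have sumA (W : zmodType) (F : I -> W) : (forall i, i \notin A -> F i = 0) ->
    \sum_i F i = \sum_(i in A) F i.
  by move=> F0; rewrite [RHS]big_mkcond; apply: eq_bigr => i _; case: ifPn => // /F0.
(* Both sides are the value of the form at v, computed in the two bases. *)
have key : \sum_k s k * N (y k) = \sum_(i in A) c i * N (v i).
  apply: (@realA_inj R G D); rewrite /= !scaler_suml.
  have -> : \sum_k (s k * N (y k))%:A =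
      \sum_i \sum_j phi0 (v i) * (\sum_k s k *: (phi0 (p k i) * p k j)) * v j :> D.
    under [RHS]eq_bigr => i _ do under eq_bigr => j _ do rewrite mulr_sumr mulr_suml.
    under [RHS]eq_bigr => i _ do rewrite exchange_big.
    rewrite exchange_big; apply: eq_bigr => k _ /=.
    rewrite -scalerA -NE // {1}/y linear_sum mulr_suml scaler_sumr; apply: eq_bigr => i _.
    rewrite /y mulr_sumr scaler_sumr; apply: eq_bigr => j _.
    by rewrite (phiM hphi0) -scalerAr -scalerAl !mulrA.
  rewrite sumA => [|i iA]; last first.
    by rewrite big1 // => j _; rewrite vA // linear0 !mul0r.
  apply: eq_bigr => i iA; rewrite sumA => [|j jA]; last by rewrite (vA j) // mulr0.
  rewrite (bigD1 i) //= [X in _ + X]big1 ?addr0 => [|j /andP[jA ji]].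
    by rewrite form // eqxx mulr_algr -scalerAl NE // scalerA.
  by rewrite form // eq_sym (negPf ji) mulr0 mul0r.
have : 0 < \sum_(i in A) c i * N (v i).
  rewrite (bigD1 i1) //= ltr_wpDr //; last by rewrite mulr_gt0 ?cpos ?Npos.
  by apply: sumr_ge0 => i /andP[iA _]; rewrite mulr_ge0 ?N0 // ltW ?cpos.
rewrite -key ltNge sumr_le0 // => k _.
have [kB|kB] := boolP (k \in B); last by rewrite mulr_le0_ge0 ?sneg ?N0.
have -> : y k = 0 by exact: v0.
have := NE 0 (mem0v _); rewrite mulr0 => /esym/eqP.
by rewrite scaler_eq0 oner_eq0 orbF => /eqP ->; rewrite mulr0.
Qed.

End Inertia.

(** * Class sizes under an isometry *)

Section Multiplicities.
Variables (R : realType) (G : zmodType) (D : gradedDivAlg R G).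
Variables (phi0 : {linear D -> D}) (X : G -> D) (f : G) (xi : GmodT D -> G).
Hypotheses (S : setting phi0 X f) (hxi : cancel xi (@piT R G D)).
Local Notation De := (homog D 0).
Local Notation T := (supp D).
Local Notation K := (inK D).

Section Blocks.
Variables (n n' : nat) (cls : 'I_n -> GmodT D) (cls' : 'I_n' -> GmodT D) (g : G).
Variables (P : 'M[D]_(n', n)).
Hypotheses (P_homog : forall i j, P i j \in homog D (- xi (cls' i) + g + xi (cls j))).

Lemma P_class i j : P i j != 0 -> cls' i = cls j + piT D g.
Proof.
move=> P0; have : - xi (cls' i) + g + xi (cls j) \in T by apply/suppP; exists (P i j).
rewrite -piT_eq0 !piTD piTN !hxi => /eqP e; apply/eqP; rewrite -subr_eq0 -oppr_eq0 -e.
by apply/eqP; abelian.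
Qed.

Variable y : GmodT D.
Local Notation x := (y + piT D g).
(** The element u of the group action. Entries of P from class y to class y + gT have degree -u,
    which equals u because T has exponent 2. *)
Definition shift_degree : G := xi x - g - xi y.

Lemma shift_degree_T : shift_degree \in T.
Proof. by rewrite -piT_eq0 /shift_degree !piTD !piTN !hxi; apply/eqP; abelian. Qed.

(** Dividing by X_u brings the entries of P between the two classes into D_e, where [kernel_vector]
    and inertia apply. *)
Definition P_block (k : 'I_n') (i : 'I_n) : D :=
  if (cls' k == x) && (cls i == y) then (X shift_degree)^-1 * P k i else 0.

Lemma P_block_De k i : P_block k i \in De.
Proof.
rewrite /P_block; case: ifP => [/andP[/eqP kx /eqP iy]|_]; last exact: mem0v.
have uT := shift_degree_T.
apply: homog_eq (homogM (homogV (X_homog S uT) (X_neq0 S uT)) (P_homog k i)) _.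
rewrite (oppT S uT) kx iy /shift_degree; abelian.
Qed.

Lemma P_blockE k i : cls i = y -> P k i = X shift_degree * P_block k i.
Proof.
move=> iy; rewrite /P_block iy eqxx andbT; case: eqP => [_|kx].
  by rewrite mulVKr ?(X_unit S shift_degree_T).
by rewrite mulr0; apply/eqP; apply: contraTT isT => /P_class; rewrite iy.
Qed.

(** With too few rows, some nonzero vector supported on class y would be killed by the block, hence
    by all of P, as P has no other nonzero entries in these columns. But Q P = 1 makes P
    injective. *)
Lemma class_card_le (Q : 'M[D]_(n, n')) : Q *m P = 1%:M ->
  (#|[set i | cls i == y]| <= #|[set k | cls' k == x]|)%N.
Proof.
move=> QP; rewrite leqNgt; apply/negP => lt.
have [v [vD vA [i1 vi1] v0]] := kernel_vector P_block_De lt.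
have Pv k : \sum_i P k i * v i = 0.
  have Pb i : P k i * v i = X shift_degree * (P_block k i * v i).
    have [iy|iy] := eqVneq (cls i) y; first by rewrite P_blockE // mulrA.
    by rewrite vA ?inE // !mulr0.
  rewrite (eq_bigr _ (fun i _ => Pb i)) -mulr_sumr.
  have [kx|kx] := eqVneq (cls' k) x; first by rewrite v0 ?mulr0 // inE kx.
  by rewrite big1 ?mulr0 // => i _; rewrite /P_block (negPf kx) mul0r.
case/eqP: vi1; have <- : \sum_k Q i1 k * (\sum_i P k i * v i) = v i1.
  under eq_bigr => k _ do rewrite mulr_sumr.
  rewrite exchange_big (bigD1 i1) //= [X in _ + X]big1 ?addr0 => [|i ii].
    under eq_bigr => k _ do rewrite mulrA.
    have /matrixP/(_ i1 i1) := QP; rewrite !mxE eqxx -mulr_suml => ->.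
    by rewrite mul1r.
  under eq_bigr => k _ do rewrite mulrA.
  have /matrixP/(_ i1 i) := QP; rewrite !mxE eq_sym (negPf ii) -mulr_suml => ->.
  by rewrite mul0r.
by rewrite big1 // => k _; rewrite Pv mulr0.
Qed.

End Blocks.

Lemma class_card (d : datum D) (ps : seq (GmodT D * GmodT D)) (qi : D) n r (Phi : 'M[D]_n) cls pos pi :
  form_desc phi0 X xi qi d ps r Phi cls pos pi ->
  forall y b, (b <= dat_kappa d y)%N ->
  #|[set i | (cls i == y) && (pos i < b)%N]| = b.
Proof.
move=> F y b bk; rewrite cardE -(size_map pos) -[RHS](size_iota 0).
apply: perm_size; apply: uniq_perm; rewrite ?iota_uniq //.
  rewrite map_inj_in_uniq ?enum_uniq // => i j; rewrite !mem_enum !inE.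
  by move=> /andP[/eqP iy _] /andP[/eqP jy _] e; apply: (form_inj F); rewrite ?iy.
move=> a; rewrite mem_iota /=; apply/mapP/idP => [|ab].
  by case=> i; rewrite mem_enum inE => /andP[_ ib] ->.
have [i [iy ia]] := form_surj F (leq_trans ab bk).
by exists i; rewrite // mem_enum inE iy ia eqxx.
Qed.

Lemma class_card_total (d : datum D) (ps : seq (GmodT D * GmodT D)) (qi : D) n r (Phi : 'M[D]_n) cls pos pi :
  form_desc phi0 X xi qi d ps r Phi cls pos pi ->
  forall y, #|[set i | cls i == y]| = dat_kappa d y.
Proof.
move=> F y; rewrite -[RHS](class_card F (leqnn (dat_kappa d y))); apply: eq_card => i.
by rewrite !inE; case: eqP => //= <-; rewrite (form_pos F).
Qed.

End Multiplicities.

(** * Transport of signatures *)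

Section Shift.
Variables (R : realType) (G : zmodType) (D : gradedDivAlg R G).
Variables (phi0 : {linear D -> D}) (X : G -> D) (f : G) (xi : GmodT D -> G).
Hypotheses (S : setting phi0 X f) (hxi : cancel xi (@piT R G D)).
Local Notation De := (homog D 0).
Local Notation T := (supp D).
Local Notation K := (inK D).
Local Notation eta := (etaX phi0 X).
Local Notation tau := (tau xi).

Lemma real_signE (r : R) : real_sign (r%:A : D) = sgz r.
Proof.
rewrite /real_sign; case: xgetP => [s _ /realA_inj -> //|/(_ r) []].
by [].
Qed.

Lemma inGT_shift g0 g y : inGT (g0 - g *+ 2) (y + piT D g) = inGT g0 y.
Proof.
rewrite /inGT piTD piTN; congr (_ == 0).
have -> : piT D (g *+ 2) = piT D g *+ 2 by rewrite !mulr2n piTD.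
abelian.
Qed.

(** The two sides differ by 2u, and T has exponent 2. *)
Lemma tau_shift g0 g y : tau (g0 - g *+ 2) (y + piT D g) = tau g0 y.
Proof.
have [e _] := X_square S (shift_degree_T hxi g y).
rewrite -[RHS]addr0 -e /Defs.tau /shift_degree; abelian.
Qed.

Lemma sig_class_shift g0 g y :
  sig_class phi0 X xi (g0 - g *+ 2) (y + piT D g) = sig_class phi0 X xi g0 y.
Proof. by rewrite /sig_class tau_shift. Qed.

Lemma sym_class_shift g0 g y :
  sym_class phi0 X xi (g0 - g *+ 2) (y + piT D g) = sym_class phi0 X xi g0 y.
Proof. by rewrite /sym_class sig_class_shift tau_shift. Qed.

Lemma dual_class_shift g0 g y :
  dual_class (g0 - g *+ 2) (y + piT D g) = dual_class g0 y + piT D g.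
Proof.
rewrite /dual_class piTD piTN; have -> : piT D (g *+ 2) = piT D g *+ 2 by rewrite !mulr2n piTD.
abelian.
Qed.

(* X_u X_t X_u = rho X_t, where rho is the real number whose sign enters the action. *)
Lemma conjugate_factor t u : t \in K -> u \in T -> exists2 rho, rho != 0 &
  X u * X t * X u = rho *: X t /\ real_sign ((X (t + u *+ 2))^-1 * X u * X t * X u) = sgz rho.
Proof.
move=> tK uT; have tT := inK_T tK; have [uu [r0 r00 rE]] := X_square S uT.
have b0 : beta X t u != 0 by rewrite -sqrf_eq0 expr2 beta_sqr oner_neq0.
have e : X u * X t * X u = (beta X t u * r0) *: X t.
  rewrite -mulrA (betaE S tK uT) -scalerAr mulrA rE -scalerAl mul1r.
  by rewrite scalerA.
exists (beta X t u * r0); first by rewrite mulf_neq0.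
split=> //; rewrite mulr2n uu addr0 -!mulrA [X u * _]mulrA e -scalerAr mulVr ?(X_unit S) //.
exact: real_signE.
Qed.

Variables (d d' : datum D) (ps ps' : seq (GmodT D * GmodT D)) (qi : D).
Hypotheses (vd : valid_datum phi0 X xi d) (vd' : valid_datum phi0 X xi d').
Variables (n n' : nat) (r : 'I_n -> G) (r' : 'I_n' -> G).
Variables (Phi : 'M[D]_n) (Phi' : 'M[D]_n').
Variables (cls : 'I_n -> GmodT D) (pos : 'I_n -> nat) (pi : 'I_n -> 'I_n).
Variables (cls' : 'I_n' -> GmodT D) (pos' : 'I_n' -> nat) (pi' : 'I_n' -> 'I_n').
Hypothesis F : form_desc phi0 X xi qi d ps r Phi cls pos pi.
Hypothesis F' : form_desc phi0 X xi qi d' ps' r' Phi' cls' pos' pi'.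
Variables (psi : D -> D) (g : G) (P : 'M[D]_(n', n)) (Q : 'M[D]_(n, n')).
Variables (m : G -> R) (omega : R).
Hypotheses (PQ : P *m Q = 1%:M) (QP : Q *m P = 1%:M)
  (Ph : forall i j, P i j \in homog D (- r' i + g + r j))
  (Qh : forall i j, Q i j \in homog D (- r i - g + r' j))
  (g0E : dat_g0 d = dat_g0 d' + g *+ 2) (omega0 : omega != 0)
  (m_sign : forall t, t \in K -> m t * m t = 1)
  (E : graded_endo psi) (psiX : forall t, t \in K -> psi (X t) = m t *: X t)
  (isom : forall i j, (star phi0 P *m Phi' *m P) i j = omega *: psi (Phi i j)).

Lemma g0_shift : dat_g0 d' = dat_g0 d - g *+ 2.
Proof. by rewrite g0E addrK. Qed.

Lemma Pxi i j : P i j \in homog D (- xi (cls' i) + g + xi (cls j)).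
Proof. by rewrite -(form_deg F) -(form_deg F'). Qed.

Lemma Qxi i j : Q i j \in homog D (- xi (cls i) - g + xi (cls' j)).
Proof. by rewrite -(form_deg F) -(form_deg F'). Qed.

Lemma kappa_shift y : dat_kappa d' (y + piT D g) = dat_kappa d y.
Proof.
apply/eqP; rewrite eqn_leq -(class_card_total F) -(class_card_total F').
rewrite (class_card_le S hxi Pxi y QP) andbT.
have := class_card_le S hxi Qxi (y + piT D g) PQ.
by rewrite piTN addrK.
Qed.

Section SignatureClass.
Variable y : GmodT D.
Hypotheses (yG : inGT (dat_g0 d) y) (ys : sig_class phi0 X xi (dat_g0 d) y).
Local Notation x := (y + piT D g).
Local Notation t := (tau (dat_g0 d) y).
Local Notation u := (shift_degree xi g y).
Local Notation p := (P_block X xi cls cls' g P y).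

Let xG : inGT (dat_g0 d') x. Proof. by rewrite g0_shift inGT_shift. Qed.
Let xs : sig_class phi0 X xi (dat_g0 d') x.
Proof. by rewrite g0_shift sig_class_shift. Qed.
Let tK : t \in K. Proof. exact: (sig_class_K hxi yG ys). Qed.
Let tE : tau (dat_g0 d') x = t. Proof. by rewrite g0_shift tau_shift. Qed.

Definition sgn_of (b : bool) : R := if b then 1 else -1.

Lemma sgn_ofE b : (if b then 1 else -1 : D) = (sgn_of b)%:A.
Proof. by case: b; rewrite /sgn_of ?scale1r ?scaleN1r. Qed.

Definition sgn k : R := sgn_of (pos k < pos_count d y)%N.
Definition sgn' k : R := if cls' k == x then sgn_of (pos' k < pos_count d' x)%N else 0.

Lemma sig_form_entry i j : cls i = y ->
  Phi i j = if j == i then sgn i *: X t else 0.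
Proof.
move=> iy; have := form_pi F i; rewrite iy /partner yG /sym_class ys /= => -[e1 e2].
have -> : i = pi i by apply: (form_inj F); rewrite ?e1 ?e2 ?iy.
rewrite (form_Phi F).
have -> : pi (pi i) = pi i.
  have := form_pi F (pi i); rewrite e1 /partner yG /sym_class ys /= => -[f1 f2].
  by apply: (form_inj F); rewrite ?f1 ?f2 ?e1.
case: eqP => // _; rewrite /coef e1 yG ys sgn_ofE /sgn.
by rewrite -scalerAr mulr1.
Qed.

Lemma sig_form_entry' i j : cls' i = x ->
  Phi' i j = if j == i then sgn' i *: X t else 0.
Proof.
move=> iy; have := form_pi F' i; rewrite iy /partner xG /sym_class xs /= => -[e1 e2].
have ei : i = pi' i by apply: (form_inj F'); rewrite ?e1 ?e2 ?iy.
rewrite (form_Phi F') -ei.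
case: eqP => // _; rewrite /coef iy xG xs sgn_ofE /sgn' iy eqxx tE.
by rewrite -scalerAr mulr1.
Qed.

(** On this class P = X_u p with p over D_e. From phi0(X_u) = eta(u) X_u and X_u X_t X_u = rho X_t,
    a factor eta(u) rho comes out of the isometry equation; dividing omega m(t) by it gives
    theta. *)
Lemma form_transport : exists theta : R,
  [/\ theta != 0, forall i j, cls i = y -> cls j = y ->
      \sum_k sgn' k *: (phi0 (p k i) * p k j) = if i == j then (theta * sgn i)%:A else 0 &
    sgz theta = sgz omega * sgz (m t) * eta u *
      real_sign ((X (t + u *+ 2))^-1 * X u * X t * X u)].
Proof.
have uT := shift_degree_T hxi g y.
have [rho rho0 [rhoE ->]] := conjugate_factor tK uT.
have etaR : (eta u)%:~R * (eta u)%:~R = 1 :> R.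
  by case: (eta_sign phi0 X u) => ->; rewrite ?mulr1 // mulrNN mulr1.
have eta0 : (eta u)%:~R != 0 :> R by rewrite -sqrf_eq0 expr2 etaR oner_neq0.
have m0 : m t != 0 by rewrite -sqrf_eq0 expr2 m_sign // oner_neq0.
exists (omega * m t * (eta u)%:~R * rho^-1); split.
- by rewrite !mulf_neq0 ?invr_eq0.
- move=> i j iy jy; set s := \sum_k _.
  have sD : s \in De.
    apply: memv_suml => k _; rewrite memvZ // De_mul ?(phi_homog (set_inv S)) ?(P_block_De S hxi Pxi) //.
  have : ((eta u)%:~R * rho) *: (s * X t) = (if i == j then omega * m t * sgn i else 0) *: X t.
    have := isom i j; rewrite sig_form_entry // eq_sym.
    have -> : omega *: psi (if i == j then sgn i *: X t else 0) =
        (if i == j then omega * m t * sgn i else 0) *: X t.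
      case: eqP => _; last by rewrite (endo0 E) scaler0 scale0r.
      by rewrite (endoZ E) psiX // !scalerA mulrAC.
    move=> <-; rewrite mxE /s mulr_suml scaler_sumr; apply: eq_bigr => k _.
    have P0 l : cls' l != x -> P l i = 0.
      move=> lx; apply/eqP; apply: contraNT lx => /(P_class hxi Pxi) ->.
      by rewrite iy.
    have -> : (star phi0 P *m Phi') i k = phi0 (P k i) * (sgn' k *: X t).
      rewrite mxE (bigD1 k) //= big1 ?addr0 => [|l lk]; rewrite starE.
        have [kx|/P0 ->] := eqVneq (cls' k) x; last by rewrite linear0 !mul0r.
        by rewrite (sig_form_entry' _ kx) eqxx.
      have [lx|/P0 ->] := eqVneq (cls' l) x; last by rewrite linear0 mul0r.
      by rewrite (sig_form_entry' _ lx) eq_sym (negPf lk) mulr0.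
    rewrite (P_blockE S hxi Pxi k iy) (P_blockE S hxi Pxi k jy) (phiM (set_inv S)) (etaE S uT).
    have conj a b : b \in De -> a * ((eta u)%:~R *: X u) * (sgn' k *: X t) * (X u * b) =
        ((eta u)%:~R * rho) *: (sgn' k *: (a * b) * X t).
      move=> bD; transitivity (((eta u)%:~R * sgn' k) *: (a * (X u * X t * X u) * b)).
        by rewrite -!scalerAr -!scalerAl scalerA mulrC !mulrA.
      rewrite rhoE -scalerAr -scalerAl -mulrA (X_commute S tK bD) mulrA -scalerAl !scalerA.
      by congr (_ *: _); ring.
    by rewrite conj ?(P_block_De S hxi Pxi).
  have tT := inK_T tK; move=> e; apply: (mulIr (X_unit S tT)).
  have er0 : (eta u)%:~R * rho != 0 by rewrite mulf_neq0.
  apply: (scalerI er0); rewrite e; case: eqP => _; last by rewrite mul0r scaler0 scale0r.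
  rewrite -scalerAl mul1r scalerA; congr (_ *: _).
  move: etaR; set e1 : R := (eta u)%:~R; move=> ee.
  by rewrite -[LHS]mulr1 -{1}ee; field.
have sV : sgz rho^-1 = sgz rho by rewrite /sgz invr_eq0 invr_lt0.
rewrite !sgzM sV; case: (eta_sign phi0 X u) => ->.
  by rewrite mulr1z sgz1.
by rewrite mulrN1z sgzN1.
Qed.

Lemma sigma_shift : dat_sigma d' x = sgz omega * sgz (m t) * eta u *
  real_sign ((X (t + u *+ 2))^-1 * X u * X t * X u) * dat_sigma d y.
Proof.
have [theta [th0 form <-]] := form_transport.
pose A (b : bool) := [set i | (cls i == y) && ((pos i < pos_count d y)%N == b)].
pose B (b : bool) := [set k | (cls' k == x) && ((pos' k < pos_count d' x)%N == b)].
(* Inertia compares the rows of sign b with those of sign c. For either sign of theta two such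
   inequalities hold, and since the class sizes agree both are equalities. *)
have le (b c : bool) : 0 < theta * sgn_of b * sgn_of c -> (#|A b| <= #|B c|)%N.
  move=> pos0.
  apply: (inertia_le (set_inv S) (set_conj S) (c := fun i => theta * sgn i * sgn_of c)
    (s := fun k => sgn' k * sgn_of c) (p := p)).
  - exact: (P_block_De S hxi Pxi).
  - move=> i j; rewrite !inE => /andP[/eqP iy _] /andP[/eqP jy _].
    under eq_bigr => k _ do rewrite mulrC -scalerA.
    rewrite -scaler_sumr form //; case: eqP => _; last by rewrite scaler0.
    by rewrite scalerA mulrC.
  - by move=> i; rewrite inE /sgn => /andP[_ /eqP ->].
  move=> k; rewrite inE /sgn'; case: eqP => //= _; last by rewrite mul0r.
  by case: (_ < _)%N; case: (c); rewrite //= /sgn_of ?mulr1 ?mul1r ?mulrN1 ?lerN10.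
have cA := class_card F (y := y); have cB := class_card F' (y := x).
have pk : (pos_count d y <= dat_kappa d y)%N.
  by rewrite -(pos_neg_count vd yG ys) leq_addr.
have pk' : (pos_count d' x <= dat_kappa d' x)%N.
  by rewrite -(pos_neg_count vd' xG xs) leq_addr.
have At : #|A true| = pos_count d y.
  by rewrite -(cA _ pk); apply: eq_card => i; rewrite !inE eqb_id.
have Bt : #|B true| = pos_count d' x.
  by rewrite -(cB _ pk'); apply: eq_card => i; rewrite !inE eqb_id.
have Af : (#|A true| + #|A false| = dat_kappa d y)%N.
  rewrite -(class_card_total F y) -(cardsID (A true) [set i | cls i == y]).
  congr (_ + _)%N; apply: eq_card => i; rewrite !inE.
    by case: (cls i == y); rewrite ?andbF //= andbT.
  by case: (cls i == y); rewrite //= ?andbF // eqb_id eqbF_neg andbT.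
have Bf : (#|B true| + #|B false| = dat_kappa d' x)%N.
  rewrite -(class_card_total F' x) -(cardsID (B true) [set i | cls' i == x]).
  congr (_ + _)%N; apply: eq_card => i; rewrite !inE.
    by case: (cls' i == x); rewrite ?andbF //= andbT.
  by case: (cls' i == x); rewrite //= ?andbF // eqb_id eqbF_neg andbT.
have kk := kappa_shift y.
rewrite (sigma_pos_count vd yG ys) (sigma_pos_count vd' xG xs) kk -At -Bt -kk -Bf.
rewrite kk -Af in Bf *.
have [tpos|tneg|t0] := ltgtP theta 0; last by rewrite t0 eqxx in th0.
- have l1 : (#|A true| <= #|B false|)%N by apply: le; rewrite /sgn_of mulr1 mulrN1 oppr_gt0.
  have l2 : (#|A false| <= #|B true|)%N by apply: le; rewrite /sgn_of mulr1 mulrN1 oppr_gt0.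
  rewrite ltr0_sgz //; lia.
have l1 : (#|A true| <= #|B true|)%N by apply: le; rewrite /sgn_of !mulr1.
have l2 : (#|A false| <= #|B false|)%N by apply: le; rewrite /sgn_of !mulrN1 opprK.
rewrite gtr0_sgz //; lia.
Qed.

End SignatureClass.
End Shift.

(** * From an isomorphism to an orbit *)

Section Forward.
Variables (R : realType) (G : zmodType) (D : gradedDivAlg R G).
Variables (phi0 : {linear D -> D}) (X : G -> D) (f : G) (nu : G -> int).
Variables (xi : GmodT D -> G) (qi : D).
Hypotheses (S : setting phi0 X f) (hxi : cancel xi (@piT R G D)).
Hypothesis (hqi : isoH (homog D 0) -> qi \in homog D 0 /\ qi * qi = -1).
Hypotheses (hnu : sign_character D nu) (hnuf : nu f = -1).
Local Notation K := (inK D).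
Local Notation tau := (tau xi).

Lemma datum_ext (d1 d2 : datum D) : dat_g0 d1 = dat_g0 d2 ->
  dat_kappa d1 =1 dat_kappa d2 -> dat_sigma d1 =1 dat_sigma d2 -> d1 = d2.
Proof.
by case: d1 d2 => [g k s] [g' k' s'] /= -> /funext -> /funext ->.
Qed.

Variables (d d' : datum D).
Hypotheses (vd : valid_datum phi0 X xi d) (vd' : valid_datum phi0 X xi d').
Variables (ms ms' : seq (GmodT D)) (ps ps' : seq (GmodT D * GmodT D)).
Hypotheses (ord : support_ordering d ms ps) (ord' : support_ordering d' ms' ps').

Lemma orbit_of_iso :
  isomorphic (model phi0 X xi qi d ms ps) (model phi0 X xi qi d' ms' ps') ->
  in_action_orbit phi0 X xi d d' \/ in_action_orbit phi0 X xi (nu_twist xi nu d) d'.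
Proof.
case=> F [Fb Fl Fg Finv].
have [cls [pos [pi H]]] := model_description qi vd ord.
have [cls' [pos' [pi' H']]] := model_description qi vd' ord'.
have [i0 _] : exists i0 : 'I_(mx_dim (blocks phi0 X xi qi d ms ps)), true.
  have [[[x xk] _ _ _ _] _] := vd.
  by have [k _] := form_surj H (a := 0%N) (x := x) ltac:(by rewrite lt0n); exists k.
have mxV := mx_inverse_form S hxi hqi vd H.
have mxV' := mx_inverse_form S hxi hqi vd' H'.
have Finv' A : F (form_inverse phi0 X xi qi d ps cls pos pi *m star phi0 A *m
      mx_Phi (blocks phi0 X xi qi d ms ps)) =
    form_inverse phi0 X xi qi d' ps' cls' pos' pi' *m star phi0 (F A) *m
      mx_Phi (blocks phi0 X xi qi d' ms' ps').
  by rewrite -mxV -mxV'; exact: Finv.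
have [psi [g [P [Q [m [omega [[PQ QP [Ph Qh] g0E] [om0 m12 E psiX isom]]]]]]]] :=
  isometry_of_iso S hnu hnuf (form_mulV S hxi hqi vd H)
   (form_Vmul S hxi hqi vd H) (form_mulV S hxi hqi vd' H')
   (form_hermitian S hxi hqi vd ord H) (form_hermitian S hxi hqi vd' ord' H')
   (form_homog S hxi hqi H) (form_homog S hxi hqi H') i0 Fb Fl Fg Finv'.
have [nu1 _] := hnu.
have m_sign t : t \in K -> m t * m t = 1.
  move=> tK; case: m12 => ->; rewrite ?mulr1 //.
  by case: (nu1 t tK) => ->; rewrite ?mulr1 // mulrNN mulr1.
have kS := kappa_shift S hxi H H' PQ QP Ph Qh.
have sS := sigma_shift S hxi vd vd' H H' PQ QP Ph Qh g0E om0 m_sign E psiX isom.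
have g0S := g0_shift g0E.
have eps1 : sgz omega = 1 \/ sgz omega = -1 by case: sgzP om0 => _ //; [left | right].
(* Only the signs of m on K matter, and mu records them: outside the classes with a signature both
   sigma functions vanish, and in those classes t lies in K. *)
have fin (mu : G -> int) : (forall t, t \in K -> sgz (m t) = mu t) ->
    d' = group_act phi0 X xi g (Datum (dat_g0 d) (dat_kappa d)
      (fun x => sgz omega * (mu (tau (dat_g0 d) x) * dat_sigma d x))).
  move=> mu_m; apply: datum_ext => [|x|x] //=.
    by rewrite -kS subrK.
  set y := x - piT D g; have xy : x = y + piT D g by rewrite subrK.
  have [ys|ys] := boolP (inGT (dat_g0 d) y && sig_class phi0 X xi (dat_g0 d) y).
    have [yG yc] := andP ys; have := sS _ yG yc; rewrite -xy => ->.
    rewrite /shift_degree -xy mu_m ?(sig_class_K hxi yG yc) //; ring.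
  rewrite (sigma_eq0 vd ys) !mulr0; apply: (sigma_eq0 vd').
  by rewrite xy g0S inGT_shift (sig_class_shift S hxi).
case: m12 => m1; [left | right]; exists g, (sgz omega); split=> //.
  rewrite (fin (fun _ => 1)) => [|t tK]; last by rewrite m1 // sgz1.
  by congr group_act; apply: datum_ext => // x /=; rewrite mul1r.
rewrite (fin nu) // => t tK; rewrite m1 //.
by case: (nu1 t tK) => ->; rewrite ?sgz1 // mulrN1z sgzN1.
Qed.

End Forward.

(** * The isomorphism attached to an element of the orbit *)

Section Twist.
Variables (R : realType) (G : zmodType) (D : gradedDivAlg R G).
Variables (phi0 : {linear D -> D}) (X : G -> D) (f : G).
Hypothesis S : setting phi0 X f.
Local Notation De := (homog D 0).
Local Notation T := (supp D).
Local Notation K := (inK D).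

(* In the case of a complex identity component K has index 2 in T, and every
   element of T has order at most 2, so a character of K extends to T. *)
Lemma extend_character (nu : G -> int) : sign_character D nu -> exists m : G -> R,
  [/\ forall t, t \in T -> m t = 1 \/ m t = -1, {in T &, {morph m : s t / s + t >-> s * t}}
    & forall t, t \in K -> m t = (nu t)%:~R].
Proof.
case=> nu1 nuM; have sgn t : t \in K -> (nu t)%:~R = 1 :> R \/ (nu t)%:~R = -1 :> R.
  by case/nu1 => ->; [left | right].
have morph s t : s \in K -> t \in K -> (nu (s + t))%:~R = (nu s)%:~R * (nu t)%:~R :> R.
  by move=> sK tK; rewrite nuM // intrM.
have [hC|nC] := boolP (isoC De); last first.
  exists (fun t => (nu t)%:~R); split=> // [t|s t]; rewrite -?(notC_K _ (negPf nC)).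
    exact: sgn.
  exact: morph.
have [w wT wK] := exists_notK S hC; have [ww _] := X_square S wT.
have tw t : t \in T -> t \notin K -> t + w \in K by move=> tT tK; apply: (notK_add S).
have mixed s t : s \in K -> t \notin K -> s + t \notin K.
  move=> sK; apply: contraNN => stK.
  by rewrite -[t](addKr s) (oppT S (inK_T sK)); exact: (inKD S sK stK).
exists (fun t => (nu (if t \in K then t else t + w))%:~R); split=> [t tT|s t sT tT|t ->//].
  by case: ifPn => tK; apply: sgn => //; apply: tw.
have [sK|sK] := boolP (s \in K); have [tK|tK] := boolP (t \in K).
- by rewrite (inKD S sK tK) morph.
- by rewrite (negPf (mixed _ _ sK tK)) -addrA; apply: morph => //; apply: tw.
- rewrite addrC (negPf (mixed _ _ tK sK)) -addrA [RHS]mulrC.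
  by apply: morph => //; apply: tw.
rewrite (notK_add S) // -morph ?tw //; congr ((nu _)%:~R).
by rewrite addrACA ww addr0.
Qed.

Variable m : G -> R.
Hypotheses (m_sign : forall t, t \in T -> m t = 1 \/ m t = -1)
  (mM : {in T &, {morph m : s t / s + t >-> s * t}}).

Lemma m_sqr t : t \in T -> m t * m t = 1.
Proof. by case/m_sign => ->; rewrite ?mulr1 // mulrNN mulr1. Qed.

(** The automorphism of D dual to the character m of T. *)
Definition twist (d : D) : D := \sum_(t <- supp_seq D) m t *: hproj t d.

Lemma twist_linear : linear twist.
Proof.
move=> k a b; rewrite /twist scaler_sumr -big_split; apply: eq_bigr => t _ /=.
by rewrite linearP scalerDr !scalerA mulrC.
Qed.

Lemma twist_homog t d : d \in homog D t -> twist d = m t *: d.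
Proof.
move=> dt; have [->|d0] := eqVneq d 0.
  by rewrite scaler0 /twist big1 // => s _; rewrite linear0 scaler0.
have tT : t \in supp_seq D by rewrite mem_supp_seq; apply/suppP; exists d.
rewrite /twist (bigD1_seq t) ?supp_seq_uniq //= hproj_id // big1 ?addr0 // => s st.
by rewrite (hproj_other dt st) scaler0.
Qed.

Lemma twistD a b : twist (a + b) = twist a + twist b.
Proof. by have := twist_linear 1 a b; rewrite !scale1r. Qed.

Lemma twist0 : twist 0 = 0.
Proof. by rewrite (twist_homog (mem0v (homog D 0))) scaler0. Qed.

Lemma twistM : {morph twist : a b / a * b}.
Proof.
move=> a b; move: a; apply: homog_ind => [|a a' ha ha'|s a sT as_].
- by rewrite mul0r twist0 mul0r.
- by rewrite mulrDl !twistD ha ha' mulrDl.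
move: b; apply: homog_ind => [|b b' hb hb'|t b tT bt].
- by rewrite mulr0 twist0 mulr0.
- by rewrite mulrDr !twistD hb hb' mulrDr.
rewrite (twist_homog (homogM as_ bt)) (twist_homog as_) (twist_homog bt) mM //.
by rewrite -scalerAl -scalerAr scalerA.
Qed.

Lemma twistK d : twist (twist d) = d.
Proof.
elim/homog_ind: d => [|a b ha hb|t a tT at_]; rewrite ?twist0 //.
  by rewrite !twistD ha hb.
by rewrite (twist_homog at_) (twist_homog (memvZ _ at_)) scalerA m_sqr // scale1r.
Qed.

Lemma m0 : m 0 = 1.
Proof. by have := mM (supp0 D) (supp0 D); rewrite addr0 m_sqr // supp0. Qed.

Lemma twist_endo : graded_endo twist.
Proof.
split; [exact: twist_linear | exact: twistM | | |].
- by rewrite (twist_homog (homog1 D)) m0 scale1r.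
- by move=> t d dt; rewrite (twist_homog dt) memvZ.
by move=> d d0; rewrite -[d]twistK d0 twist0.
Qed.

Lemma twist_phi d : twist (phi0 d) = phi0 (twist d).
Proof.
elim/homog_ind: d => [|a b ha hb|t a tT at_]; first by rewrite linear0 twist0 linear0.
  by rewrite linearD !twistD ha hb linearD.
by rewrite (twist_homog at_) (twist_homog (phi_homog (set_inv S) at_)) linearZ.
Qed.

End Twist.

(** Reversing the positions carries the first p rows to the last p, which is how rows of opposite
    sign are matched. *)
Definition flip (b : bool) (k a : nat) : nat := if b then (k.-1 - a)%N else a.

Lemma flip_lt b k a : (a < k)%N -> (flip b k a < k)%N.
Proof. by rewrite /flip; case: b => // ak; lia. Qed.

Lemma flipK b k a : (a < k)%N -> flip b k (flip b k a) = a.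
Proof. by rewrite /flip; case: b => // ak; lia. Qed.

Lemma flip_ltn k a p q : (a < k)%N -> (p + q = k)%N ->
  (flip true k a < p)%N = ~~ (a < q)%N.
Proof.
move=> ak e; rewrite -e in ak *; rewrite /flip; case: (ltnP a q) => aq /=; last lia.
by apply/negbTE; rewrite -leqNgt; lia.
Qed.

Lemma flip_half h k a : h.*2 = k -> (a < k)%N -> (flip true k a < h)%N = ~~ (a < h)%N.
Proof. by move=> hk ak; apply: flip_ltn; rewrite // addnn. Qed.

Lemma double_sub_eq (p q k : nat) :
  p%:Z *+ 2 - k%:Z = 1 * (q%:Z *+ 2 - k%:Z) -> p = q.
Proof. by lia. Qed.

Lemma double_sub_opp (p q k : nat) :
  p%:Z *+ 2 - k%:Z = -1 * (q%:Z *+ 2 - k%:Z) -> (q + p = k)%N.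
Proof. by rewrite mulN1r; lia. Qed.

(** * Matching the blocks of one self-dual class *)

Section ClassData.
Variables (R : realType) (G : zmodType) (D : gradedDivAlg R G).
Variables (phi0 : {linear D -> D}) (X : G -> D) (f : G) (xi : GmodT D -> G) (qi : D).
Hypotheses (S : setting phi0 X f) (hxi : cancel xi (@piT R G D)).
Hypothesis (hqi : isoH (homog D 0) -> qi \in homog D 0 /\ qi * qi = -1).
Local Notation De := (homog D 0).
Local Notation T := (supp D).
Local Notation K := (inK D).
Local Notation eta := (etaX phi0 X).
Local Notation tau := (tau xi).
Local Notation sigc := (sig_class phi0 X xi).
Local Notation symc := (sym_class phi0 X xi).
Variables (d d' : datum D) (ps ps' : seq (GmodT D * GmodT D)).
Hypotheses (vd : valid_datum phi0 X xi d) (vd' : valid_datum phi0 X xi d').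
Variables (g : G) (w : R) (m : G -> R).
Hypotheses (w_sign : w = 1 \/ w = -1) (m_sign : forall t, t \in T -> m t = 1 \/ m t = -1).
Hypothesis g0S : dat_g0 d' = dat_g0 d - g *+ 2.
Hypothesis kS : forall y, dat_kappa d' (y + piT D g) = dat_kappa d y.
Hypothesis sS : forall y, inGT (dat_g0 d) y -> sigc (dat_g0 d) y ->
  let t := tau (dat_g0 d) y in let u := shift_degree xi g y in
  dat_sigma d' (y + piT D g) =
    eta u * real_sign ((X (t + u *+ 2))^-1 * X u * X t * X u) *
    (sgz w * (sgz (m t) * dat_sigma d y)).

Variable y : GmodT D.
Hypothesis yG : inGT (dat_g0 d) y.
Local Notation x := (y + piT D g).
Local Notation t := (tau (dat_g0 d) y).
Local Notation u := (shift_degree xi g y).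
Local Notation kap := (dat_kappa d y).

Let xG : inGT (dat_g0 d') x. Proof. by rewrite g0S inGT_shift. Qed.
Let tT : t \in T. Proof. by rewrite -(tau_supp hxi). Qed.
Let uT : u \in T. Proof. exact: shift_degree_T. Qed.
Let tE : tau (dat_g0 d') x = t. Proof. by rewrite g0S (tau_shift S hxi). Qed.
Let sigE : sigc (dat_g0 d') x = sigc (dat_g0 d) y.
Proof. by rewrite g0S (sig_class_shift S hxi). Qed.
Let symE : symc (dat_g0 d') x = symc (dat_g0 d) y.
Proof. by rewrite g0S (sym_class_shift S hxi). Qed.

(** The isometry condition on one class: p rescales the rows and [flip b] permutes them. The factor
    w is that of the isometry, and m(t) comes from applying the automorphism psi to a coefficient of
    degree t. *)
Definition solution (p : D) (b : bool) : Prop :=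
  [/\ p \in homog D u, p != 0 & forall a, (a < kap)%N ->
     phi0 p * coef phi0 X xi qi d' ps' (x, a) * p =
     (w * m t) *: coef phi0 X xi qi d ps (y, flip b kap a)].

(** The choice p = X_u / sqrt |rho| solves the equation up to the sign s, and the flip has to supply
    that sign. *)
Lemma solution_signed (e e' : nat -> R) : t \in K ->
  (forall a, (a < kap)%N -> coef phi0 X xi qi d ps (y, a) = e a *: X t) ->
  (forall a, (a < kap)%N -> coef phi0 X xi qi d' ps' (x, a) = e' a *: X t) ->
  (forall rho : R, rho != 0 ->
    real_sign ((X (t + u *+ 2))^-1 * X u * X t * X u) = sgz rho ->
    let s := (eta u)%:~R * Num.sg rho * (w * m t) in
    exists b, forall a, (a < kap)%N -> e (flip b kap a) = s * e' a) ->
  exists p b, solution p b.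
Proof.
move=> tK cE cE' signs; have [rho rho0 [rhoE rs]] := conjugate_factor S tK uT.
have [b be] := signs rho rho0 rs.
pose z := (Num.sqrt `|rho|)^-1.
have z0 : z != 0 by rewrite invr_eq0 sqrtr_eq0 -ltNge normr_gt0.
have zz : z * z * rho = Num.sg rho.
  rewrite /z -invfM -expr2 sqr_sqrtr // [X in _ * X]numEsg mulrCA mulVf ?mulr1 //.
  by rewrite normr_eq0.
have wm : w * m t * (w * m t) = 1.
  by case: w_sign => ->; case: (m_sign tT) => ->; rewrite ?(mulr1, mulrN1, opprK).
exists (z *: X u), b; split.
- by rewrite memvZ // (X_homog S).
- by rewrite scaler_eq0 negb_or z0 (X_neq0 S).
move=> a ak; have bk := flip_lt b ak.
rewrite cE' // cE // be // linearZ /= (etaE S uT) scalerA.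
rewrite -!(scalerAr, scalerAl).
have -> : X u * X t * X u = rho *: X t by [].
rewrite !scalerA; congr (_ *: _).
set sr := Num.sg rho in zz *; set et := (eta u)%:~R : R.
rewrite !mulrA -[w * m t * et]mulrA; transitivity (z * z * rho * et * e' a); first ring.
rewrite zz; transitivity (sr * et * e' a * (w * m t * (w * m t))); last ring.
by rewrite wm mulr1.
Qed.

Lemma coef_sig a : sigc (dat_g0 d) y ->
  coef phi0 X xi qi d ps (y, a) = sgn_of R (a < pos_count d y)%N *: X t.
Proof. by move=> ys; rewrite /coef yG ys sgn_ofE -scalerAr mulr1. Qed.

Lemma coef_sig' a : sigc (dat_g0 d) y ->
  coef phi0 X xi qi d' ps' (x, a) = sgn_of R (a < pos_count d' x)%N *: X t.
Proof. by move=> ys; rewrite /coef xG sigE ys sgn_ofE -scalerAr mulr1 tE. Qed.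

Lemma coef_sym a : symc (dat_g0 d) y ->
  coef phi0 X xi qi d ps (y, a) = sgn_of R (a < kap./2)%N *: X t.
Proof.
move=> ys; case/andP: (ys) => /negPf nys _.
by rewrite /coef yG nys ys sgn_ofE -scalerAr mulr1.
Qed.

Lemma coef_sym' a : symc (dat_g0 d) y ->
  coef phi0 X xi qi d' ps' (x, a) = sgn_of R (a < kap./2)%N *: X t.
Proof.
move=> ys; case/andP: (ys) => /negPf nys _.
by rewrite /coef xG sigE symE nys ys sgn_ofE -scalerAr mulr1 tE kS.
Qed.

Lemma sign_product (rho : R) : rho != 0 ->
  (eta u)%:~R * Num.sg rho * (w * m t) = 1 \/ (eta u)%:~R * Num.sg rho * (w * m t) = -1.
Proof.
move=> rho0; have sg : Num.sg rho = 1 \/ Num.sg rho = -1.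
  by case: sgrP rho0 => _; rewrite ?eqxx //; [left | right].
case: (eta_sign phi0 X u) => ->; case: sg => ->; case: w_sign => ->;
  case: (m_sign tT) => ->; rewrite ?(mulr1, mulrN1, mul1r, mulN1r, opprK); tauto.
Qed.

(** By [sS] the signature is multiplied by s. For s = 1 the two classes have equally many positive
    rows; for s = -1 the positive rows of one are as many as the negative rows of the other, and
    reversal exchanges them. *)
Lemma solution_sig : sigc (dat_g0 d) y -> exists p b, solution p b.
Proof.
move=> ys; have tK := sig_class_K hxi yG ys.
apply: (solution_signed tK (fun a _ => coef_sig a ys) (fun a _ => coef_sig' a ys)).
move=> rho rho0 rs; set s := _ * (w * m t).
have sE : dat_sigma d' x = sgz s * dat_sigma d y.
  rewrite (sS yG ys) rs /s !sgzM sgz_sgr; set a := sgz rho.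
  have -> : sgz ((eta u)%:~R : R) = eta u.
    by case: (eta_sign phi0 X u) => ->; rewrite ?sgz1 // mulrN1z sgzN1.
  ring.
have xs : sigc (dat_g0 d') x by rewrite sigE.
have := sigma_pos_count vd yG ys; have := sigma_pos_count vd' xG xs.
rewrite kS sE; move=> e' e; case: (sign_product rho0); rewrite -/s => s1.
  exists false => a ak; rewrite s1 mul1r /flip.
  by move: e'; rewrite s1 sgz1 e => /esym/double_sub_eq ->.
exists true => a ak; rewrite s1 mulN1r.
have -> : (flip true kap a < pos_count d y)%N = ~~ (a < pos_count d' x)%N.
  move: e'; rewrite s1 sgzN1 e => /esym/double_sub_opp pk.
  exact: flip_ltn.
by case: (_ < _)%N; rewrite /sgn_of /= ?opprK.
Qed.

(** The two halves have equal size and opposite signs, so reversal realizes s = -1 without any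
    condition. *)
Lemma solution_sym : t \in K -> symc (dat_g0 d) y -> exists p b, solution p b.
Proof.
move=> tK ys; have ke := kappa_even vd yG ys.
apply: (solution_signed tK (fun a _ => coef_sym a ys) (fun a _ => coef_sym' a ys)).
move=> rho rho0 rs; set s := _ * (w * m t).
case: (sign_product rho0); rewrite -/s => s1.
  by exists false => a ak; rewrite s1 mul1r.
exists true => a ak; rewrite s1 mulN1r (flip_half ke) //.
by case: (_ < _)%N; rewrite /sgn_of /= ?opprK.
Qed.

(** As X_t conjugates D_e, passing from X_u to X_u z multiplies the result by the square of phi0(z)
    and not by a positive norm. Every scalar of C is a square, so neither flip nor signature is
    needed. *)
Lemma solution_complex : t \notin K -> exists p b, solution p b.
Proof.
move=> tK; have hC := notK_C tT tK.
have ys : sigc (dat_g0 d) y = false.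
  have nH : isoH De = false by apply/negP => /isoH_notC; rewrite hC.
  by rewrite /sig_class hC (isoC_notR hC) nH (negPf tK).
have XXh : X u * X t * X u \in homog D t.
  apply: homog_eq (homogM (homogM (X_homog S uT) (X_homog S tT)) (X_homog S uT)) _.
  by rewrite -{1}(oppT S uT); abelian.
have [c cD cE] := homog_X S tT XXh.
have c0 : c != 0.
  apply/eqP => c0; have := homog_neq0M (homogM (X_homog S uT) (X_homog S tT))
    (homog_neq0M (X_homog S uT) (X_neq0 S uT) (X_neq0 S tT)) (X_neq0 S uT).
  by rewrite cE c0 mul0r eqxx.
have cU := homog_unit cD c0.
have cVD := De_inv cD c0.
have [v vD vE] := isoC_sqrt hC (memvZ (w * m t * (eta u)%:~R) cVD).
pose z := phi0 v; have zD : z \in De by exact: phi_homog (set_inv S) _ _ vD.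
have pz : phi0 z = v by rewrite /z (phiK (set_inv S)).
have e0 : w * m t * (eta u)%:~R != 0 :> R.
  by case: w_sign => ->; case: (m_sign tT) => ->; case: (eta_sign phi0 X u) => ->;
    rewrite ?(mulr1, mulrN1, mul1r, mulN1r, opprK, oppr_eq0) oner_neq0.
have v0 : v != 0.
  apply/eqP => v0; move/eqP: vE; rewrite v0 mul0r eq_sym scaler_eq0 (negPf e0) /=.
  by rewrite invr_eq0 (negPf c0).
have z0 : z != 0 by rewrite /z (phi_eq0 (set_inv S)).
have ee : (eta u)%:~R * (eta u)%:~R = 1 :> R.
  by case: (eta_sign phi0 X u) => ->; rewrite ?mulr1 // mulrNN mulr1.
have main : phi0 (X u * z) * X t * (X u * z) = (w * m t) *: X t.
  rewrite (phiM (set_inv S)) pz (etaE S uT) -!(scalerAr, scalerAl).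
  rewrite -!mulrA [X u * (X t * _)]mulrA [X u * X t * _]mulrA cE -mulrA (X_conj S tT tK zD) pz.
  rewrite !mulrA (isoC_comm hC vD cD) -[c * v * v]mulrA vE -scalerAr divrr //.
  rewrite -scalerAl mul1r scalerA; congr (_ *: _).
  by rewrite mulrA [_ * (w * m t)]mulrC -mulrA ee mulr1.
exists (X u * z), false; split.
- by have := homogM (X_homog S uT) zD; rewrite addr0.
- exact: homog_neq0M (X_homog S uT) (X_neq0 S uT) z0.
move=> a ak; rewrite /flip.
have [xy|xy] := boolP (symc (dat_g0 d) y).
  rewrite coef_sym // coef_sym' // -scalerAr -scalerAl main !scalerA.
  by congr (_ *: _); rewrite mulrC.
by rewrite /coef yG xG sigE symE ys (negPf xy) hC tE main.
Qed.

(** phi0(z) qi z = lam qi is solvable for both signs of lam: by a real z if lam > 0, and by a real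
    multiple of an element j anticommuting with [qi] if lam < 0, where phi0(j) qi j = -N qi for the
    norm N of j. *)
Lemma solution_quaternion : isoC De = false -> sigc (dat_g0 d) y = false ->
  symc (dat_g0 d) y = false -> exists p b, solution p b.
Proof.
move=> nC ys yy; have tK : t \in K by rewrite notC_K.
have uK : u \in K by rewrite notC_K.
have hH : isoH De.
  case/or3P: (Frobenius D) => // [hR|]; last by rewrite nC.
  move: ys yy; rewrite /sym_class /sig_class hR nC /=.
  by case: (eta_sign phi0 X t) => ->.
have [qD q2] := hqi hH; have [rho rho0 [rhoE _]] := conjugate_factor S tK uT.
pose lam : R := w * m t * (eta u)%:~R / rho.
have l0 : lam != 0.
  rewrite /lam mulf_neq0 ?invr_eq0 //.
  by case: w_sign => ->; case: (m_sign tT) => ->; case: (eta_sign phi0 X u) => ->;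
    rewrite ?(mulr1, mulrN1, mul1r, mulN1r, opprK, oppr_eq0) oner_neq0.
have [z [zD z0 zE]] : exists z, [/\ z \in De, z != 0 & phi0 z * qi * z = lam *: qi].
  have [lpos|lneg|] := ltgtP lam 0; last by move/eqP; rewrite (negPf l0).
    have [j jD [j0 jq]] := quaternion_anticommute hH qD q2.
    have [N N0 NE] := De_norm (set_conj S) jD j0.
    pose s := Num.sqrt (- lam / N).
    have q0 : 0 < - lam / N by rewrite divr_gt0 // oppr_gt0.
    exists (s *: j); split; first exact: memvZ.
      by rewrite scaler_eq0 negb_or j0 sqrtr_eq0 -ltNge q0.
    rewrite linearZ /= -!(scalerAl, scalerAr) -mulrA.
    have -> : qi * j = - (j * qi) by rewrite jq opprK.
    rewrite mulrN mulrA NE -scalerAl mul1r !scalerN !scalerA -scaleNr; congr (_ *: _).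
    rewrite -expr2 sqr_sqrtr ?ltW //; field.
    by rewrite gt_eqF.
  exists (Num.sqrt lam)%:A; split; first exact: De_real.
    by rewrite scaler_eq0 oner_eq0 orbF sqrtr_eq0 -ltNge.
  rewrite (phi_real (set_inv S)) -!(scalerAl, scalerAr) mul1r mulr1 scalerA -expr2.
  by rewrite sqr_sqrtr ?ltW.
exists (X u * z), false; split.
- by have := homogM (X_homog S uT) zD; rewrite addr0.
- exact: homog_neq0M (X_homog S uT) (X_neq0 S uT) z0.
move=> a ak; rewrite /flip /coef yG xG sigE symE ys yy nC tE.
rewrite (phiM (set_inv S)) (etaE S uT) -!(scalerAr, scalerAl).
have pzD : phi0 z \in De by exact: phi_homog (set_inv S) _ _ zD.
have -> : phi0 z * X u * (X t * qi) * (X u * z) = rho *: (lam *: (X t * qi)).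
  transitivity (phi0 z * (X u * X t * X u) * (qi * z)).
    by rewrite -!mulrA [qi * (X u * z)]mulrA -(X_commute S uK qD) -!mulrA.
  rewrite rhoE -scalerAr -scalerAl; congr (_ *: _).
  by rewrite -(X_commute S tK pzD) -mulrA [phi0 z * _]mulrA zE scalerAr.
rewrite !scalerA; congr (_ *: _); rewrite /lam.
have ee : (eta u)%:~R * (eta u)%:~R = 1 :> R.
  by case: (eta_sign phi0 X u) => ->; rewrite ?mulr1 // mulrNN mulr1.
move: ee; set e1 : R := (eta u)%:~R; move=> ee.
by rewrite -[RHS]mulr1 -{1}ee; field.
Qed.

Lemma solution_exists : exists p b, solution p b.
Proof.
have [tK|] := boolP (t \in K); last exact: solution_complex.
have [ys|ys] := boolP (sigc (dat_g0 d) y); first exact: solution_sig.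
have [yy|yy] := boolP (symc (dat_g0 d) y); first exact: solution_sym.
apply: solution_quaternion; apply/negbTE => //.
by apply: contra ys => hC; rewrite /sig_class hC tK orbT.
Qed.

End ClassData.

(** * Isomorphisms given by monomial matrices *)

Section MonomialIsomorphism.
Variables (R : realType) (G : zmodType) (D : gradedDivAlg R G) (phi0 : {linear D -> D}).
Hypothesis hphi0 : degree_preserving_involution phi0.
Variables (psi : D -> D) (w : R).
Hypotheses (E : graded_endo psi) (psiK : involutive psi)
  (psi_phi : forall a, psi (phi0 a) = phi0 (psi a)) (w0 : w != 0).
Variables (n n' : nat) (r : 'I_n' -> 'I_n) (r_inv : 'I_n -> 'I_n').
Hypotheses (rK : cancel r r_inv) (r_invK : cancel r_inv r).
Variables (q : 'I_n' -> D) (deg : 'I_n -> G) (deg' : 'I_n' -> G) (g : G).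
Hypotheses (q_homog : forall k, q k \in homog D (- deg' k + g + deg (r k)))
  (q_neq0 : forall k, q k != 0).

(** This is P psi(A) P^-1 for the monomial matrix P with entry q k at (k, r k). *)
Definition monomial_map (A : 'M[D]_n) : 'M[D]_n' :=
  \matrix_(k, l) (q k * psi (A (r k) (r l)) * (q l)^-1).

Let q_unit k : q k \is a GRing.unit. Proof. exact: homog_unit (q_homog k) (q_neq0 k). Qed.

Lemma monomial_mapD : {morph monomial_map : A B / A + B}.
Proof.
by move=> A B; apply/matrixP => k l; rewrite !mxE (endoD E) mulrDr mulrDl.
Qed.

Lemma monomial_map0 : monomial_map 0 = 0.
Proof. by apply/matrixP => k l; rewrite !mxE (endo0 E) mulr0 mul0r. Qed.

Lemma monomial_map1 : monomial_map 1%:M = 1%:M.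
Proof.
apply/matrixP => k l; rewrite !mxE (inj_eq (can_inj rK)).
by case: eqP => [->|_]; rewrite ?(endo1 E) ?(endo0 E) ?mulr1 ?mulr0 ?mul0r ?divrr.
Qed.

Lemma monomial_mapM : {morph monomial_map : A B / A *m B >-> A *m B}.
Proof.
move=> A B; apply/matrixP => k l; rewrite !mxE.
have -> : psi (\sum_j A (r k) j * B j (r l)) = \sum_j psi (A (r k) j * B j (r l)).
  by elim/big_rec2: _ => [|j u v _ <-]; rewrite ?(endo0 E) ?(endoD E).
rewrite mulr_sumr mulr_suml (reindex r) /=; last first.
  by exists r_inv => j _; [exact: rK | exact: r_invK].
by apply: eq_bigr => j _; rewrite !mxE (endoM E) !mulrA mulrVK.
Qed.

Lemma monomial_map_bij : bijective monomial_map.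
Proof.
exists (fun B : 'M[D]_n' => \matrix_(i, j)
  psi ((q (r_inv i))^-1 * B (r_inv i) (r_inv j) * q (r_inv j))) => A; apply/matrixP => k l.
  by rewrite !mxE !r_invK !mulrA mulVr // mul1r mulrVK // psiK.
by rewrite !mxE !rK psiK !mulrA mulrV // mul1r mulrK.
Qed.

Variables (c : 'I_n -> D) (c' : 'I_n' -> D) (pi : 'I_n -> 'I_n) (pi' : 'I_n' -> 'I_n').
Hypotheses (piK : involutive pi) (piK' : involutive pi').
Hypotheses (c_unit : forall k, c k \is a GRing.unit)
  (c_unit' : forall k, c' k \is a GRing.unit).
Hypothesis r_pi : forall k, r (pi' k) = pi (r k).
Hypothesis intertwine : forall k, phi0 (q k) * c' k * q (pi' k) = w *: psi (c (r k)).

Lemma monomial_involution m (e : 'I_m -> D) (rho : 'I_m -> 'I_m) (V Phi A : 'M[D]_m) :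
  involutive rho -> (forall k l, V k l = if k == rho l then (e l)^-1 else 0) ->
  (forall k l, Phi k l = if l == rho k then e k else 0) ->
  forall k l, (V *m map_mx phi0 A^T *m Phi) k l =
    (e (rho k))^-1 * phi0 (A (rho l) (rho k)) * e (rho l).
Proof.
move=> rhoK VE PhiE k l; rewrite mxE (bigD1 (rho l)) //= big1 => [|i il]; last first.
  by rewrite PhiE -(inj_eq (inv_inj rhoK)) rhoK eq_sym (negPf il) mulr0.
rewrite addr0 PhiE rhoK eqxx mxE (bigD1 (rho k)) //= big1 => [|i il]; last first.
  by rewrite VE -(inj_eq (inv_inj rhoK)) rhoK eq_sym (negPf il) mul0r.
by rewrite addr0 VE rhoK eqxx !mxE.
Qed.

(** The hypothesis [intertwine] is the isometry condition star P Phi' P = w psi(Phi), entry by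
    entry. The real factor w cancels between the form and its inverse. *)
Lemma monomial_isomorphic (V Phi : 'M[D]_n) (V' Phi' : 'M[D]_n') :
  (forall k l, V k l = if k == pi l then (c l)^-1 else 0) ->
  (forall k l, Phi k l = if l == pi k then c k else 0) ->
  (forall k l, V' k l = if k == pi' l then (c' l)^-1 else 0) ->
  (forall k l, Phi' k l = if l == pi' k then c' k else 0) ->
  isomorphic
    (@GradedInvMx R G D n (fun h A => forall i j, A i j \in homog D (- deg i + h + deg j))
       (fun A => V *m map_mx phi0 A^T *m Phi))
    (@GradedInvMx R G D n' (fun h A => forall i j, A i j \in homog D (- deg' i + h + deg' j))
       (fun A => V' *m map_mx phi0 A^T *m Phi')).
Proof.
move=> VE PhiE VE' PhiE'.
pose F : {rmorphism 'M[D]_n -> 'M[D]_n'} := HB.pack monomial_map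
  (Algebra.isNmodMorphism.Build _ _ monomial_map (conj monomial_map0 monomial_mapD))
  (GRing.isMonoidMorphism.Build _ _ monomial_map (conj monomial_map1 monomial_mapM)).
exists F; split=> /=.
- exact: monomial_map_bij.
- move=> k A; apply/matrixP => i j; rewrite !mxE mulr_algl (endoZ E) mulr_algl.
  by rewrite -scalerAr -scalerAl.
- move=> h A Ah i j; rewrite mxE.
  apply: homog_eq (homogM (homogM (q_homog i) (endo_homog E (Ah (r i) (r j))))
    (homogV (q_homog j) (q_neq0 j))) _.
  abelian.
have FE A k l : F A k l = q k * psi (A (r k) (r l)) * (q l)^-1 by rewrite mxE.
move=> A; apply/matrixP => k l; rewrite (monomial_involution _ piK' VE' PhiE') !FE.
rewrite (monomial_involution _ piK VE PhiE) !(phiM hphi0) -!r_pi !(endoM E) psi_phi.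
have qU i : phi0 (q i) \is a GRing.unit.
  by apply: homog_unit (phi_homog hphi0 (q_homog i)) _; rewrite (phi_eq0 hphi0).
have psiU i : psi (c (r i)) \is a GRing.unit.
  by apply/unitrP; exists (psi (c (r i))^-1); rewrite -!(endoM E) ?mulVr ?mulrV ?(endo1 E).
have psiV i : psi (c (r i))^-1 = (psi (c (r i)))^-1.
  by apply: (mulIr (psiU i)); rewrite mulVr // -(endoM E) mulVr ?(endo1 E).
have phiV i : phi0 (q i)^-1 = (phi0 (q i))^-1.
  by apply: (mulIr (qU i)); rewrite mulVr // -(phiM hphi0) mulrV ?(phi1 hphi0).
have inter' i : phi0 (q (pi' i)) * c' (pi' i) * q i = w *: psi (c (r (pi' i))).
  by rewrite -intertwine piK'.
have right i : psi (c (r (pi' i))) * (q i)^-1 = w^-1 *: (phi0 (q (pi' i)) * c' (pi' i)).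
  apply: (mulIr (q_unit i)); rewrite mulrVK // -scalerAl inter' scalerA.
  by rewrite mulVf // scale1r.
have left i : q i * (psi (c (r (pi' i))))^-1 = w *: ((c' (pi' i))^-1 * (phi0 (q (pi' i)))^-1).
  apply: (mulIr (psiU (pi' i))); rewrite mulrVK // -scalerAl scalerAr -inter' !mulrA.
  by rewrite mulrVK // mulVr // mul1r.
rewrite psiV phiV !mulrA left -!mulrA right -!(scalerAl, scalerAr) scalerA.
by rewrite mulfV // scale1r !mulrA.
Qed.

End MonomialIsomorphism.

(** Reversal commutes with the exchange of the two halves, so it is compatible with [partner] on
    skew classes. *)
Lemma flip_swap h k b a : h.*2 = k -> (a < k)%N ->
  flip b k (if a < h then a + h else a - h)%N =
  (if flip b k a < h then flip b k a + h else flip b k a - h)%N.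
Proof.
move=> <-; rewrite /flip; case: b => // ak.
case: (ltnP a h) => ah; case: ifP => fh; move: ak fh; lia.
Qed.

(** * Gluing the choices over all classes *)

Section GluedClassData.
Variables (R : realType) (G : zmodType) (D : gradedDivAlg R G).
Variables (phi0 : {linear D -> D}) (X : G -> D) (f : G) (xi : GmodT D -> G) (qi : D).
Hypotheses (S : setting phi0 X f) (hxi : cancel xi (@piT R G D)).
Hypothesis (hqi : isoH (homog D 0) -> qi \in homog D 0 /\ qi * qi = -1).
Local Notation T := (supp D).
Variables (d d' : datum D).
Variables (ms ms' : seq (GmodT D)) (ps ps' : seq (GmodT D * GmodT D)).
Hypotheses (vd : valid_datum phi0 X xi d) (vd' : valid_datum phi0 X xi d').
Hypotheses (ord : support_ordering d ms ps) (ord' : support_ordering d' ms' ps').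
Variables (g : G) (w : R) (m : G -> R).
Hypotheses (w_sign : w = 1 \/ w = -1) (m_sign : forall t, t \in T -> m t = 1 \/ m t = -1).
Hypothesis (mM : {in T &, {morph m : s t / s + t >-> s * t}}).
Hypothesis g0S : dat_g0 d' = dat_g0 d - g *+ 2.
Hypothesis kS : forall y, dat_kappa d' (y + piT D g) = dat_kappa d y.
Hypothesis sS : forall y, inGT (dat_g0 d) y -> sig_class phi0 X xi (dat_g0 d) y ->
  let t := tau xi (dat_g0 d) y in let u := shift_degree xi g y in
  dat_sigma d' (y + piT D g) =
    etaX phi0 X u * real_sign ((X (t + u *+ 2))^-1 * X u * X t * X u) *
    (sgz w * (sgz (m t) * dat_sigma d y)).

Local Arguments coef : simpl never.
Local Notation kappa := (dat_kappa d).
Local Notation part := (partner phi0 X xi d).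
Local Notation part' := (partner phi0 X xi d').
Local Notation c := (coef phi0 X xi qi d ps).
Local Notation c' := (coef phi0 X xi qi d' ps').
Local Notation u := (shift_degree xi g).
Local Notation dual := (dual_class (dat_g0 d)).

Let w0 : w != 0.
Proof. by case: w_sign => ->; rewrite ?oppr_eq0 oner_neq0. Qed.

Let uT y : u y \in T. Proof. exact: shift_degree_T. Qed.

(* On a pair of dual classes the first factor is arbitrary and determines the other. *)
Lemma dual_solution y : inGT (dat_g0 d) y = false -> kappa y != 0%N ->
  y \in [seq p.1 | p <- ps] ->
  let z := (phi0 (X (u y)) * c' (y + piT D g, 0%N))^-1 * (w *: twist m (c (y, 0%N))) in
  [/\ z \in homog D (u (dual y)), z != 0,
    phi0 (X (u y)) * c' (y + piT D g, 0%N) * z = w *: twist m (c (y, 0%N))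
  & phi0 z * c' (dual y + piT D g, 0%N) * X (u y) = w *: twist m (c (dual y, 0%N))].
Proof.
move=> yG yk yf z.
have xG : inGT (dat_g0 d') (y + piT D g) = false by rewrite g0S inGT_shift.
have dE : dual_class (dat_g0 d') (y + piT D g) = dual y + piT D g.
  by rewrite g0S dual_class_shift.
have ph := phi_homog (set_inv S) (X_homog S (uT y)).
have pE : part (y, 0%N) = (dual y, 0%N) by rewrite /partner yG.
have pE' : part' (y + piT D g, 0%N) = (dual y + piT D g, 0%N) by rewrite /partner xG dE.
have ch : c (y, 0%N) \in homog D (dat_g0 d + xi y + xi (dual y)).
  by have := coef_homog S hxi hqi d ps (y, 0%N); rewrite pE.
have ch' : c' (y + piT D g, 0%N) \in homog D
    (dat_g0 d' + xi (y + piT D g) + xi (dual y + piT D g)).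
  by have := coef_homog S hxi hqi d' ps' (y + piT D g, 0%N); rewrite pE'.
have ah := homogM ph ch'.
have a0 : phi0 (X (u y)) * c' (y + piT D g, 0%N) != 0.
  apply: homog_neq0M ph _ (coef_neq0 S hxi hqi _ _ _).
  by rewrite (phi_eq0 (set_inv S)) (X_neq0 S).
have aU := homog_unit ah a0.
have tc0 : w *: twist m (c (y, 0%N)) != 0.
  rewrite scaler_eq0 negb_or w0; apply: contra (coef_neq0 S hxi hqi d ps (y, 0%N)).
  by move=> /eqP e; apply/eqP/(endo_inj (twist_endo m_sign mM)).
have zE : phi0 (X (u y)) * c' (y + piT D g, 0%N) * z = w *: twist m (c (y, 0%N)).
  by rewrite /z mulVKr.
split=> //.
- have zh := homogM (homogV ah a0) (memvZ w (endo_homog (twist_endo m_sign mM) ch)).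
  apply: homog_eq zh _; have [uu _] := X_square S (uT y).
  rewrite -[RHS](oppT S (uT (dual y))) -[RHS]subr0 -uu g0S /shift_degree mulr2n.
  abelian.
- exact: homog_neq0M (homogV ah a0) (invr_neq0 a0) tc0.
have /(congr1 phi0) := zE; rewrite !(phiM (set_inv S)) (phiK (set_inv S)).
rewrite linearZ_LR -(twist_phi S) (phi_coef S hxi hqi vd ord); last by rewrite lt0n.
rewrite (phi_coef S hxi hqi vd' ord'); last by rewrite kS lt0n.
by rewrite pE pE' mulrA.
Qed.

Lemma class_data : exists (p : GmodT D -> D) (b : GmodT D -> bool), forall y, kappa y != 0%N ->
  [/\ p y \in homog D (u y), p y != 0 & forall a, (a < kappa y)%N ->
    let z := part' (y + piT D g, a) in let y' := z.1 - piT D g in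
    part (y, flip (b y) (kappa y) a) = (y', flip (b y') (kappa y') z.2) /\
    phi0 (p y) * c' (y + piT D g, a) * p y' = w *: twist m (c (y, flip (b y) (kappa y) a))].
Proof.
have ex y : exists pb : D * bool, inGT (dat_g0 d) y ->
    solution phi0 X xi qi d d' ps ps' g w m y pb.1 pb.2.
  have [yG|] := boolP (inGT (dat_g0 d) y); last by exists (0, false).
  have [p [b h]] := solution_exists S hxi hqi ps ps' vd vd' w_sign m_sign g0S kS sS yG.
  by exists (p, b).
pose h y := projT1 (cid (ex y)); have hP y : inGT (dat_g0 d) y ->
    solution phi0 X xi qi d d' ps ps' g w m y (h y).1 (h y).2 := projT2 (cid (ex y)).
pose z y := (phi0 (X (u y)) * c' (y + piT D g, 0%N))^-1 * (w *: twist m (c (y, 0%N))).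
(* Each dual pair is normalized on the class listed first in [ps]; its other class receives the
   factor determined by [dual_solution]. *)
pose p y := if inGT (dat_g0 d) y then (h y).1 else
  if y \in [seq p.1 | p <- ps] then X (u y) else z (dual y).
pose b y := if inGT (dat_g0 d) y then (h y).2 else false.
exists p, b => y yk.
have sub_add v : v + piT D g - piT D g = v by rewrite addrK.
case yG: (inGT (dat_g0 d) y).
  have [h1 h2 h3] := hP y yG; rewrite /p /b yG; split=> // a ak /=.
  have xG : inGT (dat_g0 d') (y + piT D g) by rewrite g0S inGT_shift.
  rewrite /partner xG yG sub_add yG kS g0S (sym_class_shift S hxi); split.
    congr (_, _); case: ifP => ys //; rewrite flip_swap //.
    by rewrite (kappa_even vd).
  have ch : c (y, flip (h y).2 (kappa y) a) \in homog D (tau xi (dat_g0 d) y).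
    apply: homog_eq (coef_homog S hxi hqi d ps _) _.
    by rewrite /partner yG /tau mulr2n addrA.
  by rewrite h3 // (twist_homog _ ch) scalerA.
have xG : inGT (dat_g0 d') (y + piT D g) = false by rewrite g0S inGT_shift.
have dG : inGT (dat_g0 d) (dual y) = false by rewrite inGT_dual.
have dE : dual_class (dat_g0 d') (y + piT D g) = dual y + piT D g.
  by rewrite g0S dual_class_shift.
(* Within a class that is not self-dual the coefficient does not depend on the position, so position
   0 stands for all. *)
have c0 a : c (y, a) = c (y, 0%N) by rewrite /coef yG.
have c0' a : c' (y + piT D g, a) = c' (y + piT D g, 0%N) by rewrite /coef xG.
have part_eq a : part (y, flip (b y) (kappa y) a) =
    ((part' (y + piT D g, a)).1 - piT D g, flip (b ((part' (y + piT D g, a)).1 - piT D g))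
    (kappa ((part' (y + piT D g, a)).1 - piT D g)) (part' (y + piT D g, a)).2).
  by rewrite /partner xG yG dE /= sub_add /b yG dG.
have fd := firsts_or_seconds ord yk yG.
case yf: (y \in [seq p.1 | p <- ps]).
  have [z1 z2 z3 _] := dual_solution yG yk yf.
  rewrite yf in fd; split=> [||a ak /=].
  - by rewrite /p yG yf (X_homog S).
  - by rewrite /p yG yf (X_neq0 S).
  split; first exact: part_eq.
  rewrite c0 c0' /partner xG dE /= sub_add /p yG yf dG fd /z dual_classK; exact: z3.
rewrite yf in fd.
have dk : kappa (dual y) != 0%N by rewrite (kappa_dual vd).
have [z1 z2 _ z4] := dual_solution dG dk fd; rewrite dual_classK in z1 z4.
split=> [||a ak /=].
- by rewrite /p yG yf.
- by rewrite /p yG yf.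
split; first exact: part_eq.
by rewrite c0 c0' /partner xG dE /= sub_add /p yG yf dG fd.
Qed.

End GluedClassData.

(** * From an orbit to an isomorphism *)

Section Converse.
Variables (R : realType) (G : zmodType) (D : gradedDivAlg R G).
Variables (phi0 : {linear D -> D}) (X : G -> D) (f : G) (xi : GmodT D -> G) (qi : D).
Hypotheses (S : setting phi0 X f) (hxi : cancel xi (@piT R G D)).
Hypothesis (hqi : isoH (homog D 0) -> qi \in homog D 0 /\ qi * qi = -1).
Local Notation T := (supp D).
Variables (d d' : datum D).
Variables (ms ms' : seq (GmodT D)) (ps ps' : seq (GmodT D * GmodT D)).
Hypotheses (vd : valid_datum phi0 X xi d) (vd' : valid_datum phi0 X xi d').
Hypotheses (ord : support_ordering d ms ps) (ord' : support_ordering d' ms' ps').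

Lemma iso_of_shift (g : G) (w : R) (m : G -> R) : (w = 1 \/ w = -1) ->
  (forall t, t \in T -> m t = 1 \/ m t = -1) -> {in T &, {morph m : s t / s + t >-> s * t}} ->
  dat_g0 d' = dat_g0 d - g *+ 2 ->
  (forall y, dat_kappa d' (y + piT D g) = dat_kappa d y) ->
  (forall y, inGT (dat_g0 d) y -> sig_class phi0 X xi (dat_g0 d) y ->
    let t := tau xi (dat_g0 d) y in let u := shift_degree xi g y in
    dat_sigma d' (y + piT D g) =
      etaX phi0 X u * real_sign ((X (t + u *+ 2))^-1 * X u * X t * X u) *
      (sgz w * (sgz (m t) * dat_sigma d y))) ->
  isomorphic (model phi0 X xi qi d ms ps) (model phi0 X xi qi d' ms' ps').
Proof.
move=> w_sign m_sign mM g0S kS sS.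
have [p [b pb]] := class_data S hxi hqi vd vd' ord ord' w_sign m_sign mM g0S kS sS.
have [cls [pos [pi H]]] := model_description qi vd ord.
have [cls' [pos' [pi' H']]] := model_description qi vd' ord'.
set n := mx_dim _ in cls pos pi H; set n' := mx_dim _ in cls' pos' pi' H'.
(* Row k of the second model is matched with the row of the first whose class is shifted back by g
   and whose position is flipped within the class. *)
pose y k := cls' k - piT D g; pose a k := flip (b (y k)) (dat_kappa d (y k)) (pos' k).
have yE k : y k + piT D g = cls' k by rewrite subrK.
have bound k : (pos' k < dat_kappa d (y k))%N by rewrite -kS yE (form_pos H').
have yk k : dat_kappa d (y k) != 0%N by rewrite -lt0n (leq_ltn_trans _ (bound k)).
have exr k : exists i, cls i = y k /\ pos i = a k.
  exact/(form_surj H)/flip_lt.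
pose r k := projT1 (cid (exr k)).
have rE k : cls (r k) = y k /\ pos (r k) = a k := projT2 (cid (exr k)).
have exr_inv i : exists k, cls' k = cls i + piT D g /\
    pos' k = flip (b (cls i)) (dat_kappa d (cls i)) (pos i).
  by apply: (form_surj H'); rewrite kS flip_lt ?(form_pos H).
pose r_inv i := projT1 (cid (exr_inv i)).
have r_invE i : cls' (r_inv i) = cls i + piT D g /\
    pos' (r_inv i) = flip (b (cls i)) (dat_kappa d (cls i)) (pos i) := projT2 (cid (exr_inv i)).
have rK : cancel r r_inv.
  move=> k; have [e1 e2] := rE k; have [e3 e4] := r_invE (r k); apply: (form_inj H').
    by rewrite e3 e1 yE.
  by rewrite e4 e1 e2 flipK.
have r_invK : cancel r_inv r.
  move=> i; have [e1 e2] := rE (r_inv i); have [e3 e4] := r_invE i.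
  have yi : y (r_inv i) = cls i by rewrite /y e3 addrK.
  by apply: (form_inj H); rewrite ?e1 // e2 /a yi e4 flipK ?(form_pos H).
have w0 : w != 0 by case: w_sign => ->; rewrite ?oppr_eq0 oner_neq0.
have data k : r (pi' k) = pi (r k) /\
    phi0 (p (y k)) * coef phi0 X xi qi d' ps' (cls' k, pos' k) * p (y (pi' k)) =
    w *: twist m (coef phi0 X xi qi d ps (cls (r k), pos (r k))).
  have [_ _ /(_ _ (bound k))] := pb _ (yk k); rewrite yE (form_partner H').
  have [-> ->] := rE k; case=> pe ce; split=> //.
  have [e1 e2] := rE (pi' k); have [e3 e4] := rE k.
  have := form_partner H (r k); rewrite e3 e4 pe => -[e5 e6].
  by apply: (form_inj H); rewrite ?e1 ?e2 -?e5 -?e6.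
rewrite /model (mx_inverse_form S hxi hqi vd H) (mx_inverse_form S hxi hqi vd' H').
have q_homog k : p (y k) \in homog D
    (- (row_degrees xi d' ms' ps')`_k + g + (row_degrees xi d ms ps)`_(r k)).
  have [ph _ _] := pb _ (yk k); apply: homog_eq ph _.
  rewrite -(oppT S (shift_degree_T hxi g (y k))) (form_deg H') (form_deg H) (rE k).1.
  rewrite /shift_degree yE; abelian.
have q_neq0 k : p (y k) != 0 by have [] := pb _ (yk k).
apply: (@monomial_isomorphic _ _ _ _ (set_inv S) _ _ (twist_endo m_sign mM) (twistK m_sign)
  (twist_phi S m) w0 _ _ _ _ rK r_invK _ (fun k => (row_degrees xi d ms ps)`_k)
  (fun k => (row_degrees xi d' ms' ps')`_k) g q_homog q_neq0
  (fun k => coef phi0 X xi qi d ps (cls k, pos k))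
  (fun k => coef phi0 X xi qi d' ps' (cls' k, pos' k)) pi pi').
- exact: (form_piK vd H).
- exact: (form_piK vd' H').
- exact: (form_coef_unit S hxi hqi d ps cls pos).
- exact: (form_coef_unit S hxi hqi d' ps' cls' pos').
- by move=> k; have [] := data k.
- by move=> k; have [] := data k.
- by move=> k l; rewrite mxE.
- exact: (form_Phi H).
- by move=> k l; rewrite mxE.
exact: (form_Phi H').
Qed.

(** The sign eps of the action is realized by the factor w of the isometry, the character mu by the
    automorphism [twist m]. *)
Lemma iso_of_action (g : G) (eps : int) (mu : G -> int) (m : G -> R) :
  (eps = 1 \/ eps = -1) -> (forall t, t \in T -> m t = 1 \/ m t = -1) ->
  {in T &, {morph m : s t / s + t >-> s * t}} ->
  (forall t, t \in inK D -> sgz (m t) = mu t) ->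
  d' = group_act phi0 X xi g (sign_act eps (Datum (dat_g0 d) (dat_kappa d)
    (fun x => mu (tau xi (dat_g0 d) x) * dat_sigma d x))) ->
  isomorphic (model phi0 X xi qi d ms ps) (model phi0 X xi qi d' ms' ps').
Proof.
move=> eps1 m_sign mM mmu dE; apply: (@iso_of_shift g eps%:~R m) => //.
- by case: eps1 => ->; [left | right; rewrite mulrN1z].
- by rewrite dE.
- by move=> y; rewrite dE /= addrK.
move=> y yG ys; rewrite dE /= addrK mmu ?(sig_class_K hxi yG ys) // /shift_degree.
by case: eps1 => ->; rewrite ?mulrN1z ?sgzN ?sgz1.
Qed.

End Converse.

Theorem corollary27 (R : realType) (G : zmodType) (D : gradedDivAlg R G)
  (hZ : center_condition D)
  (phi0 : {linear D -> D})
  (hphi0 : degree_preserving_involution phi0)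
  (hconj : restricts_to_conj phi0 (homog D 0))
  (hphi0Z : exists2 z, z \in 'Z({:D})%VS & phi0 z != z)
  (X : G -> D) (hX : homogeneous_choice phi0 X)
  (xi : GmodT D -> G) (hxi : cancel xi (@piT R G D))
  (qi : D)
  (hqi : isoH (homog D 0) -> qi \in homog D 0 /\ qi * qi = -1)
  (f : G)
  (hf : forall g, ('Z({:D}) :&: homog D g != 0)%VS = (g \in [:: 0; f]))
  (nu : G -> int) (hnu : sign_character D nu) (hnuf : nu f = -1)
  (d d' : datum D)
  (hd : valid_datum phi0 X xi d) (hd' : valid_datum phi0 X xi d')
  (ms : seq (GmodT D)) (ps : seq (GmodT D * GmodT D))
  (hord : support_ordering d ms ps)
  (ms' : seq (GmodT D)) (ps' : seq (GmodT D * GmodT D))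
  (hord' : support_ordering d' ms' ps') :
  isomorphic (model phi0 X xi qi d ms ps) (model phi0 X xi qi d' ms' ps') <->
  (in_action_orbit phi0 X xi d d' \/ in_action_orbit phi0 X xi (nu_twist xi nu d) d').
Proof.
(* nu(0) is its own square, hence not -1, so nu(f) = -1 separates f from 0. *)
have f0 : f != 0.
  have [nu1 nuM] := hnu; have := nuM _ _ (inK0 D) (inK0 D); rewrite addr0.
  by apply: contra_eq_neq => f0; rewrite -f0 hnuf.
have S := Setting hZ hphi0 hconj hphi0Z hX hf f0.
split; first exact: (orbit_of_iso S hxi hqi hnu hnuf hd hd' hord hord').
case=> -[g [eps [eps1 dE]]].
  apply: (iso_of_action S hxi hqi hd hd' hord hord' (mu := fun _ => 1) (m := fun _ => 1) eps1).
  - by left.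
  - by move=> s t _ _; rewrite mulr1.
  - by move=> t _; rewrite sgz1.
  rewrite dE; congr (group_act _ _ _ _ (sign_act _ _)).
  by apply: datum_ext => // x /=; rewrite mul1r.
have [m [m_sign mM mK]] := extend_character S hnu; have [nu1 _] := hnu.
apply: (iso_of_action S hxi hqi hd hd' hord hord' (mu := nu) eps1 m_sign mM _ dE) => t tK.
by rewrite mK //; case: (nu1 t tK) => ->; rewrite ?mulrN1z ?sgzN sgz1.
Qed.
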